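(* For all integers $n\ge 279$, $$4\left(1+\frac{\pi^2}{32n^3}\right)q(n)q(n+2)>q(n-1)q(n+3)+3q(n+1)^2.$$
   Context: $q(n)$ denotes the number of partitions of $n$ into distinct parts. *)

(* Defs.v *)
From mathcomp Require Import all_boot.

Set Implicit Arguments.
Unset Strict Implicit.
Unset Printing Implicit Defensive.

(* A partition of [n] into distinct parts is a finite set of positive integers
   with sum [n]; its parts are at most [n], so it is a subset of {0, ..., n}
   that does not contain 0. In particular [q 0 = 1] (the empty partition). *)
Definition distinct_partitions (n : nat) : {set {set 'I_n.+1}} :=
  [set A : {set 'I_n.+1} | (ord0 \notin A) && (\sum_(i in A) i == n)].

Definition q (n : nat) : nat := #|distinct_partitions n|.

(* Main.v *)
(** Euler's identity and the partial fractions of [coth] show that the logarithm of the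
    generating function [prod_k (1 + exp (- k t))] is [A / t + t / 24 - c] for [A = PI^2 / 12]
    and a constant [c], up to an error of order [exp (- 2 Re (PI^2 / t))]. By Cauchy's formula,
    [q n] is then [exp (- c) * f (n + 1/24)] up to an exponentially small relative error, where
    [f x = sqrt (A / x) * I_1 (2 sqrt (A x))] has the Laplace transform [exp (A / t) - 1]. The logarithmic
    derivative of [f] solves a Riccati equation, and comparison with explicit sub- and
    supersolutions yields [f(x-1) f(x+1) = f(x)^2 exp (- u)] and
    [f(x-2) f(x+2) = f(x)^2 exp (- v)] with [4 u <= v] and [u] small enough for
    [(4 + PI^2 / (8 n^3)) exp (- u) > exp (- 4 u) + 3] with room for the error as soon as
    [8000 <= n]. Smaller [n] are checked on a table of [q], computed from
    [sum_n q n x^n = sum_k prod_(j <= k) x^j / (1 - x^j)]. *)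

Require Import Defs.
From Stdlib Require Import Arith NArith Factorial Reals Lra Lia List.
From Stdlib Require Import FunctionalExtensionality.
From Coquelicot Require Import Coquelicot.

Open Scope R_scope.

(** The constant [PI^2 / 32] is sharp to leading order, which dictates the precision. With
    [w = n^(-1/2)] and [u] close to [(al / 2) w^3], [al^2 = A], the expansion [4 exp (- u) - exp (-
    4 u) - 3 = - 6 u^2 + ...] loses [(3 / 2) A w^6], exactly what [PI^2 / (8 n^3)] adds. The sign is
    decided at order [w^7], so [u] is needed with its second term and [q] with a relative error
    below a small multiple of [w^7]. Hence the main term stays an exact Bessel function instead of
    an asymptotic series. The modular relation comes from a signed double series of
    [t / ((m t)^2 + (PI l)^2)] summed in both orders; it converges absolutely only after pairing
    neighbouring [l]. The major arc is the part of the line [Re t = s] with [Re (PI^2 / t) >= 1], a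
    chord of the circle [Cmod t = PI sqrt s], over which the kernel integrates exactly to the Bessel
    function. Elsewhere the first term of the logarithm loses about [1 / (2 s)] in the exponent,
    roughly [0.55 sqrt n], which beats the powers of [n] by [n = 8000]. *)

(** * The complex exponential *)

Definition Cexp (z : C) : C :=
  (exp (fst z) * cos (snd z), exp (fst z) * sin (snd z)).

Lemma Cexp_plus (a b : C) : Cexp (a + b) = (Cexp a * Cexp b)%C.
Proof.
  unfold Cexp, Cmult; simpl; rewrite exp_plus, cos_plus, sin_plus.
  apply injective_projections; simpl; ring.
Qed.

Lemma Cexp_0 : Cexp 0 = 1.
Proof.
  unfold Cexp; simpl; rewrite exp_0, cos_0, sin_0.
  apply injective_projections; simpl; ring.
Qed.

Lemma Cexp_opp_r (a : C) : (Cexp a * Cexp (- a))%C = 1.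
Proof. rewrite <- Cexp_plus, Cplus_opp_r; apply Cexp_0. Qed.

Lemma Cmod_sqr (z : C) : Cmod z * Cmod z = fst z * fst z + snd z * snd z.
Proof.
  unfold Cmod; rewrite sqrt_sqrt; [ring|].
  apply Rplus_le_le_0_compat; apply pow2_ge_0.
Qed.

Lemma Cmod_Cexp (z : C) : Cmod (Cexp z) = exp (Re z).
Proof.
  apply Rsqr_inj; [apply Cmod_ge_0 | left; apply exp_pos |].
  unfold Rsqr; rewrite Cmod_sqr; unfold Cexp, Re; simpl.
  assert (H := sin2_cos2 (snd z)); unfold Rsqr in H.
  transitivity (exp (fst z) * exp (fst z) *
    (sin (snd z) * sin (snd z) + cos (snd z) * cos (snd z))); [ring|].
  rewrite H; ring.
Qed.

Lemma Cexp_neq_0 (z : C) : Cexp z <> 0.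
Proof. apply Cmod_gt_0; rewrite Cmod_Cexp; apply exp_pos. Qed.

Lemma Cexp_opp (a : C) : Cexp (- a) = (/ Cexp a)%C.
Proof.
  assert (H := Cexp_neq_0 a). 
  rewrite <- (Cmult_1_l (Cexp (- a))), <- (Cinv_l _ H), <- Cmult_assoc, Cexp_opp_r.
  ring.
Qed.

Lemma Cexp_INR_mult (n : nat) (z : C) : Cexp (INR n * z) = (Cexp z ^ n)%C.
Proof.
  induction n as [|n IH].
  - simpl; rewrite Cmult_0_l; apply Cexp_0.
  - rewrite S_INR, RtoC_plus, Cpow_S, <- IH, <- Cexp_plus; f_equal; ring.
Qed.

Lemma Cexp_RtoC (x : R) : Cexp x = RtoC (exp x).
Proof.
  unfold Cexp; simpl; rewrite cos_0, sin_0.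
  apply injective_projections; simpl; ring.
Qed.

Lemma Cmod_minus_sym (a b : C) : Cmod (a - b) = Cmod (b - a).
Proof. rewrite <- Cmod_opp; f_equal; ring. Qed.

Lemma Cmod_triangle_minus (a b : C) : Cmod (a - b) <= Cmod a + Cmod b.
Proof. unfold Cminus; rewrite <- (Cmod_opp b); apply Cmod_triangle. Qed.

Lemma Cmod_triangle_inv (a b : C) : Cmod a - Cmod b <= Cmod (a - b).
Proof.
  assert (H := Cmod_triangle (a - b) b).
  replace (a - b + b)%C with a in H by ring; lra.
Qed.

Lemma Cmod_dist_triangle (a b c : C) : Cmod (a - c) <= Cmod (a - b) + Cmod (b - c).
Proof.
  replace (a - c)%C with ((a - b) + (b - c))%C by ring; apply Cmod_triangle.
Qed.

Lemma Re_le_Cmod (z : C) : Re z <= Cmod z.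
Proof. eapply Rle_trans; [apply Rle_abs | apply re_le_Cmod]. Qed.

Lemma im_le_Cmod (z : C) : Rabs (Im z) <= Cmod z.
Proof. eapply Rle_trans; [apply Rmax_r | apply Rmax_Cmod]. Qed.

(** * Curves in the complex plane *)

(** Complex functions are only differentiated along real parameters, so a componentwise derivative
    takes the place of holomorphy. *)
Definition is_Cderive (h : R -> C) (u : R) (d : C) : Prop :=
  is_derive (fun x => fst (h x)) u (fst d) /\
  is_derive (fun x => snd (h x)) u (snd d).

Lemma is_Cderive_const (a : C) (u : R) : is_Cderive (fun _ => a) u 0.
Proof. split; simpl; auto_derive; auto. Qed.

Lemma is_Cderive_ext (f g : R -> C) (u : R) (d : C) :
  (forall x, f x = g x) -> is_Cderive f u d -> is_Cderive g u d.
Proof.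
  intros E [H1 H2]; split.
  - apply (is_derive_ext (fun x => fst (f x))); [|exact H1]; intros; now rewrite E.
  - apply (is_derive_ext (fun x => snd (f x))); [|exact H2]; intros; now rewrite E.
Qed.

Lemma is_Cderive_plus (f g : R -> C) (u : R) (a b : C) :
  is_Cderive f u a -> is_Cderive g u b ->
  is_Cderive (fun x => f x + g x)%C u (a + b)%C.
Proof.
  intros [H1 H2] [H3 H4]; split; simpl.
  - exact (is_derive_plus _ _ u _ _ H1 H3).
  - exact (is_derive_plus _ _ u _ _ H2 H4).
Qed.

Lemma is_derive_mult_R (f g : R -> R) (u a b : R) :
  is_derive f u a -> is_derive g u b ->
  is_derive (fun x => f x * g x) u (a * g u + f u * b).
Proof.
  intros H1 H2.
  apply (is_derive_mult f g u a b H1 H2); intros; apply Rmult_comm.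
Qed.

Lemma is_Cderive_mult (f g : R -> C) (u : R) (a b : C) :
  is_Cderive f u a -> is_Cderive g u b ->
  is_Cderive (fun x => f x * g x)%C u (a * g u + f u * b)%C.
Proof.
  intros [H1 H2] [H3 H4]; split; simpl.
  - replace (_ + _)
      with ((fst a * fst (g u) + fst (f u) * fst b) -
            (snd a * snd (g u) + snd (f u) * snd b)) by ring.
    apply (is_derive_minus (fun x => fst (f x) * fst (g x))
      (fun x => snd (f x) * snd (g x))); now apply is_derive_mult_R.
  - replace (_ + _)
      with ((fst a * snd (g u) + fst (f u) * snd b) +
            (snd a * fst (g u) + snd (f u) * fst b)) by ring.
    apply (is_derive_plus (fun x => fst (f x) * snd (g x))
      (fun x => snd (f x) * fst (g x))); now apply is_derive_mult_R.
Qed.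

Lemma is_Cderive_Cexp (f : R -> C) (u : R) (a : C) :
  is_Cderive f u a -> is_Cderive (fun x => Cexp (f x)) u (a * Cexp (f u))%C.
Proof.
  intros [H1 H2].
  assert (He : is_derive (fun x => exp (fst (f x))) u (fst a * exp (fst (f u)))).
  { apply (is_derive_comp exp (fun x => fst (f x))); [|exact H1].
    auto_derive; auto; ring. }
  assert (Hc : is_derive (fun x => cos (snd (f x))) u (snd a * - sin (snd (f u)))).
  { apply (is_derive_comp cos (fun x => snd (f x))); [|exact H2].
    auto_derive; auto; ring. }
  assert (Hs : is_derive (fun x => sin (snd (f x))) u (snd a * cos (snd (f u)))).
  { apply (is_derive_comp sin (fun x => snd (f x))); [|exact H2].
    auto_derive; auto; ring. }
  split; simpl.
  - replace (_ - _) with (fst a * exp (fst (f u)) * cos (snd (f u)) +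
      exp (fst (f u)) * (snd a * - sin (snd (f u)))) by ring.
    now apply (is_derive_mult_R (fun x => exp (fst (f x))) (fun x => cos (snd (f x)))).
  - replace (_ + _) with (fst a * exp (fst (f u)) * sin (snd (f u)) +
      exp (fst (f u)) * (snd a * cos (snd (f u)))) by ring.
    now apply (is_derive_mult_R (fun x => exp (fst (f x))) (fun x => sin (snd (f x)))).
Qed.

Lemma is_Cderive_line (z : C) (u : R) : is_Cderive (fun x => x * z)%C u z.
Proof. split; simpl; auto_derive; auto; ring. Qed.

Lemma is_Cderive_pow (z : C) (n : nat) (u : R) :
  is_Cderive (fun x => (x * z) ^ n)%C u (INR n * z * (u * z) ^ (pred n))%C.
Proof.
  assert (H1 := is_Cderive_line z u).
  induction n as [|n IH].
  - simpl; rewrite !Cmult_0_l; apply is_Cderive_const.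
  - apply (is_Cderive_ext (fun x => (x * z) * (x * z) ^ n)%C).
    { intros; now rewrite Cpow_S. }
    replace (INR (S n) * z * (u * z) ^ pred (S n))%C
      with (z * (u * z) ^ n + (u * z) * (INR n * z * (u * z) ^ pred n))%C.
    + now apply is_Cderive_mult.
    + rewrite S_INR, RtoC_plus; simpl pred.
      destruct n as [|n]; [simpl; ring|]; simpl pred; rewrite Cpow_S; ring.
Qed.

Lemma increasing_of_derive_nonneg (f df : R -> R) (a b : R) :
  a <= b -> (forall x, a <= x <= b -> is_derive f x (df x)) ->
  (forall x, a <= x <= b -> 0 <= df x) -> f a <= f b.
Proof.
  intros Hab Hd Hp.
  destruct (MVT_gen f a b df) as [c [Hc E]].
  - intros x Hx; apply Hd; rewrite Rmin_left, Rmax_right in Hx; lra.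
  - intros x Hx; rewrite Rmin_left, Rmax_right in Hx by lra.
    apply continuity_pt_filterlim, (ex_derive_continuous f).
    exists (df x); apply Hd; lra.
  - rewrite Rmin_left, Rmax_right in Hc by lra.
    assert (0 <= df c * (b - a)) by (apply Rmult_le_pos; [apply Hp|]; lra); lra.
Qed.

(* The inequality follows from the real one applied to the projection of the
   curve on the direction of [h 1 - h 0]. *)
Lemma Cmod_increment_le (h h' : R -> C) (g g' : R -> R) :
  (forall u, 0 <= u <= 1 -> is_Cderive h u (h' u)) ->
  (forall u, 0 <= u <= 1 -> is_derive g u (g' u)) ->
  (forall u, 0 <= u <= 1 -> Cmod (h' u) <= g' u) ->
  Cmod (h 1 - h 0) <= g 1 - g 0.
Proof.
  intros Hh Hg Hb.
  set (d := (h 1 - h 0)%C).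
  destruct (Req_dec (Cmod d) 0) as [E|E].
  { rewrite E.
    assert (g 0 <= g 1); [|lra].
    apply (increasing_of_derive_nonneg g g'); [lra | exact Hg |].
    intros x Hx; eapply Rle_trans; [apply Cmod_ge_0 | now apply Hb]. }
  assert (Hd : 0 < Cmod d) by (assert (H := Cmod_ge_0 d); lra).
  assert (H : g 0 * Cmod d - (fst (h 0) * fst d + snd (h 0) * snd d) <=
              g 1 * Cmod d - (fst (h 1) * fst d + snd (h 1) * snd d)).
  { apply (increasing_of_derive_nonneg
      (fun u => g u * Cmod d - (fst (h u) * fst d + snd (h u) * snd d))
      (fun u => g' u * Cmod d - (fst (h' u) * fst d + snd (h' u) * snd d)));
      [lra | |].
    - intros x Hx; destruct (Hh x Hx) as [H1 H2].
      apply (is_derive_minus (fun u => g u * Cmod d)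
        (fun u => fst (h u) * fst d + snd (h u) * snd d)).
      + replace (g' x * Cmod d) with (g' x * Cmod d + g x * 0) by ring.
        apply is_derive_mult_R; [now apply Hg | apply (@is_derive_const R_AbsRing)].
      + apply (is_derive_plus (fun u => fst (h u) * fst d) (fun u => snd (h u) * snd d)).
        * replace (fst (h' x) * fst d) with (fst (h' x) * fst d + fst (h x) * 0) by ring.
          apply is_derive_mult_R; [exact H1 | apply (@is_derive_const R_AbsRing)].
        * replace (snd (h' x) * snd d) with (snd (h' x) * snd d + snd (h x) * 0) by ring.
          apply is_derive_mult_R; [exact H2 | apply (@is_derive_const R_AbsRing)].
    - intros x Hx.
      assert (H1 := Re_le_Cmod (h' x * Cconj d)).
      rewrite re_mult, re_conj, im_conj, Cmod_mult, Cmod_conj in H1; unfold Re, Im in H1.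
      assert (H2 := Rmult_le_compat_r _ _ _ (Rlt_le _ _ Hd) (Hb x Hx)); lra. }
  assert (H2 : Cmod d * Cmod d <= Cmod d * (g 1 - g 0)).
  { rewrite Cmod_sqr.
    assert (E1 : fst d = fst (h 1) - fst (h 0)) by (unfold d; simpl; ring).
    assert (E2 : snd d = snd (h 1) - snd (h 0)) by (unfold d; simpl; ring).
    rewrite E1 at 1; rewrite E2 at 1; nra. }
  now apply Rmult_le_reg_l in H2.
Qed.

(** * Finite sums and Taylor remainders *)

Fixpoint Csum (f : nat -> C) (n : nat) : C :=
  match n with O => 0 | S k => (Csum f k + f k)%C end.

Fixpoint Rsum (f : nat -> R) (n : nat) : R :=
  match n with O => 0 | S k => Rsum f k + f k end.

Lemma Csum_ext (f g : nat -> C) (n : nat) :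
  (forall k, (k < n)%nat -> f k = g k) -> Csum f n = Csum g n.
Proof.
  induction n as [|n IH]; intros H; [reflexivity|]; simpl.
  rewrite IH, (H n) by (auto; intros; apply H; lia); reflexivity.
Qed.

Lemma Rsum_ext (f g : nat -> R) (n : nat) :
  (forall k, (k < n)%nat -> f k = g k) -> Rsum f n = Rsum g n.
Proof.
  induction n as [|n IH]; intros H; [reflexivity|]; simpl.
  rewrite IH, (H n) by (auto; intros; apply H; lia); reflexivity.
Qed.

Lemma Csum_plus (f g : nat -> C) (n : nat) :
  Csum (fun k => f k + g k)%C n = (Csum f n + Csum g n)%C.
Proof. induction n as [|n IH]; simpl; [ring | rewrite IH; ring]. Qed.

Lemma Rsum_plus (f g : nat -> R) (n : nat) :
  Rsum (fun k => f k + g k) n = Rsum f n + Rsum g n.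
Proof. induction n as [|n IH]; simpl; [ring | rewrite IH; ring]. Qed.

Lemma Csum_minus (f g : nat -> C) (n : nat) :
  Csum (fun k => f k - g k)%C n = (Csum f n - Csum g n)%C.
Proof. induction n as [|n IH]; simpl; [ring | rewrite IH; ring]. Qed.

Lemma Csum_mult_l (a : C) (f : nat -> C) (n : nat) :
  Csum (fun k => a * f k)%C n = (a * Csum f n)%C.
Proof. induction n as [|n IH]; simpl; [ring | rewrite IH; ring]. Qed.

Lemma Rsum_mult_l (a : R) (f : nat -> R) (n : nat) :
  Rsum (fun k => a * f k) n = a * Rsum f n.
Proof. induction n as [|n IH]; simpl; [ring | rewrite IH; ring]. Qed.

Lemma Csum_add (f : nat -> C) (n m : nat) :
  Csum f (n + m) = (Csum f n + Csum (fun k => f (n + k)%nat) m)%C.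
Proof.
  induction m as [|m IH]; [rewrite Nat.add_0_r; simpl; ring|].
  rewrite Nat.add_succ_r; simpl; rewrite IH; ring.
Qed.

Lemma Csum_S_l (f : nat -> C) (n : nat) :
  Csum f (S n) = (f O + Csum (fun k => f (S k)) n)%C.
Proof. change (S n) with (1 + n)%nat; rewrite (Csum_add f 1 n); simpl; ring. Qed.

Lemma Csum_RtoC (f : nat -> R) (n : nat) :
  Csum (fun k => RtoC (f k)) n = RtoC (Rsum f n).
Proof. induction n as [|n IH]; simpl; [|rewrite IH, RtoC_plus]; reflexivity. Qed.

Lemma Rsum_le (f g : nat -> R) (n : nat) :
  (forall k, (k < n)%nat -> f k <= g k) -> Rsum f n <= Rsum g n.
Proof.
  induction n as [|n IH]; intros H; simpl; [lra|].
  apply Rplus_le_compat; [apply IH; intros; apply H; lia | apply H; lia].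
Qed.

Lemma Rsum_nonneg (f : nat -> R) (n : nat) :
  (forall k, (k < n)%nat -> 0 <= f k) -> 0 <= Rsum f n.
Proof.
  induction n as [|n IH]; intros H; simpl; [lra|].
  apply Rplus_le_le_0_compat; [apply IH; intros; apply H; lia | apply H; lia].
Qed.

Lemma Rsum_const (a : R) (n : nat) : Rsum (fun _ => a) n = INR n * a.
Proof. induction n as [|n IH]; [simpl; ring|]; rewrite S_INR; simpl; rewrite IH; ring. Qed.

Lemma Cmod_Csum_le (f : nat -> C) (g : nat -> R) (n : nat) :
  (forall k, (k < n)%nat -> Cmod (f k) <= g k) -> Cmod (Csum f n) <= Rsum g n.
Proof.
  induction n as [|n IH]; intros H; simpl; [rewrite Cmod_0; lra|].
  eapply Rle_trans; [apply Cmod_triangle|].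
  apply Rplus_le_compat; [apply IH; intros; apply H; lia | apply H; lia].
Qed.

Lemma Csum_geom (z : C) (n : nat) : ((1 - z) * Csum (fun k => z ^ k) n = 1 - z ^ n)%C.
Proof.
  induction n as [|n IH]; [simpl; ring|].
  simpl Csum; rewrite Cmult_plus_distr_l, IH, Cpow_S; ring.
Qed.

Lemma Rsum_geom_lt (x : R) (n : nat) : 0 <= x < 1 -> Rsum (fun k => x ^ k) n <= / (1 - x).
Proof.
  intros Hx.
  assert (E : (1 - x) * Rsum (fun k => x ^ k) n = 1 - x ^ n).
  { induction n as [|n IH]; simpl; [ring|]; rewrite Rmult_plus_distr_l, IH; ring. }
  apply (Rmult_le_reg_l (1 - x)); [lra|]; rewrite E, Rinv_r by lra.
  assert (0 <= x ^ n) by (apply pow_le; lra); lra.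
Qed.

Lemma is_Cderive_Csum (f : nat -> R -> C) (f' : nat -> C) (u : R) (n : nat) :
  (forall k, is_Cderive (f k) u (f' k)) ->
  is_Cderive (fun x => Csum (fun k => f k x) n) u (Csum f' n).
Proof.
  intros H; induction n as [|n IH]; simpl.
  - apply is_Cderive_const.
  - now apply (is_Cderive_plus (fun x => Csum (fun k => f k x) n) (f n)).
Qed.

(** Along [u |-> u z] the derivative of the remainder of order [n + 1] is [z] times the remainder of
    order [n]; the induction hypothesis is integrated over [u] by [Cmod_increment_le], with
    [exp (u |z|)] replaced by [exp |z|]. *)
Lemma Cmod_exp_taylor (n : nat) (z : C) :
  Cmod (Cexp z - Csum (fun k => z ^ k / INR (fact k))%C n) <=
  Cmod z ^ n / INR (fact n) * exp (Cmod z).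
Proof.
  revert z; induction n as [|n IH]; intros z.
  { simpl; replace (Cexp z - 0)%C with (Cexp z) by ring.
    rewrite Cmod_Cexp.
    replace (1 / 1 * exp (Cmod z)) with (exp (Cmod z)) by field.
    destruct (Re_le_Cmod z) as [H|H]; [left; now apply exp_increasing | right; now rewrite H]. }
  set (h := fun u : R => (Cexp (u * z) + -1 * Csum (fun k => (u * z) ^ k / INR (fact k)) (S n))%C).
  set (g := fun u : R => Cmod z ^ (S n) / INR (fact (S n)) * exp (Cmod z) * u ^ S n).
  assert (Hf := INR_fact_neq_0 n).
  assert (Hn : INR (S n) <> 0) by (apply not_0_INR; lia).
  replace (Cexp z - _)%C with (h 1 - h 0)%C.
  2:{ unfold h; rewrite !Cmult_1_l, Cmult_0_l, Cexp_0.
      rewrite (Csum_S_l (fun k => 0 ^ k / INR (fact k)))%C.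
      replace (Csum (fun k : nat => 0 ^ S k / INR (fact (S k))) n)%C with (RtoC 0).
      - simpl; field; intros E; apply RtoC_inj in E; lra.
      - symmetry; rewrite (Csum_ext _ (fun _ => 0 * 0)%C), Csum_mult_l; [ring|].
        intros; rewrite Cpow_S; unfold Cdiv; ring. }
  replace (_ / _ * _) with (g 1 - g 0).
  2:{ unfold g; rewrite pow1, pow_i by lia; ring. }
  apply (Cmod_increment_le h
    (fun u => z * (Cexp (u * z) - Csum (fun k => (u * z) ^ k / INR (fact k)) n))%C g
    (fun u => Cmod z ^ (S n) / INR (fact n) * exp (Cmod z) * u ^ n)).
  - intros u Hu; unfold h.
    replace (z * _)%C with (z * Cexp (u * z) + (0 * Csum (fun k => (u * z) ^ k / INR (fact k)) (S n)
      + -1 * Csum (fun k => INR k * z * (u * z) ^ (pred k) / INR (fact k)) (S n)))%C.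
    2:{ rewrite Cmult_0_l, Cplus_0_l, Csum_S_l; simpl INR at 1.
        rewrite (Csum_ext _ (fun k => z * ((u * z) ^ k / INR (fact k)))%C), Csum_mult_l.
        - unfold Cdiv; ring.
        - intros k _; simpl pred.
          rewrite fact_simpl, mult_INR, RtoC_mult; field.
          split; intros E; apply RtoC_inj in E; [revert E; apply INR_fact_neq_0 |].
          revert E; apply not_0_INR; lia. }
    assert (Hz := is_Cderive_line z u).
    apply is_Cderive_plus; [now apply is_Cderive_Cexp|].
    apply (is_Cderive_mult (fun _ => -1)%C); [apply is_Cderive_const|].
    apply (is_Cderive_Csum (fun k x => (x * z) ^ k / INR (fact k))%C).
    intros k; unfold Cdiv.
    replace (_ * _ * _)%C with ((INR k * z * (u * z) ^ pred k) * / INR (fact k)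
      + (u * z) ^ k * 0)%C by ring.
    apply (is_Cderive_mult (fun x => (x * z) ^ k)%C);
      [apply is_Cderive_pow | apply is_Cderive_const].
  - intros u Hu; unfold g.
    rewrite fact_simpl, mult_INR.
    auto_derive; [auto|].
    change (match n with 0%nat => 1 | S _ => INR n + 1 end) with (INR (S n)).
    simpl pred; change (Cmod z ^ S n) with (Cmod z * Cmod z ^ n); field; auto.
  - intros u Hu; rewrite Cmod_mult.
    eapply Rle_trans; [apply Rmult_le_compat_l; [apply Cmod_ge_0 | apply IH]|].
    rewrite Cmod_mult, Cmod_R, Rabs_pos_eq, Rpow_mult_distr by lra.
    assert (Hz := Cmod_ge_0 z).
    assert (He : exp (u * Cmod z) <= exp (Cmod z)).
    { assert (H : u * Cmod z <= Cmod z) by nra.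
      destruct H as [H|H]; [left; now apply exp_increasing | right; now rewrite H]. }
    assert (Hp : 0 <= Cmod z ^ S n / INR (fact n) * u ^ n).
    { apply Rmult_le_pos; [|apply pow_le; lra].
      apply Rdiv_le_0_compat; [now apply pow_le | apply INR_fact_lt_0]. }
    apply (Rmult_le_compat_l _ _ _ Hp) in He; simpl pow in *.
    unfold Rdiv in *; lra.
Qed.

Lemma exp_le (x y : R) : x <= y -> exp x <= exp y.
Proof. intros [H|H]; [left; now apply exp_increasing | right; now rewrite H]. Qed.

Lemma Cmod_exp_minus_1 (z : C) : Cmod (Cexp z - 1) <= Cmod z * exp (Cmod z).
Proof.
  assert (H := Cmod_exp_taylor 1 z); simpl in H.
  replace (Cmod z * 1 / 1 * exp (Cmod z)) with (Cmod z * exp (Cmod z)) in H by field.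
  replace (Cexp z - 1)%C with (Cexp z - (0 + 1 / 1))%C; [exact H | field].
Qed.

(** Taylor sums of [- log (1 - z)]. Only their exponentials are compared with [1 - z], so no branch
    of the complex logarithm has to be chosen. *)
Definition Clog_sum (z : C) (n : nat) : C := Csum (fun k => z ^ S k / INR (S k))%C n.

Lemma RtoC_neq_0 (x : R) : x <> 0 -> RtoC x <> 0.
Proof. intros H E; apply H, RtoC_inj, E. Qed.

Lemma Cmod_Clog_sum_le (z : C) (n : nat) :
  Cmod z < 1 -> Cmod (Clog_sum z n) <= Cmod z / (1 - Cmod z).
Proof.
  intros Hz; assert (H0 := Cmod_ge_0 z).
  apply Rle_trans with (Rsum (fun k => Cmod z * Cmod z ^ k) n).
  - apply Cmod_Csum_le; intros k _.
    assert (1 <= INR (S k)) by (rewrite S_INR; assert (H := pos_INR k); lra).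
    rewrite Cmod_div by (apply RtoC_neq_0; lra).
    rewrite Cmod_pow, Cmod_R, Rabs_pos_eq by lra.
    change (Cmod z ^ S k) with (Cmod z * Cmod z ^ k).
    assert (0 <= Cmod z * Cmod z ^ k) by (apply Rmult_le_pos; [|apply pow_le]; lra).
    apply Rle_div_l; [lra|]; nra.
  - rewrite Rsum_mult_l; unfold Rdiv; apply Rmult_le_compat_l; [lra|].
    apply Rsum_geom_lt; lra.
Qed.

(* The derivative of u |-> (1 - u z) exp (sum_(k <= n) (u z)^k / k) is
   - z (u z)^n exp(...). *)
Lemma one_minus_mult_exp_log_sum (z : C) (n : nat) :
  Cmod z < 1 ->
  Cmod ((1 - z) * Cexp (Clog_sum z n) - 1) <=
  Cmod z ^ S n * exp (Cmod z / (1 - Cmod z)).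
Proof.
  intros Hz; assert (H0 := Cmod_ge_0 z).
  set (h := fun u : R => ((1 + u * (-1 * z)) * Cexp (Clog_sum (u * z) n))%C).
  set (g := fun u : R => Cmod z ^ S n * exp (Cmod z / (1 - Cmod z)) * u).
  replace (_ - 1)%C with (h 1 - h 0)%C.
  2:{ unfold h; rewrite !Cmult_1_l, !Cmult_0_l.
      replace (Clog_sum 0 n) with (RtoC 0); [rewrite Cexp_0; ring|].
      symmetry; unfold Clog_sum; rewrite (Csum_ext _ (fun _ => 0 * 0)%C), Csum_mult_l; [ring|].
      intros; rewrite Cpow_S; unfold Cdiv; ring. }
  replace (_ ^ S n * _) with (g 1 - g 0) by (unfold g; ring).
  apply (Cmod_increment_le h
    (fun u => - z * (u * z) ^ n * Cexp (Clog_sum (u * z) n))%C g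
    (fun u => Cmod z ^ S n * exp (Cmod z / (1 - Cmod z)))).
  - intros u Hu; unfold h.
    assert (Hl : is_Cderive (fun x => Clog_sum (x * z) n) u (z * Csum (fun k => (u * z) ^ k) n)%C).
    { rewrite <- Csum_mult_l.
      apply (is_Cderive_Csum (fun k x => (x * z) ^ S k / INR (S k))%C).
      intros k; unfold Cdiv.
      replace (z * (u * z) ^ k)%C with
        ((INR (S k) * z * (u * z) ^ pred (S k)) * / INR (S k) + (u * z) ^ S k * 0)%C.
      - apply (is_Cderive_mult (fun x => (x * z) ^ S k)%C);
          [apply is_Cderive_pow | apply is_Cderive_const].
      - simpl pred; field; apply RtoC_neq_0, not_0_INR; lia. }
    assert (H1 : is_Cderive (fun x : R => 1 + x * (-1 * z))%C u (- z)%C).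
    { replace (- z)%C with (0 + -1 * z)%C by ring.
      apply is_Cderive_plus; [apply is_Cderive_const | apply is_Cderive_line]. }
    assert (H2 := is_Cderive_mult _ _ _ _ _ H1 (is_Cderive_Cexp _ _ _ Hl)).
    replace (- z * (u * z) ^ n * _)%C with
      (- z * Cexp (Clog_sum (u * z) n) + (1 + u * (-1 * z)) *
        (z * Csum (fun k : nat => (u * z) ^ k) n * Cexp (Clog_sum (u * z) n)))%C; [exact H2|].
    assert (E := Csum_geom (u * z) n).
    replace ((1 + u * (-1 * z)) * (z * Csum (fun k : nat => (u * z) ^ k) n * Cexp (Clog_sum (u * z) n)))%C
      with (((1 - u * z) * Csum (fun k : nat => (u * z) ^ k) n) * (z * Cexp (Clog_sum (u * z) n)))%C by ring.
    rewrite E; ring.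
  - intros u Hu; unfold g; auto_derive; [auto | apply Rmult_1_r].
  - intros u Hu.
    rewrite !Cmod_mult, Cmod_opp, Cmod_Cexp, Cmod_pow, Cmod_mult, Cmod_R, Rabs_pos_eq by lra.
    assert (Huz : u * Cmod z <= Cmod z) by nra.
    assert (Huz0 : 0 <= u * Cmod z) by nra.
    apply Rmult_le_compat.
    + apply Rmult_le_pos; [lra | now apply pow_le].
    + left; apply exp_pos.
    + simpl; apply Rmult_le_compat_l; [lra|]. apply pow_incr; lra.
    + apply exp_le; eapply Rle_trans; [apply Re_le_Cmod|].
      eapply Rle_trans; [apply Cmod_Clog_sum_le|];
        rewrite Cmod_mult, Cmod_R, Rabs_pos_eq by lra; [lra|].
      unfold Rdiv; apply Rmult_le_compat; [lra | left; apply Rinv_0_lt_compat; lra | lra |].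
      apply Rinv_le_contravar; lra.
Qed.

(** * Limits of complex sequences *)

(** Convergence is stated for the real sequence of distances, so that squeezing and the limit rules
    for real sequences apply directly. *)
Definition Clim (u : nat -> C) (l : C) : Prop :=
  is_lim_seq (fun n => Cmod (u n - l)) 0.

Lemma Clim_le (u : nat -> C) (l : C) (e : nat -> R) :
  (forall n, Cmod (u n - l) <= e n) -> is_lim_seq e 0 -> Clim u l.
Proof.
  intros H He; apply (is_lim_seq_le_le (fun _ => 0) _ e); [|apply is_lim_seq_const | exact He].
  intros n; split; [apply Cmod_ge_0 | apply H].
Qed.

Lemma Clim_ext (u v : nat -> C) (l : C) :
  (forall n, u n = v n) -> Clim u l -> Clim v l.
Proof.
  intros H; apply is_lim_seq_ext; intros; now rewrite H.
Qed.

Lemma Clim_const (a : C) : Clim (fun _ => a) a.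
Proof.
  apply (is_lim_seq_ext (fun _ => 0)); [|apply is_lim_seq_const].
  intros; replace (a - a)%C with (RtoC 0) by ring; now rewrite Cmod_0.
Qed.

Lemma Clim_plus (u v : nat -> C) (a b : C) :
  Clim u a -> Clim v b -> Clim (fun n => u n + v n)%C (a + b)%C.
Proof.
  intros Hu Hv.
  apply (Clim_le _ _ (fun n => Cmod (u n - a) + Cmod (v n - b))).
  - intros n; replace (_ - _)%C with ((u n - a) + (v n - b))%C by ring; apply Cmod_triangle.
  - replace (Finite 0) with (Finite (0 + 0)) by (f_equal; ring).
    now apply is_lim_seq_plus'.
Qed.

Lemma Clim_mult_l (c : C) (u : nat -> C) (a : C) :
  Clim u a -> Clim (fun n => c * u n)%C (c * a)%C.
Proof.
  intros Hu.
  apply (Clim_le _ _ (fun n => Cmod c * Cmod (u n - a))).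
  - intros n; replace (_ - _)%C with (c * (u n - a))%C by ring; rewrite Cmod_mult; lra.
  - replace (Finite 0) with (Rbar_mult (Cmod c) 0) by (simpl; f_equal; ring).
    now apply is_lim_seq_scal_l.
Qed.

Lemma Clim_minus (u v : nat -> C) (a b : C) :
  Clim u a -> Clim v b -> Clim (fun n => u n - v n)%C (a - b)%C.
Proof.
  intros Hu Hv; apply (Clim_ext (fun n => u n + -1 * v n)%C); [intros; ring|].
  replace (a - b)%C with (a + -1 * b)%C by ring.
  now apply Clim_plus, Clim_mult_l.
Qed.

Lemma Clim_Cmod (u : nat -> C) (a : C) : Clim u a -> is_lim_seq (fun n => Cmod (u n)) (Cmod a).
Proof.
  intros Hu; apply (is_lim_seq_le_le (fun n => Cmod a - Cmod (u n - a)) _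
    (fun n => Cmod a + Cmod (u n - a))).
  - intros n; split.
    + assert (H := Cmod_dist_triangle a (u n) 0); rewrite (Cmod_minus_sym a (u n)) in H.
      replace (a - 0)%C with a in H by ring; replace (u n - 0)%C with (u n) in H by ring; lra.
    + assert (H := Cmod_dist_triangle (u n) a 0).
      replace (a - 0)%C with a in H by ring; replace (u n - 0)%C with (u n) in H by ring; lra.
  - replace (Finite (Cmod a)) with (Finite (Cmod a - 0)) by (f_equal; ring).
    apply is_lim_seq_minus'; [apply is_lim_seq_const | exact Hu].
  - replace (Finite (Cmod a)) with (Finite (Cmod a + 0)) by (f_equal; ring).
    apply is_lim_seq_plus'; [apply is_lim_seq_const | exact Hu].
Qed.

Lemma Clim_Cmod_le (u : nat -> C) (a b : C) (B : R) :
  Clim u a -> (forall n, Cmod (u n - b) <= B) -> Cmod (a - b) <= B.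
Proof.
  intros Hu Hb.
  assert (H := Clim_Cmod _ _ (Clim_minus _ _ _ _ Hu (Clim_const b))).
  exact (is_lim_seq_le _ _ _ _ Hb H (is_lim_seq_const B)).
Qed.

Lemma Clim_unique (u : nat -> C) (a b : C) : Clim u a -> Clim u b -> a = b.
Proof.
  intros Ha Hb.
  assert (H := Clim_Cmod _ _ (Clim_minus _ _ _ _ Ha Hb)).
  assert (E : Cmod (a - b) = 0).
  { assert (H0 : is_lim_seq (fun n => Cmod (u n - u n)) 0).
    { apply (is_lim_seq_ext (fun _ => 0)); [|apply is_lim_seq_const].
      intros; replace (u n - u n)%C with (RtoC 0) by ring; now rewrite Cmod_0. }
    apply is_lim_seq_unique in H; apply is_lim_seq_unique in H0; congruence. }
  apply Cmod_eq_0 in E; now apply Ceq_minus.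
Qed.

Lemma Clim_mult (u v : nat -> C) (a b : C) :
  Clim u a -> Clim v b -> Clim (fun n => u n * v n)%C (a * b)%C.
Proof.
  intros Hu Hv.
  apply (Clim_le _ _ (fun n => Cmod (u n) * Cmod (v n - b) + Cmod (u n - a) * Cmod b)).
  - intros n; replace (_ - _)%C with (u n * (v n - b) + (u n - a) * b)%C by ring.
    rewrite <- !Cmod_mult; apply Cmod_triangle.
  - replace (Finite 0) with (Finite (Cmod a * 0 + 0 * Cmod b)) by (f_equal; ring).
    apply is_lim_seq_plus'; apply is_lim_seq_mult';
      [now apply Clim_Cmod | exact Hv | exact Hu | apply is_lim_seq_const].
Qed.

Lemma Clim_Cexp (u : nat -> C) (a : C) : Clim u a -> Clim (fun n => Cexp (u n)) (Cexp a).
Proof.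
  intros Hu.
  apply (Clim_le _ _ (fun n => Cmod (Cexp a) * (Cmod (u n - a) * exp (Cmod (u n - a))))).
  - intros n; replace (Cexp (u n) - Cexp a)%C with (Cexp a * (Cexp (u n - a) - 1))%C.
    + rewrite Cmod_mult; apply Rmult_le_compat_l; [apply Cmod_ge_0 | apply Cmod_exp_minus_1].
    + replace (u n) with (a + (u n - a))%C at 2 by ring; rewrite Cexp_plus; ring.
  - replace (Finite 0) with (Finite (Cmod (Cexp a) * (0 * exp 0))) by (f_equal; ring).
    apply is_lim_seq_mult'; [apply is_lim_seq_const|].
    apply is_lim_seq_mult'; [exact Hu|].
    apply (is_lim_seq_continuous exp); [|exact Hu].
    apply derivable_continuous_pt, derivable_pt_exp.
Qed.

Lemma Clim_inv (u : nat -> C) (a : C) :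
  a <> 0 -> (forall n, u n <> 0) -> Clim u a -> Clim (fun n => / u n)%C (/ a)%C.
Proof.
  intros Ha Hn Hu.
  assert (Ha' : Cmod a <> 0) by (apply Cmod_gt_0 in Ha; lra).
  apply (Clim_le _ _ (fun n => Cmod (u n - a) / (Cmod (u n) * Cmod a))).
  - intros n; right.
    replace (/ u n - / a)%C with (- (u n - a) / (u n * a))%C by (field; split; auto).
    rewrite Cmod_div by (apply Cmult_neq_0; auto); now rewrite Cmod_opp, Cmod_mult.
  - replace (Finite 0) with (Finite (0 / (Cmod a * Cmod a))) by (f_equal; field; auto).
    apply is_lim_seq_div'; [exact Hu | | nra].
    apply is_lim_seq_mult'; [now apply Clim_Cmod | apply is_lim_seq_const].
Qed.

Lemma Clim_RtoC (u : nat -> R) (l : R) : is_lim_seq u l -> Clim (fun n => RtoC (u n)) l.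
Proof.
  intros H; apply (is_lim_seq_ext (fun n => Rabs (u n - l))).
  - intros n; now rewrite <- RtoC_minus, Cmod_R.
  - replace (Finite 0) with (Rbar_abs (l - l)) by (simpl; f_equal; rewrite Rminus_diag; apply Rabs_R0).
    apply is_lim_seq_abs, is_lim_seq_minus'; [exact H | apply is_lim_seq_const].
Qed.

Lemma Clim_subseq (u : nat -> C) (l : C) (phi : nat -> nat) :
  filterlim phi eventually eventually -> Clim u l -> Clim (fun n => u (phi n)) l.
Proof. intros Hp Hu; exact (is_lim_seq_subseq (fun n => Cmod (u n - l)) 0 phi Hp Hu). Qed.

Lemma Clim_Csum (f : nat -> nat -> C) (l : nat -> C) (n : nat) :
  (forall k, (k < n)%nat -> Clim (fun N => f N k) (l k)) ->
  Clim (fun N => Csum (f N) n) (Csum l n).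
Proof.
  induction n as [|n IH]; intros H; simpl; [apply Clim_const|].
  apply Clim_plus; [apply IH; intros; apply H; lia | apply H; lia].
Qed.

Lemma ex_lim_Rsum_bounded (g : nat -> R) (B : R) :
  (forall k, 0 <= g k) -> (forall n, Rsum g n <= B) -> ex_finite_lim_seq (Rsum g).
Proof.
  intros Hg HB; apply (ex_finite_lim_seq_incr _ B); [|exact HB].
  intros n; simpl; specialize (Hg n); lra.
Qed.

Lemma Rsum_sum_n (f : nat -> R) (n : nat) : Rsum f (S n) = sum_n f n.
Proof.
  induction n as [|n IH]; [rewrite sum_O; simpl; ring|].
  rewrite sum_Sn, <- IH; reflexivity.
Qed.

Lemma ex_lim_Rsum_dominated (f g : nat -> R) (B : R) :
  (forall k, Rabs (f k) <= g k) -> (forall n, Rsum g n <= B) -> ex_finite_lim_seq (Rsum f).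
Proof.
  intros Hf HB.
  destruct (ex_lim_Rsum_bounded g B) as [l Hl]; [|exact HB|].
  { intros k; eapply Rle_trans; [apply Rabs_pos | apply Hf]. }
  assert (Hg : ex_series g).
  { exists l; change (is_lim_seq (sum_n g) l); apply (is_lim_seq_ext (fun n => Rsum g (S n))); [apply Rsum_sum_n|].
    now apply (is_lim_seq_incr_1 (Rsum g)). }
  destruct (ex_series_le f g Hf Hg) as [l' Hl'].
  exists l'; apply (is_lim_seq_incr_1 (Rsum f)).
  apply (is_lim_seq_ext (sum_n f)); [intros; now rewrite Rsum_sum_n | exact Hl'].
Qed.

Lemma Csum_fst_snd (f : nat -> C) (n : nat) :
  Csum f n = (Rsum (fun k => fst (f k)) n, Rsum (fun k => snd (f k)) n).
Proof.
  induction n as [|n IH]; [reflexivity|]; simpl; rewrite IH; reflexivity.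
Qed.

Lemma Cmod_le_Rabs (z : C) : Cmod z <= Rabs (fst z) + Rabs (snd z).
Proof.
  assert (H1 := Rabs_pos (fst z)); assert (H2 := Rabs_pos (snd z)).
  apply Rsqr_incr_0_var; [|lra].
  unfold Rsqr; rewrite Cmod_sqr.
  assert (E1 : fst z * fst z = Rabs (fst z) * Rabs (fst z))
    by (rewrite <- Rabs_mult, Rabs_pos_eq by nra; ring).
  assert (E2 : snd z * snd z = Rabs (snd z) * Rabs (snd z))
    by (rewrite <- Rabs_mult, Rabs_pos_eq by nra; ring).
  nra.
Qed.

Lemma Clim_pair (u v : nat -> R) (a b : R) :
  is_lim_seq u a -> is_lim_seq v b -> Clim (fun n => (u n, v n)) (a, b).
Proof.
  intros Hu Hv.
  apply (Clim_le _ _ (fun n => Rabs (u n - a) + Rabs (v n - b))).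
  - intros n; eapply Rle_trans; [apply Cmod_le_Rabs | simpl; right; reflexivity].
  - replace (Finite 0) with (Finite (Rabs (a - a) + Rabs (b - b)))
      by (rewrite !Rminus_diag, Rabs_R0; f_equal; ring).
    apply is_lim_seq_plus'.
    + apply (is_lim_seq_abs (fun n => u n - a) (a - a)).
      apply is_lim_seq_minus'; [exact Hu | apply is_lim_seq_const].
    + apply (is_lim_seq_abs (fun n => v n - b) (b - b)).
      apply is_lim_seq_minus'; [exact Hv | apply is_lim_seq_const].
Qed.

Lemma ex_Clim_Csum_dominated (f : nat -> C) (g : nat -> R) (B : R) :
  (forall k, Cmod (f k) <= g k) -> (forall n, Rsum g n <= B) ->
  exists l, Clim (Csum f) l.
Proof.
  intros Hf HB.
  destruct (ex_lim_Rsum_dominated (fun k => fst (f k)) g B) as [a Ha]; [|exact HB|].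
  { intros k; eapply Rle_trans; [apply (re_le_Cmod (f k)) | apply Hf]. }
  destruct (ex_lim_Rsum_dominated (fun k => snd (f k)) g B) as [b Hb]; [|exact HB|].
  { intros k; eapply Rle_trans; [apply (im_le_Cmod (f k)) | apply Hf]. }
  exists (a, b).
  apply (Clim_ext (fun n => (Rsum (fun k => fst (f k)) n, Rsum (fun k => snd (f k)) n))).
  - intros n; symmetry; apply Csum_fst_snd.
  - now apply Clim_pair.
Qed.

Lemma Csum_rev (f : nat -> C) (n : nat) :
  Csum f n = Csum (fun k => f (n - 1 - k)%nat) n.
Proof.
  induction n as [|n IH]; [reflexivity|].
  rewrite (Csum_S_l (fun k => f (S n - 1 - k)%nat)); change (Csum f (S n)) with (Csum f n + f n)%C; rewrite IH.
  replace (S n - 1 - 0)%nat with n by lia.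
  rewrite (Csum_ext (fun k => f (n - 1 - k)%nat) (fun k => f (S n - 1 - S k)%nat)); [ring|].
  intros k Hk; f_equal; lia.
Qed.

(** * Hyperbolic functions and the partial fractions of the cotangent *)

Definition Cim (y : R) : C := (0, y).

Definition Csinh (z : C) : C := ((Cexp z - Cexp (- z)) / 2)%C.
Definition Ccosh (z : C) : C := ((Cexp z + Cexp (- z)) / 2)%C.
Definition Ccoth (z : C) : C := (Ccosh z / Csinh z)%C.

Lemma C2_neq_0 : RtoC 2 <> 0.
Proof. apply RtoC_neq_0; lra. Qed.

Lemma Csinh_pair (z : C) :
  Csinh z = (sinh (fst z) * cos (snd z), cosh (fst z) * sin (snd z)).
Proof.
  unfold Csinh, Cexp, sinh, cosh; apply injective_projections; simpl;
    rewrite cos_neg, sin_neg; field.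
Qed.

Lemma Csinh_plus (a b : C) :
  Csinh (a + b) = (Csinh a * Ccosh b + Ccosh a * Csinh b)%C.
Proof.
  unfold Csinh, Ccosh.
  replace (- (a + b))%C with (- a + - b)%C by ring.
  rewrite !Cexp_plus; field; apply C2_neq_0.
Qed.

Lemma Ccosh_plus (a b : C) :
  Ccosh (a + b) = (Ccosh a * Ccosh b + Csinh a * Csinh b)%C.
Proof.
  unfold Csinh, Ccosh.
  replace (- (a + b))%C with (- a + - b)%C by ring.
  rewrite !Cexp_plus; field; apply C2_neq_0.
Qed.

Lemma Cexp_iPI : Cexp (Cim PI) = (-1)%C.
Proof.
  unfold Cexp; simpl; rewrite exp_0, cos_PI, sin_PI.
  apply injective_projections; simpl; ring.
Qed.

Lemma Cexp_iPI2 : Cexp (Cim (PI / 2)) = Ci.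
Proof.
  unfold Cexp; simpl; rewrite exp_0, cos_PI2, sin_PI2.
  apply injective_projections; simpl; ring.
Qed.

Lemma sinh_ge (x : R) : 0 <= x -> x <= sinh x.
Proof.
  intros Hx.
  assert (H : sinh 0 - 0 <= sinh x - x); [|rewrite sinh_0 in H; lra].
  apply (increasing_of_derive_nonneg (fun u => sinh u - u) (fun u => cosh u - 1)); [exact Hx| |].
  - intros u _; unfold sinh, cosh; auto_derive; auto; field.
  - intros u _; unfold cosh.
    assert (H1 := exp_pos u); assert (H2 := exp_pos (- u)).
    assert (E : exp u * exp (- u) = 1) by (rewrite <- exp_plus, Rplus_opp_r; apply exp_0).
    assert (0 <= (exp u - 1) * (1 - exp (- u))); [|lra].
    destruct (Rle_dec 1 (exp u)); nra.
Qed.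

Lemma Cmod_Csinh_sqr (z : C) :
  Cmod (Csinh z) * Cmod (Csinh z) =
  sinh (fst z) * sinh (fst z) + sin (snd z) * sin (snd z).
Proof.
  rewrite Cmod_sqr, Csinh_pair; simpl.
  assert (H := sin2_cos2 (snd z)); unfold Rsqr in H.
  assert (H' : cosh (fst z) * cosh (fst z) = 1 + sinh (fst z) * sinh (fst z)).
  { unfold sinh, cosh.
    assert (E : exp (fst z) * exp (- fst z) = 1)
      by (rewrite <- exp_plus, Rplus_opp_r; apply exp_0).
    nra. }
  replace (cosh (fst z) * sin (snd z) * (cosh (fst z) * sin (snd z)))
    with ((cosh (fst z) * cosh (fst z)) * (sin (snd z) * sin (snd z))) by ring.
  rewrite H'.
  assert (E : cos (snd z) * cos (snd z) = 1 - sin (snd z) * sin (snd z)) by lra.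
  replace (sinh (fst z) * cos (snd z) * (sinh (fst z) * cos (snd z)))
    with (sinh (fst z) * sinh (fst z) * (cos (snd z) * cos (snd z))) by ring.
  rewrite E; ring.
Qed.

Lemma sinh_le_Cmod_Csinh (z : C) : 0 <= Re z -> sinh (Re z) <= Cmod (Csinh z).
Proof.
  intros Hz; unfold Re in *.
  assert (H0 := sinh_ge _ Hz).
  apply Rsqr_incr_0_var; [|apply Cmod_ge_0].
  unfold Rsqr; rewrite Cmod_Csinh_sqr; nra.
Qed.

Lemma Csinh_neq_0 (z : C) : 0 < Re z -> Csinh z <> 0.
Proof.
  intros Hz; apply Cmod_gt_0.
  assert (H0 := sinh_ge (Re z)); assert (H1 := sinh_le_Cmod_Csinh z); lra.
Qed.

(** A shift by [i PI / 2] turns coth into tanh, and [coth a + tanh a = 2 coth (2 a)]. *)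
Lemma Ccoth_duplication (w : C) : 0 < Re w ->
  Ccoth w = (/ 2 * (Ccoth (w / 2) + Ccoth (w / 2 + (Cim (PI / 2)))))%C.
Proof.
  intros Hw.
  set (a := (w / 2)%C).
  assert (Ew : w = (a + a)%C) by (unfold a; field; apply C2_neq_0).
  assert (Ha : 0 < Re a) by (rewrite Ew, re_plus in Hw; lra).
  assert (Ei : Re (Cim (PI / 2)) = 0) by reflexivity.
  assert (N1 := Csinh_neq_0 _ Ha).
  assert (N2 : Csinh (a + (Cim (PI / 2))) <> 0) by (apply Csinh_neq_0; rewrite re_plus, Ei; lra).
  assert (N3 : Csinh (a + a) <> 0) by (apply Csinh_neq_0; rewrite re_plus; lra).
  rewrite Ew; unfold Ccoth.
  rewrite (Csinh_plus a a), (Ccosh_plus a a) in *.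
  rewrite (Csinh_plus a (Cim _)), (Ccosh_plus a (Cim _)) in *.
  assert (Es : Csinh (Cim (PI / 2)) = Ci).
  { rewrite Csinh_pair; simpl; rewrite cos_PI2, sin_PI2, cosh_0.
    apply injective_projections; simpl; ring. }
  assert (Ec : Ccosh (Cim (PI / 2)) = 0).
  { unfold Ccosh; rewrite Cexp_opp, Cexp_iPI2, Ci_inv; unfold Cdiv; ring. }
  rewrite Es, Ec in *.
  assert (N4 : Ccosh a <> 0).
  { intros E; apply N3; rewrite E; ring. }
  field; repeat split; auto using C2_neq_0, Ci_nz.
Qed.

Lemma Ccoth_period (w : C) : Ccoth (w + (Cim PI)) = Ccoth w.
Proof.
  unfold Ccoth; rewrite Csinh_plus, Ccosh_plus.
  assert (Es : Csinh (Cim PI) = 0).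
  { rewrite Csinh_pair; simpl; rewrite sin_PI, sinh_0.
    apply injective_projections; simpl; ring. }
  assert (Ec : Ccosh (Cim PI) = (-1)%C).
  { unfold Ccosh; rewrite Cexp_opp, Cexp_iPI; field. }
  rewrite Es, Ec.
  replace (Csinh w * -1 + Ccosh w * 0)%C with (- Csinh w)%C by ring.
  replace (Ccosh w * -1 + Csinh w * 0)%C with (- Ccosh w)%C by ring.
  (* At a pole both quotients are 0, because [/ 0] evaluates to 0. *)
  destruct (Ceq_dec (Csinh w) 0) as [E|E].
  - rewrite E; replace (- 0)%C with (RtoC 0) by ring.
    unfold Cdiv; replace (/ 0)%C with (RtoC 0); [ring|].
    unfold Cinv; simpl; apply injective_projections; simpl;
      unfold Rdiv; ring.
  - field; auto.
Qed.

Lemma Cim_plus (x y : R) : Cim (x + y) = (Cim x + Cim y)%C.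
Proof. unfold Cim; apply injective_projections; simpl; ring. Qed.

Lemma Cim_div (x y : R) : y <> 0 -> Cim (x / y) = (Cim x / y)%C.
Proof. intros H; unfold Cim; apply injective_projections; simpl; field; auto. Qed.

Lemma Cim_sqr (y : R) : (Cim y * Cim y)%C = RtoC (- (y * y)).
Proof. unfold Cim; apply injective_projections; simpl; ring. Qed.

Lemma Cmod_Cim (y : R) : 0 <= y -> Cmod (Cim y) = y.
Proof.
  intros H; apply Rsqr_inj; [apply Cmod_ge_0 | exact H |].
  unfold Rsqr; rewrite Cmod_sqr; unfold Cim; simpl; ring.
Qed.

Lemma Re_div_RtoC (z : C) (x : R) : x <> 0 -> Re (z / x) = Re z / x.
Proof. intros H; unfold Cdiv; rewrite <- RtoC_inv, re_scal_r by auto; reflexivity. Qed.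

Lemma Cmod_div_RtoC (z : C) (x : R) : 0 < x -> Cmod (z / x) = Cmod z / x.
Proof.
  intros H; rewrite Cmod_div by (apply RtoC_neq_0; lra).
  now rewrite Cmod_R, Rabs_pos_eq by lra.
Qed.

(** Iterated duplication. Letting [n] grow in such a sum is the classical elementary route to the
    partial fractions: each translate close to the pole tends to one fraction. *)
Lemma Ccoth_pow2_sum (n : nat) (z : C) : 0 < Re z ->
  Ccoth z = (/ INR (2 ^ n) *
    Csum (fun l => Ccoth (z / INR (2 ^ n) + Cim (PI * INR l / INR (2 ^ n)))) (2 ^ n))%C.
Proof.
  intros Hz; induction n as [|n IH].
  { simpl. replace (/ 1)%C with (RtoC 1) by field.
    replace (z / 1 + Cim (PI * 0 / 1))%C with z; [ring|].
    replace (PI * 0 / 1) with 0 by field. unfold Cim.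
    replace (z / 1)%C with z by field.
    apply injective_projections; simpl; ring. }
  assert (HN : 0 < INR (2 ^ n)).
  { apply lt_0_INR; assert (H := Nat.pow_nonzero 2 n); lia. }
  set (N := INR (2 ^ n)) in *.
  assert (HNC : RtoC N <> 0) by (apply RtoC_neq_0; lra).
  assert (E2 : INR (2 ^ S n) = 2 * N).
  { simpl Nat.pow; rewrite Nat.add_0_r, plus_INR; fold N; ring. }
  rewrite E2.
  replace (2 ^ S n)%nat with (2 ^ n + 2 ^ n)%nat by (simpl; lia).
  rewrite Csum_add, <- Csum_plus, IH.
  rewrite (Csum_ext _ (fun l => / 2 *
     (Ccoth (z / (2 * N)%R + Cim (PI * INR l / (2 * N))) +
      Ccoth (z / (2 * N)%R + Cim (PI * INR (2 ^ n + l) / (2 * N)))))%C).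
  { rewrite Csum_mult_l, RtoC_mult; field; repeat split; auto using C2_neq_0. }
  intros l _; rewrite Ccoth_duplication.
  2:{ rewrite re_plus, Re_div_RtoC by lra; unfold Cim, Re at 2; simpl.
      assert (0 < Re z / N) by (now apply Rdiv_lt_0_compat); lra. }
  do 3 f_equal.
  - rewrite !Cim_div by lra; rewrite RtoC_mult; field; repeat split; auto using C2_neq_0.
  - rewrite plus_INR; fold N.
    replace (PI * (N + INR l) / (2 * N)) with (PI / 2 + (PI * INR l) / (2 * N)) by (field; lra).
    rewrite Cim_plus, !Cim_div by lra; rewrite RtoC_mult; field; repeat split; auto using C2_neq_0.
Qed.

(** The translates beyond [PI / 2] are moved by the period to negative shifts and pair up with the
    positive ones. The shifts 0 and [PI / 2] remain unpaired. *)
Lemma Ccoth_symmetric_sum (n h : nat) (z : C) : 0 < Re z -> (2 ^ n = S h)%nat ->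
  let N := (2 * INR (S h))%R in
  Ccoth z = (/ N * (Ccoth (z / N) + Ccoth (z / N + Cim (PI / 2)) +
    Csum (fun l => Ccoth (z / N + Cim (PI * INR (S l) / N)) +
                   Ccoth (z / N - Cim (PI * INR (S l) / N))) h))%C.
Proof.
  intros Hz Hh N.
  assert (HS : 0 < INR (S h)) by (apply lt_0_INR; lia).
  assert (E2 : INR (2 ^ S n) = N).
  { simpl Nat.pow; rewrite Nat.add_0_r, Hh, plus_INR; unfold N; ring. }
  rewrite (Ccoth_pow2_sum (S n) z Hz), E2; f_equal.
  replace (2 ^ S n)%nat with (S h + S h)%nat by (simpl; lia).
  rewrite Csum_add, !Csum_S_l, Csum_plus.
  replace (PI * INR 0 / N) with 0 by (simpl; unfold Rdiv; ring).
  replace (Cim 0) with (RtoC 0) by reflexivity.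
  replace (PI * INR (S h + 0) / N) with (PI / 2).
  2:{ rewrite Nat.add_0_r; unfold N; field; lra. }
  rewrite (Csum_rev (fun k => Ccoth (z / N + Cim (PI * INR (S h + S k) / N)))%C).
  rewrite (Csum_ext (fun k : nat => Ccoth (z / N + Cim (PI * INR (S h + S (h - 1 - k)) / N)))%C
    (fun k => Ccoth (z / N - Cim (PI * INR (S k) / N)))%C).
  { rewrite Cplus_0_r; ring. }
  intros k Hk; rewrite <- (Ccoth_period (z / N - _)); f_equal.
  replace (PI * INR (S h + S (h - 1 - k)) / N) with (- (PI * INR (S k) / N) + PI).
  - rewrite Cim_plus.
    replace (Cim (- (PI * INR (S k) / N))) with (- Cim (PI * INR (S k) / N))%C; [ring|].
    unfold Cim; apply injective_projections; simpl; ring.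
  - replace (S h + S (h - 1 - k))%nat with (2 * S h - S k)%nat by lia.
    rewrite minus_INR, mult_INR by lia; unfold N; simpl (INR 2); field; lra.
Qed.

Lemma Ccoth_pair (a b : C) : Csinh (a + b) <> 0 -> Csinh (a - b) <> 0 ->
  (Ccoth (a + b) + Ccoth (a - b) = Csinh (2 * a) / (Csinh (a + b) * Csinh (a - b)))%C.
Proof.
  intros H1 H2; replace (2 * a)%C with ((a + b) + (a - b))%C by ring.
  rewrite (Csinh_plus (a + b) (a - b)); unfold Ccoth; field; auto.
Qed.

(** Three integrations starting from [cos <= 1]. *)
Lemma sin_ge_cubic (y : R) : 0 <= y -> y - y ^ 3 / 6 <= sin y.
Proof.
  assert (H1 : forall x, 0 <= x -> sin x <= x).
  { intros x Hx.
    assert (H : 0 - sin 0 <= x - sin x); [|rewrite sin_0 in H; lra].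
    apply (increasing_of_derive_nonneg (fun u => u - sin u) (fun u => 1 - cos u)); [exact Hx| |].
    - intros; auto_derive; auto; ring.
    - intros u _; assert (H := COS_bound u); lra. }
  assert (H2 : forall x, 0 <= x -> 1 - x ^ 2 / 2 <= cos x).
  { intros x Hx.
    assert (H : cos 0 - (1 - 0 ^ 2 / 2) <= cos x - (1 - x ^ 2 / 2)); [|rewrite cos_0 in H; lra].
    apply (increasing_of_derive_nonneg (fun u => cos u - (1 - u ^ 2 / 2)) (fun u => u - sin u)); [exact Hx| |].
    - intros; auto_derive; auto; field.
    - intros u Hu; assert (H := H1 u); lra. }
  intros Hy.
  assert (H : sin 0 - (0 - 0 ^ 3 / 6) <= sin y - (y - y ^ 3 / 6)); [|rewrite sin_0 in H; lra].
  apply (increasing_of_derive_nonneg (fun u => sin u - (u - u ^ 3 / 6))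
    (fun u => cos u - (1 - u ^ 2 / 2))); [exact Hy| |].
  - intros; auto_derive; auto; field.
  - intros u Hu; assert (H := H2 u); lra.
Qed.

(** From [|sinh w|^2 = sinh^2 x + sin^2 y]. The bound [7 / 3] lies above [PI / 2 + 3 / 4], the
    largest imaginary part met in [Csinh_pair_estimate], and below [PI], where the next zero of sinh
    lies. *)
Lemma Cmod_le_Csinh (w : C) : Rabs (Im w) <= 7 / 3 -> Cmod w <= 16 * Cmod (Csinh w).
Proof.
  unfold Im; intros Hw.
  apply Rsqr_incr_0_var; [|assert (H := Cmod_ge_0 (Csinh w)); lra].
  unfold Rsqr; replace (16 * Cmod (Csinh w) * (16 * Cmod (Csinh w)))
    with (256 * (Cmod (Csinh w) * Cmod (Csinh w))) by ring.
  rewrite Cmod_Csinh_sqr, Cmod_sqr.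
  assert (Hx : fst w * fst w <= sinh (fst w) * sinh (fst w)).
  { destruct (Rle_dec 0 (fst w)) as [H|H].
    - assert (H1 := sinh_ge _ H); nra.
    - assert (H1 := sinh_ge (- fst w)).
      assert (E : sinh (- fst w) = - sinh (fst w)) by (unfold sinh; rewrite Ropp_involutive; field).
      rewrite E in H1; nra. }
  assert (Hy : snd w * snd w <= 256 * (sin (snd w) * sin (snd w))).
  { assert (Ha : forall y, 0 <= y <= 7 / 3 -> y * y <= 256 * (sin y * sin y)).
    { intros y Hy; assert (H := sin_ge_cubic y (proj1 Hy)).
      assert (H' : y / 16 <= sin y); [|nra].
      assert (y ^ 3 / 6 <= y * (15 / 16)); [|lra].
      assert (y * y <= 49 / 9) by nra. nra. }
    destruct (Rle_dec 0 (snd w)) as [H|H].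
    - rewrite Rabs_pos_eq in Hw by lra; apply Ha; lra.
    - rewrite Rabs_left in Hw by lra.
      specialize (Ha (- snd w)); rewrite sin_neg in Ha; nra. }
  nra.
Qed.

Lemma exp_le_27 (x : R) : x <= 3 -> exp x <= 27.
Proof.
  intros H; apply Rle_trans with (exp (1 + 1 + 1)); [apply exp_le; lra|].
  rewrite !exp_plus; assert (H1 := exp_le_3); assert (H2 := exp_pos 1); nra.
Qed.

(** The even Taylor terms cancel between the two exponentials; 5 rounds up [27 / 6], where 27 bounds
    [exp 3]. *)
Lemma Cmod_Csinh_taylor (w : C) : Cmod w <= 3 -> Cmod (Csinh w - w) <= 5 * Cmod w ^ 3.
Proof.
  intros Hw.
  assert (H1 := Cmod_exp_taylor 3 w); assert (H2 := Cmod_exp_taylor 3 (- w)).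
  rewrite Cmod_opp in H2.
  set (T1 := Csum (fun k => w ^ k / INR (fact k))%C 3) in *.
  set (T2 := Csum (fun k => (- w) ^ k / INR (fact k))%C 3) in *.
  replace (Csinh w - w)%C with (/ 2 * ((Cexp w - T1) - (Cexp (- w) - T2)))%C.
  2:{ unfold Csinh, T1, T2; simpl; field; repeat split; apply RtoC_neq_0; lra. }
  rewrite Cmod_mult, Cmod_inv, Cmod_R, Rabs_pos_eq by (lra || apply C2_neq_0).
  assert (H3 := Cmod_triangle_minus (Cexp w - T1) (Cexp (- w) - T2)).
  assert (H4 := exp_le_27 _ Hw).
  assert (H5 : 0 <= Cmod w ^ 3) by (apply pow_le, Cmod_ge_0).
  replace (INR (fact 3)) with 6 in * by (simpl; ring).
  assert (Cmod w ^ 3 / 6 * exp (Cmod w) <= Cmod w ^ 3 / 6 * 27)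
    by (apply Rmult_le_compat_l; lra).
  lra.
Qed.

Lemma PI_bounds : 3.1415 < PI < 3.1416.
Proof.
  assert (H := PI_2_3_7_ineq 3).
  unfold tg_alt, PI_2_3_7_tg, Ratan_seq in H; simpl in H; lra.
Qed.

(** Inside the sector [Cmod a <= k * Re a] no cancellation against an imaginary number is possible:
    the distance is at least [Re a], which controls [Cmod a] and hence [b]. *)
Lemma Cim_le_Cmod (a : C) (k b : R) : 0 <= b -> 0 < Re a -> Cmod a <= k * Re a ->
  b <= (1 + k) * Cmod (a - Cim b).
Proof.
  intros Hb Ha Hk.
  assert (H1 : Re a <= Cmod (a - Cim b)).
  { eapply Rle_trans; [|apply Re_le_Cmod]; unfold Cim, Re; simpl; lra. }
  assert (H2 : b <= Cmod a + Cmod (a - Cim b)).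
  { rewrite <- (Cmod_Cim b Hb) at 1.
    replace (Cim b) with (a - (a - Cim b))%C at 1 by ring; apply Cmod_triangle_minus. }
  assert (0 <= k).
  { destruct (Rle_dec 0 k); [lra|]; assert (H := Cmod_ge_0 a); nra. }
  nra.
Qed.

Lemma Cim_le_Cmod_plus (a : C) (k b : R) : 0 <= b -> 0 < Re a -> Cmod a <= k * Re a ->
  b <= (1 + k) * Cmod (a + Cim b).
Proof.
  intros Hb Ha Hk.
  assert (H := Cim_le_Cmod (Cconj a) k b Hb); rewrite re_conj, Cmod_conj in H.
  rewrite <- (Cmod_conj (a + Cim b)), Cplus_conj.
  replace (Cconj (Cim b)) with (- Cim b)%C by (unfold Cim; apply injective_projections; simpl; ring).
  now apply H.
Qed.

(* Both quotients have the poles of 1 / sinh, with the same residues. *)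
Lemma Csinh_pair_estimate (k : R) (a : C) (b : R) :
  0 < Re a -> Cmod a <= k * Re a -> Cmod a <= 3 / 4 -> 0 <= b <= PI / 2 ->
  Cmod (Csinh (2 * a) / (Csinh (a + Cim b) * Csinh (a - Cim b)) -
        2 * a / ((a + Cim b) * (a - Cim b))) <=
  256 * (40 * k ^ 2 + 920 * (3 + 2 * k)) * Cmod a.
Proof.
  intros Ha Hk Ha1 Hb.
  set (w := (a + Cim b)%C); set (w' := (a - Cim b)%C).
  assert (HPI := PI_bounds).
  assert (Rw : Re w = Re a) by (unfold w, Cim, Re; simpl; ring).
  assert (Rw' : Re w' = Re a) by (unfold w', Cim, Re; simpl; ring).
  assert (Hp0 : 0 <= k).
  { destruct (Rle_dec 0 k); [lra|]; assert (H := Cmod_ge_0 a); nra. }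
  assert (Nw : w <> 0) by (apply Cmod_gt_0; assert (H := Re_le_Cmod w); lra).
  assert (Nw' : w' <> 0) by (apply Cmod_gt_0; assert (H := Re_le_Cmod w'); lra).
  assert (NS : Csinh w <> 0) by (apply Csinh_neq_0; lra).
  assert (NS' : Csinh w' <> 0) by (apply Csinh_neq_0; lra).
  assert (Hcb := Cmod_Cim b (proj1 Hb)).
  assert (Ima : Rabs (Im a) <= 3 / 4) by (eapply Rle_trans; [apply im_le_Cmod | lra]).
  assert (Lw : Cmod w <= 16 * Cmod (Csinh w)).
  { apply Cmod_le_Csinh; unfold w; rewrite im_plus; unfold Cim, Im at 2; simpl.
    eapply Rle_trans; [apply Rabs_triang|]; rewrite (Rabs_pos_eq b) by lra; lra. }
  assert (Lw' : Cmod w' <= 16 * Cmod (Csinh w')).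
  { apply Cmod_le_Csinh; unfold w', Cminus; rewrite im_plus, im_opp; unfold Cim, Im at 2; simpl.
    eapply Rle_trans; [apply Rabs_triang|]; rewrite Rabs_Ropp, (Rabs_pos_eq b) by lra; lra. }
  assert (Uw : Cmod w <= 3).
  { eapply Rle_trans; [apply Cmod_triangle|]; lra. }
  assert (Uw' : Cmod w' <= 3).
  { eapply Rle_trans; [apply Cmod_triangle_minus|]; lra. }
  assert (Tw := Cmod_Csinh_taylor w Uw); assert (Tw' := Cmod_Csinh_taylor w' Uw').
  assert (M2 : Cmod (2 * a) = 2 * Cmod a) by (rewrite Cmod_mult, Cmod_R, Rabs_pos_eq by lra; ring).
  assert (Ta := Cmod_Csinh_taylor (2 * a)); rewrite M2 in Ta; specialize (Ta ltac:(lra)).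
  assert (Ba := Cim_le_Cmod_plus a k b (proj1 Hb) Ha Hk); fold w in Ba.
  assert (Ba' := Cim_le_Cmod a k b (proj1 Hb) Ha Hk); fold w' in Ba'.
  assert (Aw : Cmod a <= k * Cmod w).
  { assert (H := Re_le_Cmod w); rewrite Rw in H; nra. }
  assert (Aw' : Cmod a <= k * Cmod w').
  { assert (H := Re_le_Cmod w'); rewrite Rw' in H; nra. }
  assert (Cww' : Cmod w <= (3 + 2 * k) * Cmod w').
  { assert (H : Cmod w <= Cmod w' + 2 * b); [|nra].
    replace w with (w' + 2 * Cim b)%C by (unfold w, w'; ring).
    eapply Rle_trans; [apply Cmod_triangle|]; rewrite Cmod_mult, Hcb, Cmod_R, Rabs_pos_eq; lra. }
  assert (Cw'w : Cmod w' <= (3 + 2 * k) * Cmod w).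
  { assert (H : Cmod w' <= Cmod w + 2 * b); [|nra].
    replace w' with (w - 2 * Cim b)%C by (unfold w, w'; ring).
    eapply Rle_trans; [apply Cmod_triangle_minus|]; rewrite Cmod_mult, Hcb, Cmod_R, Rabs_pos_eq; lra. }
  assert (Pw : 0 < Cmod w) by now apply Cmod_gt_0.
  assert (Pw' : 0 < Cmod w') by now apply Cmod_gt_0.
  assert (Pa := Cmod_ge_0 a).
  assert (Sw' : Cmod (Csinh w') <= 46 * Cmod w').
  { replace (Csinh w') with ((Csinh w' - w') + w')%C by ring.
    eapply Rle_trans; [apply Cmod_triangle|].
    assert (Cmod w' ^ 3 <= 9 * Cmod w'); [|lra].
    assert (Cmod w' * Cmod w' <= 9) by nra. simpl; nra. }
  (* Every term of the new numerator contains a cubic Taylor remainder of sinh and has total order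
     five, against order four in the denominator; one factor [Cmod a] is left. *)
  replace (Csinh (2 * a) / (Csinh w * Csinh w') - 2 * a / (w * w'))%C with
    (((Csinh (2 * a) - 2 * a) * (w * w') + 2 * a * ((w' - Csinh w') * w + Csinh w' * (w - Csinh w)))
      / (w * w' * (Csinh w * Csinh w')))%C by (field; auto).
  rewrite Cmod_div by (apply Cmult_neq_0; apply Cmult_neq_0; assumption).
  rewrite !(Cmod_mult (w * w')), !(Cmod_mult w), (Cmod_mult (Csinh w)).
  set (p := Cmod w) in *; set (p' := Cmod w') in *; set (al := Cmod a) in *.
  assert (D0 : 0 < p * p') by (apply Rmult_lt_0_compat; lra).
  assert (D1 : 0 < p * p' * (p * p' / 256)) by (apply Rmult_lt_0_compat; lra).
  assert (D2 : p * p' * (p * p' / 256) <= p * p' * (Cmod (Csinh w) * Cmod (Csinh w'))).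
  { apply Rmult_le_compat_l; [nra|].
    assert (p / 16 * (p' / 16) <= Cmod (Csinh w) * Cmod (Csinh w')); [|lra].
    apply Rmult_le_compat; lra. }
  assert (Num : Cmod ((Csinh (2 * a) - 2 * a) * (w * w') +
     2 * a * ((w' - Csinh w') * w + Csinh w' * (w - Csinh w))) <=
     40 * al ^ 3 * (p * p') + 2 * al * (5 * p' ^ 3 * p + 46 * p' * (5 * p ^ 3))).
  { eapply Rle_trans; [apply Cmod_triangle|]; apply Rplus_le_compat.
    - rewrite !Cmod_mult; fold p p'; apply Rmult_le_compat_r; [nra|].
      eapply Rle_trans; [exact Ta|]; right; ring.
    - rewrite Cmod_mult, M2; fold al; apply Rmult_le_compat_l; [lra|].
      eapply Rle_trans; [apply Cmod_triangle|]; rewrite !Cmod_mult; fold p p'.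
      apply Rplus_le_compat.
      + apply Rmult_le_compat_r; [lra|]; rewrite Cmod_minus_sym; exact Tw'.
      + apply Rmult_le_compat; [apply Cmod_ge_0 | apply Cmod_ge_0 | exact Sw'|].
        rewrite Cmod_minus_sym; exact Tw. }
  apply Rle_div_l; [lra|].
  eapply Rle_trans; [exact Num|].
  eapply Rle_trans; [|apply Rmult_le_compat_l; [|exact D2]].
  2:{ apply Rmult_le_pos; [|lra].
      apply Rmult_le_pos; [lra|]. assert (0 <= k ^ 2) by apply pow2_ge_0. lra. }
  replace (256 * (40 * k ^ 2 + 920 * (3 + 2 * k)) * al * (p * p' * (p * p' / 256)))
    with (al * (p * p') * (40 * (k * p) * (k * p') + 920 * (3 + 2 * k) * (p * p'))) by field.
  replace (40 * al ^ 3 * (p * p') + 2 * al * (5 * p' ^ 3 * p + 46 * p' * (5 * p ^ 3)))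
    with (al * (p * p') * (40 * (al * al) + 2 * (5 * (p' * p') + 230 * (p * p)))) by ring.
  apply Rmult_le_compat_l; [nra|].
  assert (al * al <= (k * p) * (k * p')) by (apply Rmult_le_compat; lra).
  assert (p * p <= (3 + 2 * k) * (p * p')) by nra.
  assert (p' * p' <= (3 + 2 * k) * (p * p')) by nra.
  nra.
Qed.

Lemma Clim_le_loc (u : nat -> C) (l : C) (e : nat -> R) :
  eventually (fun n => Cmod (u n - l) <= e n) -> is_lim_seq e 0 -> Clim u l.
Proof.
  intros H He; apply (is_lim_seq_le_le_loc (fun _ => 0) _ e); [|apply is_lim_seq_const | exact He].
  revert H; apply filter_imp; intros n Hn; split; [apply Cmod_ge_0 | exact Hn].
Qed.

Lemma is_lim_seq_pow2 : is_lim_seq (fun n => INR (2 ^ n)) p_infty.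
Proof.
  apply (is_lim_seq_ext (fun n => 2 ^ n)).
  - intros n; rewrite pow_INR; reflexivity.
  - apply is_lim_seq_geom_p; lra.
Qed.

Lemma Rsum_inv_sqr_le (n : nat) : Rsum (fun l => / INR (S l) ^ 2) n <= 2.
Proof.
  assert (H : Rsum (fun l => / INR (S l) ^ 2) (S n) <= 2 - / INR (S n)).
  { induction n as [|n IH]; [simpl; lra|].
    change (Rsum (fun l => / INR (S l) ^ 2) (S n) + / INR (S (S n)) ^ 2 <= 2 - / INR (S (S n))).
    assert (Hn : 1 <= INR (S n)) by (rewrite S_INR; assert (H := pos_INR n); lra).
    assert (E : / INR (S n) - / INR (S (S n)) - / INR (S (S n)) ^ 2 =
      / (INR (S n) * INR (S (S n)) ^ 2)).
    { rewrite (S_INR (S n)); field; lra. }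
    assert (0 < / (INR (S n) * INR (S (S n)) ^ 2)).
    { apply Rinv_0_lt_compat; rewrite (S_INR (S n)); apply Rmult_lt_0_compat; [lra|]; nra. }
    lra. }
  change (Rsum (fun l => / INR (S l) ^ 2) (S n)) with
    (Rsum (fun l => / INR (S l) ^ 2) n + / INR (S n) ^ 2) in H.
  assert (0 < / INR (S n)) by (apply Rinv_0_lt_compat, lt_0_INR; lia).
  assert (0 < / INR (S n) ^ 2) by (apply Rinv_0_lt_compat, pow_lt, lt_0_INR; lia).
  lra.
Qed.

Lemma sqr_plus_PI_sqr (z : C) (x : R) :
  (z ^ 2 + (PI * x) ^ 2)%C = ((z + Cim (PI * x)) * (z - Cim (PI * x)))%C.
Proof.
  replace ((z + Cim (PI * x)) * (z - Cim (PI * x)))%C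
    with (z ^ 2 - Cim (PI * x) * Cim (PI * x))%C by ring.
  rewrite Cim_sqr, RtoC_opp, !RtoC_mult; ring.
Qed.

Lemma sqr_plus_PI_sqr_neq_0 (z : C) (x : R) : 0 < Re z -> (z ^ 2 + (PI * x) ^ 2)%C <> 0.
Proof.
  intros Hz; rewrite sqr_plus_PI_sqr; apply Cmult_neq_0; apply Cmod_gt_0;
    eapply Rlt_le_trans; try apply Re_le_Cmod; unfold Cim, Re in *; simpl; lra.
Qed.

(** The limit exists by comparison with the sum of [1 / l^2], so it may be identified along the
    lengths [2^n - 1]. There the partial sum is compared termwise with [Ccoth_symmetric_sum]: about
    [N / 2] pairs, each off by [K * Cmod a] with [Cmod a = Cmod z / N], and a prefactor [/ N] leave
    an error of order [1 / N]. *)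
Lemma Ccoth_partial_fractions (z : C) : 0 < Re z ->
  Clim (Csum (fun l => 2 * z / (z ^ 2 + (PI * INR (S l)) ^ 2))%C) (Ccoth z - / z)%C.
Proof.
  intros Hz.
  set (k := Cmod z / Re z).
  assert (Hk : Cmod z = k * Re z) by (unfold k; field; lra).
  assert (Hz1 := Re_le_Cmod z).
  assert (Hk1 : 1 <= k) by nra.
  assert (HPI := PI_bounds).
  assert (Nz : z <> 0) by (apply Cmod_gt_0; lra).
  set (f := fun l : nat => (2 * z / (z ^ 2 + (PI * INR (S l)) ^ 2))%C).
  assert (Hex : exists l, Clim (Csum f) l).
  { apply (ex_Clim_Csum_dominated f
      (fun l => (2 * Cmod z * (1 + k) ^ 2 / PI ^ 2) * / INR (S l) ^ 2)
      ((2 * Cmod z * (1 + k) ^ 2 / PI ^ 2) * 2)).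
    - intros l; unfold f.
      assert (Hl : 1 <= INR (S l)) by (rewrite S_INR; assert (H := pos_INR l); lra).
      rewrite Cmod_div by (now apply sqr_plus_PI_sqr_neq_0).
      rewrite sqr_plus_PI_sqr, !Cmod_mult, Cmod_R, Rabs_pos_eq by lra.
      assert (B1 := Cim_le_Cmod z k (PI * INR (S l)) ltac:(nra) Hz ltac:(lra)).
      assert (B2 := Cim_le_Cmod_plus z k (PI * INR (S l)) ltac:(nra) Hz ltac:(lra)).
      assert (B3 : (PI * INR (S l)) * (PI * INR (S l)) <=
        ((1 + k) * Cmod (z + Cim (PI * INR (S l)))) * ((1 + k) * Cmod (z - Cim (PI * INR (S l)))))
        by (apply Rmult_le_compat; nra).
      set (D := Cmod (z + Cim (PI * INR (S l))) * Cmod (z - Cim (PI * INR (S l)))) in *.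
      assert (P0 : 0 < PI * INR (S l)) by (apply Rmult_lt_0_compat; lra).
      assert (P1 : 0 < PI * INR (S l) * (PI * INR (S l))) by now apply Rmult_lt_0_compat.
      assert (B4 : (PI * INR (S l)) * (PI * INR (S l)) <= (1 + k) ^ 2 * D) by (unfold D; nra).
      assert (HD : 0 < D).
      { unfold D; apply Rmult_lt_0_compat; eapply Rlt_le_trans; try apply Re_le_Cmod;
          unfold Cim, Re in *; simpl; lra. }
      apply Rle_div_l; [exact HD|].
      replace (2 * Cmod z * (1 + k) ^ 2 / PI ^ 2 * / INR (S l) ^ 2 * D)
        with (2 * Cmod z * (((1 + k) ^ 2 * D) / (PI * INR (S l) * (PI * INR (S l))))) by (field; lra).
      rewrite <- (Rmult_1_r (2 * Cmod z)) at 1; apply Rmult_le_compat_l; [lra|].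
      apply Rle_div_r; [exact P1 | lra].
    - intros n; rewrite Rsum_mult_l; apply Rmult_le_compat_l; [|apply Rsum_inv_sqr_le].
      apply Rdiv_le_0_compat; [|nra]. apply Rmult_le_pos; [lra | apply pow2_ge_0]. }
  destruct Hex as [l Hl].
  assert (Hsub : Clim (fun n => Csum f (2 ^ n - 1)%nat) l).
  { apply (Clim_subseq (Csum f) l (fun n => (2 ^ n - 1)%nat)); [|exact Hl].
    apply eventually_subseq; intros n; simpl; assert (H := Nat.pow_nonzero 2 n); lia. }
  replace (Ccoth z - / z)%C with l; [exact Hl|].
  apply (Clim_unique _ _ _ Hsub).
  set (K := 256 * (40 * k ^ 2 + 920 * (3 + 2 * k))).
  assert (HK : 0 <= K) by (unfold K; nra).
  apply (Clim_le_loc _ _ (fun n => (K * Cmod z + 60) * / INR (2 ^ n))).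
  2:{ replace (Finite 0) with (Rbar_mult (K * Cmod z + 60) 0) by (simpl; f_equal; ring).
      apply is_lim_seq_scal_l.
      apply (is_lim_seq_inv _ p_infty); [apply is_lim_seq_pow2 | discriminate]. }
  assert (Hev : eventually (fun n => Cmod z < INR (2 ^ n))).
  { assert (H := is_lim_seq_pow2). apply is_lim_seq_spec in H; exact (H (Cmod z)). }
  revert Hev; apply filter_imp; intros n Hn.
  destruct (2 ^ n)%nat as [|h] eqn:Eh; [simpl in Hn; lra|].
  replace (S h - 1)%nat with h by lia.
  rewrite (Ccoth_symmetric_sum n h z Hz Eh).
  set (N := (2 * INR (S h))%R).
  assert (HH : 1 <= INR (S h)) by (rewrite S_INR; assert (H := pos_INR h); lra).
  assert (HN : 0 < N) by (unfold N; lra).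
  set (a := (z / N)%C).
  assert (Ea : z = (N * a)%C) by (unfold a; field; apply RtoC_neq_0; lra).
  assert (Ma : Cmod a = Cmod z / N) by (apply Cmod_div_RtoC; lra).
  assert (Ra : Re a = Re z / N) by (apply Re_div_RtoC; lra).
  assert (Ha : 0 < Re a) by (rewrite Ra; now apply Rdiv_lt_0_compat).
  assert (Hka : Cmod a <= k * Re a) by (rewrite Ma, Ra, Hk; right; field; lra).
  assert (Ha1 : Cmod a <= 1 / 2).
  { rewrite Ma; apply Rle_div_l; [lra|]; unfold N; lra. }
  assert (HaK : K * Cmod a <= K * Cmod z / N) by (rewrite Ma; right; field; lra).
  assert (NC : RtoC N <> 0) by (apply RtoC_neq_0; lra).
  assert (Na : a <> 0) by (apply Cmod_gt_0; assert (H := Re_le_Cmod a); lra).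
  replace (Csum f h - _)%C with
    (/ N * (Csum (fun l => 2 * a / ((a + Cim (PI * INR (S l) / N)) * (a - Cim (PI * INR (S l) / N)))
        - (Ccoth (a + Cim (PI * INR (S l) / N)) + Ccoth (a - Cim (PI * INR (S l) / N))))%C h
      - Ccoth (a + Cim (PI / 2)) - (Ccoth a - / a)))%C.
  2:{ rewrite Csum_minus.
      replace (Csum f h) with (/ N * Csum (fun l => 2 * a /
        ((a + Cim (PI * INR (S l) / N)) * (a - Cim (PI * INR (S l) / N))))%C h)%C.
      - replace (/ z)%C with (/ N * / a)%C; [ring|]. rewrite Ea; field; auto.
      - rewrite <- Csum_mult_l; apply Csum_ext; intros j _; unfold f.
        rewrite sqr_plus_PI_sqr, Cim_div, Ea by lra.
        assert (Hj := sqr_plus_PI_sqr_neq_0 z (INR (S j)) Hz).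
        rewrite sqr_plus_PI_sqr, Ea in Hj.
        assert (Hj1 : (N * a + Cim (PI * INR (S j)))%C <> 0) by (intros E; apply Hj; rewrite E; ring).
        assert (Hj2 : (N * a - Cim (PI * INR (S j)))%C <> 0) by (intros E; apply Hj; rewrite E; ring).
        field; repeat split; auto. }
  rewrite Cmod_mult, Cmod_inv, Cmod_R, Rabs_pos_eq by (auto; lra).
  assert (B1 : Cmod (Csum (fun l => 2 * a / ((a + Cim (PI * INR (S l) / N)) * (a - Cim (PI * INR (S l) / N)))
        - (Ccoth (a + Cim (PI * INR (S l) / N)) + Ccoth (a - Cim (PI * INR (S l) / N))))%C h)
      <= INR h * (K * Cmod a)).
  { rewrite <- Rsum_const; apply Cmod_Csum_le; intros j Hj.
    assert (Hb : 0 <= PI * INR (S j) / N <= PI / 2).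
    { assert (INR (S j) <= INR (S h)) by (apply le_INR; lia).
      assert (0 <= INR (S j)) by apply pos_INR.
      split; [apply Rdiv_le_0_compat; nra|]; apply Rle_div_l; [lra|]; unfold N; nra. }
    rewrite Cmod_minus_sym, Ccoth_pair.
    - apply Csinh_pair_estimate; auto; lra.
    - apply Csinh_neq_0; unfold Cim, Re in *; simpl in *; lra.
    - apply Csinh_neq_0; unfold Cim, Re in *; simpl in *; lra. }
  assert (B2 : Cmod (Ccoth (a + Cim (PI / 2))) <= 60).
  { set (w := (a + Cim (PI / 2))%C).
    assert (Rw : Re w = Re a) by (unfold w, Cim, Re; simpl; ring).
    unfold Ccoth; rewrite Cmod_div by (apply Csinh_neq_0; lra).
    assert (Ima := im_le_Cmod a).
    assert (H1 : Cmod w <= 16 * Cmod (Csinh w)).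
    { apply Cmod_le_Csinh; unfold w; rewrite im_plus; change (Im (Cim (PI / 2))) with (PI / 2).
      eapply Rle_trans; [apply Rabs_triang|]; rewrite (Rabs_pos_eq (PI / 2)) by lra; lra. }
    assert (H2 : PI / 2 - Cmod a <= Cmod w).
    { rewrite <- (Cmod_Cim (PI / 2)) by lra.
      replace w with (Cim (PI / 2) - - a)%C by (unfold w; ring).
      rewrite <- (Cmod_opp a); apply Cmod_triangle_inv. }
    assert (H3 : Cmod (Ccosh w) <= 3).
    { unfold Ccosh; rewrite Cmod_div, Cmod_R, Rabs_pos_eq by (auto using C2_neq_0; lra).
      assert (H := Cmod_triangle (Cexp w) (Cexp (- w))).
      rewrite !Cmod_Cexp, re_opp, Rw in H.
      assert (G1 : exp (Re a) <= exp 1) by (apply exp_le; assert (G := Re_le_Cmod a); lra).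
      assert (G2 : exp (- Re a) <= exp 1) by (apply exp_le; lra).
      assert (G3 := exp_le_3); lra. }
    apply Rle_div_l; lra. }
  assert (B3 : Cmod (Ccoth a - / a) <= K * Cmod a).
  (* For [b = 0] the pair collapses to twice [coth a - 1 / a]. *)
  { assert (H := Csinh_pair_estimate k a 0 Ha Hka ltac:(lra) ltac:(lra)); fold K in H.
    assert (E0 : Cim 0 = 0) by reflexivity.
    rewrite E0 in H.
    replace (a + 0)%C with a in H by ring; replace (a - 0)%C with a in H by ring.
    assert (Sa : Csinh a <> 0) by now apply Csinh_neq_0.
    replace (Csinh (2 * a) / (Csinh a * Csinh a) - 2 * a / (a * a))%C with (2 * (Ccoth a - / a))%C in H.
    2:{ replace (2 * a)%C with (a + a)%C at 1 by ring.
        rewrite Csinh_plus; unfold Ccoth; field; auto. }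
    rewrite Cmod_mult, Cmod_R, Rabs_pos_eq in H by lra.
    assert (0 <= Cmod (Ccoth a - / a)) by apply Cmod_ge_0; lra. }
  assert (B4 : Cmod (Csum (fun l => 2 * a / ((a + Cim (PI * INR (S l) / N)) * (a - Cim (PI * INR (S l) / N)))
        - (Ccoth (a + Cim (PI * INR (S l) / N)) + Ccoth (a - Cim (PI * INR (S l) / N))))%C h
      - Ccoth (a + Cim (PI / 2)) - (Ccoth a - / a)) <= INR h * (K * Cmod a) + 60 + K * Cmod a).
  { eapply Rle_trans; [apply Cmod_triangle_minus|]; apply Rplus_le_compat; [|exact B3].
    eapply Rle_trans; [apply Cmod_triangle_minus|]; lra. }
  rewrite Rmult_comm.
  replace ((K * Cmod z + 60) * / INR (S h)) with ((2 * (K * Cmod z + 60)) * / N) by (unfold N; field; lra).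
  apply Rmult_le_compat_r; [left; now apply Rinv_0_lt_compat|].
  eapply Rle_trans; [exact B4|].
  replace (INR h * (K * Cmod a) + 60 + K * Cmod a) with (INR (S h) * (K * Cmod a) + 60)
    by (rewrite S_INR; ring).
  assert (INR (S h) * (K * Cmod a) = K * Cmod z / 2) by (rewrite Ma; unfold N; field; lra).
  assert (0 <= K * Cmod z) by (apply Rmult_le_pos; lra).
  lra.
Qed.

Lemma Rsum_S (f : nat -> R) (n : nat) : Rsum f (S n) = Rsum f n + f n.
Proof. reflexivity. Qed.

Lemma Rsum_minus (f g : nat -> R) (n : nat) :
  Rsum (fun k => f k - g k) n = Rsum f n - Rsum g n.
Proof. induction n as [|n IH]; simpl; [ring | rewrite IH; ring]. Qed.

Lemma Csum_S (f : nat -> C) (n : nat) : Csum f (S n) = (Csum f n + f n)%C.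
Proof. reflexivity. Qed.

Lemma Clim_Re (u : nat -> C) (l : C) : Clim u l -> is_lim_seq (fun n => Re (u n)) (Re l).
Proof.
  intros H; apply (is_lim_seq_le_le (fun n => Re l - Cmod (u n - l)) _
    (fun n => Re l + Cmod (u n - l))).
  - intros n; assert (H1 := re_le_Cmod (u n - l)).
    apply Rabs_le_between in H1.
    replace (Re (u n - l)) with (Re (u n) - Re l) in H1 by (unfold Re; simpl; ring); lra.
  - replace (Finite (Re l)) with (Finite (Re l - 0)) by (f_equal; ring).
    apply is_lim_seq_minus'; [apply is_lim_seq_const | exact H].
  - replace (Finite (Re l)) with (Finite (Re l + 0)) by (f_equal; ring).
    apply is_lim_seq_plus'; [apply is_lim_seq_const | exact H].
Qed.

(** * The Basel sum and its alternating variants *)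

Lemma exp_taylor5 (x : R) : Rabs x <= 1 ->
  Rabs (exp x - (1 + x + x ^ 2 / 2 + x ^ 3 / 6 + x ^ 4 / 24)) <= Rabs x ^ 5 / 40.
Proof.
  intros Hx; assert (H := Cmod_exp_taylor 5 x).
  rewrite Cmod_R in H.
  replace (Cexp x - Csum (fun k : nat => (x ^ k / INR (fact k))%C) 5)%C
    with (RtoC (exp x - (1 + x + x ^ 2 / 2 + x ^ 3 / 6 + x ^ 4 / 24))) in H.
  2:{ rewrite Cexp_RtoC; apply injective_projections; simpl; field. }
  rewrite Cmod_R in H; eapply Rle_trans; [exact H|].
  replace (INR (fact 5)) with 120 by (simpl; ring).
  assert (H1 : exp (Rabs x) <= 3) by (eapply Rle_trans; [apply exp_le, Hx | apply exp_le_3]).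
  assert (0 <= Rabs x ^ 5) by (apply pow_le, Rabs_pos).
  assert (Rabs x ^ 5 / 120 * exp (Rabs x) <= Rabs x ^ 5 / 120 * 3)
    by (apply Rmult_le_compat_l; lra).
  lra.
Qed.

Lemma Ccoth_RtoC (x : R) : 0 < x -> Ccoth x = RtoC (cosh x / sinh x).
Proof.
  intros Hx; assert (H := sinh_ge x).
  unfold Ccoth, Ccosh, Csinh; rewrite <- RtoC_opp, !Cexp_RtoC.
  rewrite <- RtoC_plus, <- RtoC_minus, <- !RtoC_div; unfold sinh, cosh in *; (lra || auto).
Qed.

(** By the partial fractions the quotient is the sum of [1 / (x^2 + (PI l)^2)], so its value at 0
    determines the sum of the inverse squares. *)
Lemma coth_near_0 (x : R) : 0 < x <= 1 ->
  Rabs ((cosh x / sinh x - / x) / (2 * x) - / 6) <= x ^ 2 / 6.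
Proof.
  intros Hx; assert (Hs := sinh_ge x ltac:(lra)).
  assert (H1 := exp_taylor5 x); assert (H2 := exp_taylor5 (- x)).
  rewrite Rabs_Ropp, Rabs_pos_eq in H2 by lra; rewrite (Rabs_pos_eq x) in H1 by lra.
  specialize (H1 ltac:(lra)); specialize (H2 ltac:(lra)).
  apply Rabs_le_between in H1; apply Rabs_le_between in H2.
  assert (Hx5 : 0 <= x ^ 5) by (apply pow_le; lra).
  assert (Hx6 : 0 <= x ^ 6 <= x ^ 5).
  { replace (x ^ 6) with (x * x ^ 5) by ring; nra. }
  assert (Hx7 : 0 <= x ^ 7 <= x ^ 5).
  { replace (x ^ 7) with (x * x ^ 6) by ring; nra. }
  assert (S1 : Rabs (sinh x - (x + x ^ 3 / 6)) <= x ^ 5 / 40)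
    by (apply Rabs_le_between; unfold sinh; lra).
  assert (C1 : Rabs (cosh x - (1 + x ^ 2 / 2 + x ^ 4 / 24)) <= x ^ 5 / 40)
    by (apply Rabs_le_between; unfold cosh; lra).
  apply Rabs_le_between in S1; apply Rabs_le_between in C1.
  replace ((cosh x / sinh x - / x) / (2 * x) - / 6)
    with ((6 * (x * cosh x - sinh x) - 2 * (x ^ 2 * sinh x)) / (12 * x ^ 2 * sinh x))
    by (field; lra).
  assert (Hxc : - (x ^ 6 / 40) <= x * cosh x - (x + x ^ 3 / 2 + x ^ 5 / 24) <= x ^ 6 / 40) by nra.
  assert (Hxs : - (x ^ 7 / 40) <= x ^ 2 * sinh x - (x ^ 3 + x ^ 5 / 6) <= x ^ 7 / 40) by nra.
  assert (Hden : 12 * x ^ 3 <= 12 * x ^ 2 * sinh x) by nra.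
  assert (Hx3 : 0 < x ^ 3) by (apply pow_lt; lra).
  unfold Rdiv; rewrite Rabs_mult, (Rabs_pos_eq (/ _)).
  2:{ left; apply Rinv_0_lt_compat; lra. }
  apply Rle_div_l; [lra|].
  apply Rle_trans with (2 * x ^ 5).
  - apply Rabs_le; lra.
  - replace (2 * x ^ 5) with (x ^ 2 * / 6 * (12 * x ^ 3)) by field.
    apply Rmult_le_compat_l; [nra | lra].
Qed.

(** The partial fractions of coth, divided by [2 x], are taken near [x = 0]. The passage to the
    limit is replaced by the bound [2 x^2], valid for every small [x]. *)
Lemma basel : is_lim_seq (Rsum (fun l => / INR (S l) ^ 2)) (PI ^ 2 / 6).
Proof.
  destruct (ex_lim_Rsum_bounded (fun l => / INR (S l) ^ 2) 2) as [Z HZ].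
  { intros k; left; apply Rinv_0_lt_compat, pow_lt, lt_0_INR; lia. }
  { apply Rsum_inv_sqr_le. }
  assert (HPI := PI_bounds).
  assert (HZ0 : 0 <= Z <= 2).
  { split.
    - apply (is_lim_seq_le (fun _ => 0) (Rsum (fun l => / INR (S l) ^ 2)) 0 Z); [|apply is_lim_seq_const | exact HZ].
      intros n; apply Rsum_nonneg; intros k _; left; apply Rinv_0_lt_compat, pow_lt, lt_0_INR; lia.
    - exact (is_lim_seq_le _ _ Z 2 Rsum_inv_sqr_le HZ (is_lim_seq_const 2)). }
  replace (PI ^ 2 / 6) with Z; [exact HZ|].
  assert (Hx : forall x, 0 < x <= 1 -> Rabs (Z / PI ^ 2 - / 6) <= 2 * x ^ 2).
  { intros x Hx.
    set (g := (cosh x / sinh x - / x) / (2 * x)).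
    assert (Hg : is_lim_seq (Rsum (fun l => / (x ^ 2 + (PI * INR (S l)) ^ 2))) g).
    { assert (H := Ccoth_partial_fractions x ltac:(simpl; lra)).
      rewrite Ccoth_RtoC, <- RtoC_inv, <- RtoC_minus in H by lra.
      apply (is_lim_seq_ext (fun n => / (2 * x) * Rsum (fun l => 2 * x / (x ^ 2 + (PI * INR (S l)) ^ 2)) n)).
      { intros n; rewrite <- Rsum_mult_l; apply Rsum_ext; intros; field.
        split; [|lra]. assert (0 <= (PI * INR (S k)) ^ 2) by apply pow2_ge_0. nra. }
      replace g with (/ (2 * x) * (cosh x / sinh x - / x)) by (unfold g, Rdiv; ring).
      apply (is_lim_seq_scal_l _ (/ (2 * x)) (cosh x / sinh x - / x)).
      apply (is_lim_seq_ext (fun n => Re (Csum (fun l : nat =>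
        2 * x / (x ^ 2 + (PI * INR (S l)) ^ 2))%C n))).
      { intros n; rewrite (Csum_ext _ (fun l => RtoC (2 * x / (x ^ 2 + (PI * INR (S l)) ^ 2)))).
        - rewrite Csum_RtoC; reflexivity.
        - intros l _; rewrite RtoC_div, RtoC_plus, !RtoC_pow, !RtoC_mult; [reflexivity|].
          assert (0 <= (PI * INR (S l)) ^ 2) by apply pow2_ge_0. nra. }
      exact (Clim_Re _ _ H). }
    assert (Hterm : forall l, 0 <= / PI ^ 2 * / INR (S l) ^ 2 - / (x ^ 2 + (PI * INR (S l)) ^ 2)
        <= x ^ 2 / PI ^ 4 * / INR (S l) ^ 2).
    { intros l.
      assert (Hl : 1 <= INR (S l)) by (rewrite S_INR; assert (H := pos_INR l); lra).
      set (L := INR (S l)) in *.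
      assert (P1 : 0 < PI ^ 2 * L ^ 2) by (apply Rmult_lt_0_compat; nra).
      assert (P2 : 0 < x ^ 2) by nra.
      replace ((PI * L) ^ 2) with (PI ^ 2 * L ^ 2) by ring.
      replace (/ PI ^ 2 * / L ^ 2 - / (x ^ 2 + PI ^ 2 * L ^ 2))
        with (x ^ 2 * / (PI ^ 2 * L ^ 2 * (x ^ 2 + PI ^ 2 * L ^ 2))) by (field; nra).
      split.
      - apply Rmult_le_pos; [lra|]; left; apply Rinv_0_lt_compat, Rmult_lt_0_compat; lra.
      - replace (x ^ 2 / PI ^ 4 * / L ^ 2) with (x ^ 2 * / (PI ^ 4 * L ^ 2)) by (field; lra).
        apply Rmult_le_compat_l; [lra|]; apply Rinv_le_contravar.
        + apply Rmult_lt_0_compat; [apply pow_lt; lra | nra].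
        + replace (PI ^ 4 * L ^ 2) with (PI ^ 2 * L ^ 2 * PI ^ 2) by ring.
          apply Rmult_le_compat_l; [lra|]. assert (1 <= L ^ 2) by nra.
          assert (0 < PI ^ 2) by (apply pow_lt; lra). nra. }
    assert (HD : is_lim_seq (Rsum (fun l => / PI ^ 2 * / INR (S l) ^ 2 - / (x ^ 2 + (PI * INR (S l)) ^ 2)))
      (Z / PI ^ 2 - g)).
    { apply (is_lim_seq_ext (fun n => / PI ^ 2 * Rsum (fun l => / INR (S l) ^ 2) n -
        Rsum (fun l => / (x ^ 2 + (PI * INR (S l)) ^ 2)) n)).
      - intros n; now rewrite Rsum_minus, Rsum_mult_l.
      - apply is_lim_seq_minus'; [|exact Hg].
        replace (Z / PI ^ 2) with (/ PI ^ 2 * Z) by (unfold Rdiv; ring).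
        now apply (is_lim_seq_scal_l _ (/ PI ^ 2) Z). }
    assert (D1 : 0 <= Z / PI ^ 2 - g).
    { eapply (is_lim_seq_le (fun _ => 0) _ 0 (Z / PI ^ 2 - g)); [|apply is_lim_seq_const | exact HD].
      intros n; apply Rsum_nonneg; intros k _; apply Hterm. }
    assert (D2 : Z / PI ^ 2 - g <= x ^ 2 / PI ^ 4 * Z).
    { eapply (is_lim_seq_le _ (fun n => x ^ 2 / PI ^ 4 * Rsum (fun l => / INR (S l) ^ 2) n)
        (Z / PI ^ 2 - g) (x ^ 2 / PI ^ 4 * Z)); [|exact HD|].
      - intros n; rewrite <- Rsum_mult_l; apply Rsum_le; intros k _; apply Hterm.
      - now apply (is_lim_seq_scal_l _ (x ^ 2 / PI ^ 4) Z). }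
    assert (D3 : x ^ 2 / PI ^ 4 * Z <= x ^ 2).
    { assert (P4 : 2 <= PI ^ 4) by (assert (9 <= PI ^ 2) by nra; simpl in *; nra).
      apply Rmult_le_reg_r with (PI ^ 4); [lra|].
      replace (x ^ 2 / PI ^ 4 * Z * PI ^ 4) with (x ^ 2 * Z) by (field; lra).
      apply Rmult_le_compat_l; [nra | lra]. }
    assert (Hg6 := coth_near_0 x Hx); fold g in Hg6.
    apply Rabs_le_between in Hg6; apply Rabs_le.
    assert (0 <= x ^ 2) by apply pow2_ge_0; lra. }
  assert (H0 : Z / PI ^ 2 - / 6 = 0).
  { destruct (Req_dec (Z / PI ^ 2 - / 6) 0) as [E|E]; [exact E | exfalso].
    set (d := Rabs (Z / PI ^ 2 - / 6)) in *.
    assert (Hd : 0 < d) by now apply Rabs_pos_lt.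
    (* For this [x] the bound [2 x^2] is at most [d / 2]. *)
    set (x := Rmin 1 (d / 4)).
    assert (Hx1 : 0 < x <= 1) by (split; [apply Rmin_glb_lt; lra | apply Rmin_l]).
    assert (Hx2 : x <= d / 4) by apply Rmin_r.
    specialize (Hx x Hx1); nra. }
  replace Z with (PI ^ 2 * (Z / PI ^ 2 - / 6) + PI ^ 2 / 6) by (field; lra).
  rewrite H0; ring.
Qed.

Lemma Csum_pairs (f : nat -> C) (n : nat) :
  Csum (fun j => f (2 * j)%nat + f (S (2 * j)))%C n = Csum f (2 * n).
Proof.
  induction n as [|n IH]; [reflexivity|].
  replace (2 * S n)%nat with (S (S (2 * n))) by lia.
  simpl Csum; simpl in IH; rewrite IH; ring.
Qed.

Lemma Rsum_pairs (f : nat -> R) (n : nat) :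
  Rsum (fun j => f (2 * j)%nat + f (S (2 * j))) n = Rsum f (2 * n).
Proof.
  induction n as [|n IH]; [reflexivity|].
  replace (2 * S n)%nat with (S (S (2 * n))) by lia.
  simpl Rsum; simpl in IH; rewrite IH; ring.
Qed.

Lemma is_lim_seq_double (u : nat -> R) (l : Rbar) :
  is_lim_seq u l -> is_lim_seq (fun n => u (2 * n)%nat) l.
Proof.
  intros H; apply (is_lim_seq_subseq u l (fun n => (2 * n)%nat)); [|exact H].
  apply eventually_subseq; intros; lia.
Qed.

Lemma Clim_double (u : nat -> C) (l : C) : Clim u l -> Clim (fun n => u (2 * n)%nat) l.
Proof.
  intros H; apply (Clim_subseq u l (fun n => (2 * n)%nat)); [|exact H].
  apply eventually_subseq; intros; lia.
Qed.

(** Subtracting the even terms twice halves the sum of [basel]. Multiplied by [t / (2 PI^2)], this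
    value is the term [t / 24] of the modular relation. *)
Lemma alternating_inv_sqr :
  is_lim_seq (Rsum (fun j => / INR (S (2 * j)) ^ 2 - / INR (S (S (2 * j))) ^ 2)) (PI ^ 2 / 12).
Proof.
  assert (H := basel).
  apply (is_lim_seq_ext (fun n => Rsum (fun l => / INR (S l) ^ 2) (2 * n) -
    / 2 * Rsum (fun l => / INR (S l) ^ 2) n)).
  - intros n; rewrite <- Rsum_pairs, <- Rsum_mult_l.
    induction n as [|n IH]; [simpl; ring|].
    rewrite !Rsum_S, <- IH.
    replace (INR (S (S (2 * n)))) with (2 * INR (S n)) by (rewrite !S_INR, mult_INR; simpl; ring).
    assert (INR (S n) <> 0) by (apply not_0_INR; lia).
    assert (INR (S (2 * n)) <> 0) by (apply not_0_INR; lia).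
    field; auto.
  - replace (PI ^ 2 / 12) with (PI ^ 2 / 6 - / 2 * (PI ^ 2 / 6)) by field.
    apply is_lim_seq_minus'; [now apply (is_lim_seq_double (Rsum (fun l => / INR (S l) ^ 2)))|].
    now apply (is_lim_seq_scal_l _ (/ 2) (PI ^ 2 / 6)).
Qed.

(** The limit is [ln 2 / 2]; it enters through the common factor [exp (- c)] of all values of [q],
    which cancels in the homogeneous inequality. *)
Lemma ex_alternating_harmonic :
  exists c : R, is_lim_seq (Rsum (fun j => / (2 * INR (S (2 * j))) - / (2 * INR (S (S (2 * j)))))) c.
Proof.
  destruct (ex_lim_Rsum_bounded (fun j => / (2 * INR (S (2 * j))) - / (2 * INR (S (S (2 * j))))) 2)
    as [c Hc]; [| |now exists c].
  - intros k.
    assert (H := pos_INR k); rewrite !S_INR, mult_INR; simpl INR.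
    assert (/ (2 * ((1 + 1) * INR k + 1 + 1)) <= / (2 * ((1 + 1) * INR k + 1)));
      [apply Rinv_le_contravar; lra | lra].
  - intros n; eapply Rle_trans; [|apply (Rsum_inv_sqr_le n)].
    apply Rsum_le; intros k _.
    assert (H := pos_INR k); rewrite !S_INR, mult_INR; simpl INR.
    set (x := INR k) in *.
    replace (/ (2 * ((1 + 1) * x + 1)) - / (2 * ((1 + 1) * x + 1 + 1)))
      with (/ (2 * (2 * x + 1) * (2 * x + 2))) by (field; lra).
    apply Rinv_le_contravar; nra.
Qed.

(** * Modular behaviour of the logarithm of the generating function *)

(* At [x = exp (- t)], Euler's identity [prod (1 + x^k) = prod / (1 - x^(2k-1))] makes the logarithm
   of the generating function the limit of these sums. *)
Definition log_gf (t : C) (n : nat) : C :=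
  Csum (fun m => / (2 * INR (S m) * Csinh (INR (S m) * t)))%C n.

Lemma INR_S_ge_1 (n : nat) : 1 <= INR (S n).
Proof. rewrite S_INR; assert (H := pos_INR n); lra. Qed.

Lemma Re_RtoC_mult (x : R) (z : C) : Re (x * z) = x * Re z.
Proof. apply re_scal_l. Qed.

Lemma Cmod_log_gf_term (t : C) (m : nat) : 0 < Re t ->
  Cmod (/ (2 * INR (S m) * Csinh (INR (S m) * t))) <= / (2 * INR (S m) * sinh (INR (S m) * Re t)).
Proof.
  intros Ht; assert (Hm := INR_S_ge_1 m).
  assert (Hr : 0 < Re (INR (S m) * t)) by (rewrite Re_RtoC_mult; apply Rmult_lt_0_compat; lra).
  assert (Ns := Csinh_neq_0 _ Hr).
  assert (Hs := sinh_le_Cmod_Csinh _ (Rlt_le _ _ Hr)).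
  rewrite Re_RtoC_mult in Hs, Hr.
  assert (H0 := sinh_ge _ (Rlt_le _ _ Hr)).
  assert (Nm : RtoC (INR (S m)) <> 0) by (apply RtoC_neq_0; lra).
  rewrite Cmod_inv by (apply Cmult_neq_0; [apply Cmult_neq_0; [apply C2_neq_0 | exact Nm] | exact Ns]).
  rewrite !Cmod_mult, !Cmod_R, !Rabs_pos_eq by lra.
  apply Rinv_le_contravar; [apply Rmult_lt_0_compat; lra|].
  apply Rmult_le_compat_l; lra.
Qed.

Lemma log_gf_term_le (s : R) (m : nat) : 0 < s ->
  / (2 * INR (S m) * sinh (INR (S m) * s)) <= / (2 * s) * / INR (S m) ^ 2.
Proof.
  intros Hs; assert (Hm := INR_S_ge_1 m).
  assert (Hr : 0 < INR (S m) * s) by (apply Rmult_lt_0_compat; lra).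
  assert (H0 := sinh_ge _ (Rlt_le _ _ Hr)).
  rewrite <- Rinv_mult; apply Rinv_le_contravar.
  - apply Rmult_lt_0_compat; [lra | apply pow_lt; lra].
  - replace (2 * s * INR (S m) ^ 2) with (2 * INR (S m) * (INR (S m) * s)) by ring.
    apply Rmult_le_compat_l; lra.
Qed.

Lemma ex_lim_log_gf (t : C) : 0 < Re t -> exists L, Clim (log_gf t) L.
Proof.
  intros Ht.
  apply (ex_Clim_Csum_dominated _ (fun m => / (2 * Re t) * / INR (S m) ^ 2) (/ (2 * Re t) * 2)).
  - intros m; eapply Rle_trans; [now apply Cmod_log_gf_term | now apply log_gf_term_le].
  - intros n; rewrite Rsum_mult_l; apply Rmult_le_compat_l; [|apply Rsum_inv_sqr_le].
    left; apply Rinv_0_lt_compat; lra.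
Qed.

(** Passes from the partial fractions of coth to the alternating ones of [1 / sinh]: the expansion
    at [z / 2] contributes the even indices twice. *)
Lemma Ccoth_half (z : C) : 0 < Re z -> (Ccoth (z / 2) - Ccoth z = / Csinh z)%C.
Proof.
  intros Hz; set (a := (z / 2)%C).
  assert (Ez : z = (a + a)%C) by (unfold a; field; apply C2_neq_0).
  assert (Ha : 0 < Re a) by (rewrite Ez, re_plus in Hz; lra).
  assert (Na := Csinh_neq_0 _ Ha); assert (Nz := Csinh_neq_0 _ Hz).
  rewrite Ez in *; unfold Ccoth.
  assert (E1 : (Ccosh a * Ccosh a - Csinh a * Csinh a = 1)%C).
  { unfold Ccosh, Csinh; rewrite <- (Cexp_opp_r a); field; apply C2_neq_0. }
  rewrite Ccosh_plus, Csinh_plus in *.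
  assert (Nc : Ccosh a <> 0) by (intros E; apply Nz; rewrite E; ring).
  replace (Ccosh a / Csinh a -
    (Ccosh a * Ccosh a + Csinh a * Csinh a) / (Csinh a * Ccosh a + Ccosh a * Csinh a))%C
    with ((Ccosh a * Ccosh a - Csinh a * Csinh a) / (2 * Csinh a * Ccosh a))%C.
  2:{ field; repeat split; auto using C2_neq_0; intros E; apply Nz; rewrite <- E; ring. }
  rewrite E1; field; repeat split; auto using C2_neq_0;
    intros E; apply Nz; rewrite <- E; ring.
Qed.

(** The summand behind the modular relation: over [l] it expands coth at [m t], over [m] it expands
    coth at [PI^2 l / t]. *)
Definition lattice_term (t : C) (m l : nat) : C :=
  (t / ((INR m * t) ^ 2 + (PI * INR l) ^ 2))%C.

(** A single term has order [(m + l)^-2], for which the double series diverges. Pairing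
    [l = 2 j + 2] with [l = 2 j + 1] gains one power and makes it absolutely convergent. *)
Definition lattice_pair (t : C) (m j : nat) : C :=
  (lattice_term t (S m) (S (S (2 * j))) - lattice_term t (S m) (S (2 * j)))%C.

Lemma lattice_den_neq_0 (t : C) (m l : nat) : 0 < Re t ->
  ((INR (S m) * t) ^ 2 + (PI * INR l) ^ 2)%C <> 0.
Proof.
  intros Ht; apply (sqr_plus_PI_sqr_neq_0 (INR (S m) * t) (INR l)).
  rewrite Re_RtoC_mult; apply Rmult_lt_0_compat; [apply lt_0_INR; lia | exact Ht].
Qed.

(** By [Ccoth_half]: the expansion at [z / 2] meets the even [l] only and is combined with the one
    at [z] over twice as many terms. *)
Lemma lattice_pair_sum_cols (t : C) (m : nat) : 0 < Re t ->
  Clim (Csum (lattice_pair t m))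
    (/ (2 * INR (S m)) * (/ Csinh (INR (S m) * t) - / (INR (S m) * t)))%C.
Proof.
  intros Ht; set (M := INR (S m)); set (z := (M * t)%C).
  assert (HM : 1 <= M) by apply INR_S_ge_1.
  assert (NM : RtoC M <> 0) by (apply RtoC_neq_0; lra).
  assert (Hz : 0 < Re z) by (unfold z; rewrite Re_RtoC_mult; apply Rmult_lt_0_compat; lra).
  assert (Hz2 : 0 < Re (z / 2)) by (rewrite Re_div_RtoC; lra).
  assert (Nz : z <> 0) by (apply Cmod_gt_0; assert (H := Re_le_Cmod z); lra).
  assert (PA := Clim_double _ _ (Ccoth_partial_fractions z Hz)).
  assert (PB := Ccoth_partial_fractions (z / 2) Hz2).
  assert (P := Clim_mult_l (/ (2 * M))%C _ _ (Clim_minus _ _ _ _ PB PA)).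
  replace (/ (2 * M) * (/ Csinh z - / z))%C with
    (/ (2 * M) * (Ccoth (z / 2) - / (z / 2) - (Ccoth z - / z)))%C.
  2:{ rewrite <- (Ccoth_half z Hz); field; repeat split; auto using C2_neq_0. }
  revert P; apply Clim_ext; intros n; cbv beta.
  rewrite <- Csum_pairs, <- Csum_minus, <- Csum_mult_l; apply Csum_ext; intros j _.
  unfold lattice_pair, lattice_term; fold M; fold z.
  assert (D1 := sqr_plus_PI_sqr_neq_0 z (INR (S (2 * j))) Hz).
  assert (D2 := sqr_plus_PI_sqr_neq_0 z (INR (S (S (2 * j)))) Hz).
  assert (D3 := sqr_plus_PI_sqr_neq_0 (z / 2) (INR (S j)) Hz2).
  assert (E2 : RtoC (INR (S (S (2 * j)))) = (2 * INR (S j))%C).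
  { rewrite <- RtoC_mult; f_equal; rewrite !S_INR, mult_INR; simpl; ring. }
  assert (D4 : (z ^ 2 + (PI * (2 * INR (S j))) ^ 2)%C <> 0) by (rewrite <- E2; exact D2).
  assert (Et : t = (z / M)%C) by (unfold z; field; exact NM).
  replace (2 * (z / 2) / ((z / 2) ^ 2 + (PI * INR (S j)) ^ 2))%C with
    (4 * z / (z ^ 2 + (PI * (2 * INR (S j))) ^ 2))%C.
  2:{ field; repeat split; auto using C2_neq_0; intros E.
      - apply D3; replace ((z / 2) ^ 2 + (PI * INR (S j)) ^ 2)%C with
          ((z ^ 2 + (PI * (2 * INR (S j))) ^ 2) / 4)%C by (field; apply RtoC_neq_0; lra).
        replace (z ^ 2 + (PI * (2 * INR (S j))) ^ 2)%C with (RtoC 0); [unfold Cdiv; ring|].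
        rewrite <- E; ring. }
  rewrite E2, Et; field; repeat split; auto using C2_neq_0.
Qed.

Definition row_limit (t : C) (l : nat) : C :=
  (/ (2 * INR l) * (Ccoth (PI ^ 2 * INR l / t) - t / (PI ^ 2 * INR l)))%C.

Lemma Re_inv_pos (t : C) (x : R) : 0 < Re t -> 0 < x -> 0 < Re (x / t).
Proof.
  intros Ht Hx.
  assert (Nt : t <> 0) by (apply Cmod_gt_0; assert (H := Re_le_Cmod t); lra).
  assert (P : 0 < fst t ^ 2 + snd t ^ 2).
  { unfold Re in Ht; assert (0 <= snd t ^ 2) by apply pow2_ge_0; nra. }
  unfold Cdiv; rewrite Re_RtoC_mult; unfold Re in *; simpl.
  apply Rmult_lt_0_compat; [exact Hx|]; apply Rdiv_lt_0_compat; [exact Ht | simpl in *; lra].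
Qed.

(** With [z = PI^2 l / t], the summand equals [1 / (2 l)] times [2 z / (z^2 + (PI m)^2)]. *)
Lemma lattice_term_sum_rows (t : C) (l : nat) : 0 < Re t -> (0 < l)%nat ->
  Clim (Csum (fun m => lattice_term t (S m) l)) (row_limit t l).
Proof.
  intros Ht Hl.
  assert (HL : 0 < INR l) by now apply lt_0_INR.
  assert (HPI := PI_bounds).
  assert (Nt : t <> 0) by (apply Cmod_gt_0; assert (H := Re_le_Cmod t); lra).
  assert (NL : RtoC (INR l) <> 0) by (apply RtoC_neq_0; lra).
  assert (NP : RtoC PI <> 0) by (apply RtoC_neq_0; lra).
  set (z := (PI ^ 2 * INR l / t)%C).
  assert (Hz : 0 < Re z).
  { unfold z; rewrite <- RtoC_pow, <- RtoC_mult; apply Re_inv_pos; [exact Ht|].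
    apply Rmult_lt_0_compat; [apply pow_lt; lra | exact HL]. }
  assert (Nz : z <> 0) by (apply Cmod_gt_0; assert (H := Re_le_Cmod z); lra).
  unfold row_limit; fold z.
  replace (t / (PI ^ 2 * INR l))%C with (/ z)%C by (unfold z; field; auto).
  assert (P := Clim_mult_l (/ (2 * INR l))%C _ _ (Ccoth_partial_fractions z Hz)).
  revert P; apply Clim_ext; intros n; cbv beta.
  rewrite <- Csum_mult_l; apply Csum_ext; intros m _.
  unfold lattice_term.
  assert (D1 := lattice_den_neq_0 t m l Ht).
  assert (D2 := sqr_plus_PI_sqr_neq_0 z (INR (S m)) Hz).
  unfold z in *; field; repeat split; auto using C2_neq_0.
  replace ((PI ^ 2 * INR l) ^ 2 + (PI * INR (S m) * t) ^ 2)%C with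
    (PI ^ 2 * ((INR (S m) * t) ^ 2 + (PI * INR l) ^ 2))%C by ring.
  apply Cmult_neq_0; [now apply Cpow_nz | exact D1].
Qed.

(** The denominator factors into [m t + i PI l] and [m t - i PI l]. In each factor the real part
    controls [m], and the sector estimate [Cim_le_Cmod] controls [l]. *)
Lemma lattice_den_ge (t : C) (m l : nat) : 0 < Re t ->
  let c := / Re t + (1 + Cmod t / Re t) / PI in
  (INR (S m) + INR l) ^ 2 <= c ^ 2 * Cmod ((INR (S m) * t) ^ 2 + (PI * INR l) ^ 2).
Proof.
  intros Ht c; set (M := INR (S m)); set (L := INR l).
  assert (HM : 1 <= M) by apply INR_S_ge_1.
  assert (HL : 0 <= L) by apply pos_INR.
  assert (HPI := PI_bounds).
  rewrite (sqr_plus_PI_sqr (M * t) L), Cmod_mult.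
  set (k := Cmod t / Re t).
  assert (Hk : Cmod t = k * Re t) by (unfold k; field; lra).
  assert (Hz : 0 < Re (M * t)) by (rewrite Re_RtoC_mult; apply Rmult_lt_0_compat; lra).
  assert (Hkz : Cmod (M * t) <= k * Re (M * t)).
  { rewrite Re_RtoC_mult, Cmod_mult, Cmod_R, Rabs_pos_eq, Hk by lra; right; ring. }
  assert (HPL : 0 <= PI * L) by (apply Rmult_le_pos; lra).
  assert (B1 := Cim_le_Cmod (M * t) k (PI * L) HPL Hz Hkz).
  assert (B2 := Cim_le_Cmod_plus (M * t) k (PI * L) HPL Hz Hkz).
  assert (G : forall w, Re w = M * Re t -> PI * L <= (1 + k) * Cmod w -> M + L <= c * Cmod w).
  { intros w Hw Hw2.
    assert (Hw3 := Re_le_Cmod w); rewrite Hw in Hw3.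
    unfold c; fold k; rewrite Rmult_plus_distr_r; apply Rplus_le_compat.
    - apply Rmult_le_reg_l with (Re t); [exact Ht|].
      replace (Re t * (/ Re t * Cmod w)) with (Cmod w) by (field; lra); lra.
    - apply Rmult_le_reg_l with PI; [lra|].
      replace (PI * ((1 + k) / PI * Cmod w)) with ((1 + k) * Cmod w) by (field; lra); lra. }
  assert (G1 := G (M * t + Cim (PI * L))%C).
  assert (G2 := G (M * t - Cim (PI * L))%C).
  assert (R0 : Re (Cim (PI * L)) = 0) by reflexivity.
  rewrite re_plus, Re_RtoC_mult, R0 in G1; specialize (G1 ltac:(ring) B2).
  unfold Cminus in G2; rewrite re_plus, re_opp, Re_RtoC_mult, R0 in G2.
  fold (Cminus (M * t) (Cim (PI * L))) in G2; specialize (G2 ltac:(ring) B1).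
  replace ((M + L) ^ 2) with ((M + L) * (M + L)) by ring.
  replace (c ^ 2 * (Cmod (M * t + Cim (PI * L)) * Cmod (M * t - Cim (PI * L)))) with
    ((c * Cmod (M * t + Cim (PI * L))) * (c * Cmod (M * t - Cim (PI * L)))) by ring.
  apply Rmult_le_compat; lra.
Qed.

(** The two denominators differ by the real number [PI^2 (4 j + 3)], so a pair has order [v^-3]. The
    bound is written as a difference because it will be summed by telescoping. *)
Lemma Cmod_lattice_pair (t : C) (m j : nat) : 0 < Re t ->
  let c := / Re t + (1 + Cmod t / Re t) / PI in
  let v := INR (S m) + INR j in
  Cmod (lattice_pair t m j) <= 2 * PI ^ 2 * Cmod t * c ^ 4 *
    (/ (v * (v + 1)) - / ((v + 1) * (v + 2))).
Proof.
  intros Ht c v.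
  set (M := INR (S m)) in *; set (J := INR j) in *.
  assert (HM : 1 <= M) by apply INR_S_ge_1.
  assert (HJ : 0 <= J) by apply pos_INR.
  assert (HPI := PI_bounds).
  assert (Hv : 1 <= v) by (unfold v; lra).
  assert (D1 := lattice_den_neq_0 t m (S (2 * j)) Ht).
  assert (D2 := lattice_den_neq_0 t m (S (S (2 * j))) Ht).
  assert (L1 := lattice_den_ge t m (S (2 * j)) Ht).
  assert (L2 := lattice_den_ge t m (S (S (2 * j))) Ht).
  cbv zeta in L1, L2; fold c in L1, L2; fold M in L1, L2, D1, D2.
  assert (E1 : INR (S (2 * j)) = 2 * J + 1) by (rewrite S_INR, mult_INR; simpl; unfold J; ring).
  assert (E2 : INR (S (S (2 * j))) = 2 * J + 2) by (rewrite 2!S_INR, mult_INR; simpl; unfold J; ring).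
  unfold lattice_pair, lattice_term; fold M.
  set (d1 := ((M * t) ^ 2 + (PI * INR (S (2 * j))) ^ 2)%C) in *.
  set (d2 := ((M * t) ^ 2 + (PI * INR (S (S (2 * j)))) ^ 2)%C) in *.
  assert (Ed : (d1 - d2)%C = RtoC (- (PI ^ 2 * (4 * J + 3)))).
  { unfold d1, d2; rewrite E1, E2; apply injective_projections; simpl; ring. }
  replace (t / d2 - t / d1)%C with (t * (d1 - d2) / (d1 * d2))%C by (field; auto).
  rewrite Ed, Cmod_div by (apply Cmult_neq_0; assumption).
  rewrite !Cmod_mult, Cmod_R, Rabs_Ropp, Rabs_pos_eq
    by (apply Rmult_le_pos; [apply pow2_ge_0 | lra]).
  rewrite E1 in L1; rewrite E2 in L2.
  assert (Hc : 0 < c).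
  { unfold c; apply Rplus_lt_0_compat; [now apply Rinv_0_lt_compat|].
    apply Rdiv_lt_0_compat; [|lra].
    assert (0 <= Cmod t / Re t) by (apply Rdiv_le_0_compat; [apply Cmod_ge_0 | lra]); lra. }
  assert (P1 : 0 < Cmod d1) by now apply Cmod_gt_0.
  assert (P2 : 0 < Cmod d2) by now apply Cmod_gt_0.
  assert (Pt := Cmod_ge_0 t).
  apply Rle_div_l; [now apply Rmult_lt_0_compat|].
  replace (2 * PI ^ 2 * Cmod t * c ^ 4 * (/ (v * (v + 1)) - / ((v + 1) * (v + 2))) * (Cmod d1 * Cmod d2))
    with (Cmod t * PI ^ 2 * (4 * ((c ^ 2 * Cmod d1) * (c ^ 2 * Cmod d2)) / (v * (v + 1) * (v + 2))))
    by (field; lra).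
  replace (Cmod t * (PI ^ 2 * (4 * J + 3))) with (Cmod t * PI ^ 2 * (4 * J + 3)) by ring.
  apply Rmult_le_compat_l; [apply Rmult_le_pos; [exact Pt | apply pow2_ge_0]|].
  assert (L3 : (v + 1) ^ 2 * (v + 1) ^ 2 <= (c ^ 2 * Cmod d1) * (c ^ 2 * Cmod d2)).
  { apply Rmult_le_compat; try apply pow2_ge_0.
    - eapply Rle_trans; [|exact L1]; apply pow_incr; unfold v; lra.
    - eapply Rle_trans; [|exact L2]; apply pow_incr; unfold v; lra. }
  assert (Pv : 0 < v * (v + 1) * (v + 2)) by (repeat apply Rmult_lt_0_compat; lra).
  apply Rle_div_r; [exact Pv|].
  eapply Rle_trans; [|apply Rmult_le_compat_l; [lra | exact L3]].
  assert (4 * J + 3 <= 4 * (v + 1)) by (unfold v; lra).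
  replace (4 * ((v + 1) ^ 2 * (v + 1) ^ 2)) with ((4 * (v + 1)) * ((v + 1) * (v + 1) ^ 2)) by ring.
  apply Rmult_le_compat; lra.
Qed.

Lemma Rsum_telescope (f : nat -> R) (n : nat) : Rsum (fun k => f k - f (S k)) n = f O - f n.
Proof. induction n as [|n IH]; simpl; [ring | rewrite IH; ring]. Qed.

(** Uniformity in the number [X] of rows is what permits the interchange of the summations.
    Telescoping in the column index leaves [1 / (w (w + 1))], which telescopes again in [m]. *)
Lemma lattice_tail (t : C) : 0 < Re t ->
  exists K, 0 <= K /\ forall X Y Z : nat,
    Cmod (Csum (fun m => Csum (lattice_pair t m) (Y + Z) - Csum (lattice_pair t m) Y)%C X) <=
    K / INR (S Y).
Proof.
  intros Ht.
  set (c := / Re t + (1 + Cmod t / Re t) / PI).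
  set (K := 2 * PI ^ 2 * Cmod t * c ^ 4).
  assert (HK : 0 <= K).
  { unfold K; replace (c ^ 4) with ((c ^ 2) ^ 2) by ring.
    apply Rmult_le_pos; [|apply pow2_ge_0].
    apply Rmult_le_pos; [|apply Cmod_ge_0].
    apply Rmult_le_pos; [lra | apply pow2_ge_0]. }
  exists K; split; [exact HK|]; intros X Y Z.
  assert (HY := INR_S_ge_1 Y); rewrite S_INR in HY.
  assert (Hrow : forall m, Cmod (Csum (lattice_pair t m) (Y + Z) - Csum (lattice_pair t m) Y)
     <= K * (/ (INR m + INR (S Y)) - / (INR (S m) + INR (S Y)))).
  { intros m.
    rewrite Csum_add.
    replace (_ + _ - _)%C with (Csum (fun k => lattice_pair t m (Y + k)%nat) Z) by ring.
    set (w := INR m + INR (S Y)).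
    assert (Hw : 1 <= w) by (unfold w; rewrite S_INR; assert (H := pos_INR m); lra).
    set (F := fun k => / ((w + INR k) * (w + INR k + 1))).
    apply Rle_trans with (Rsum (fun k => K * (F k - F (S k))) Z).
    - apply Cmod_Csum_le; intros k _.
      eapply Rle_trans; [apply (Cmod_lattice_pair t m (Y + k) Ht)|].
      cbv zeta; fold c; fold K; right; f_equal.
      unfold F; f_equal.
      + f_equal; rewrite plus_INR; unfold w; rewrite !S_INR; ring.
      + f_equal; f_equal; rewrite plus_INR; unfold w; rewrite !S_INR; ring.
    - rewrite Rsum_mult_l, Rsum_telescope; apply Rmult_le_compat_l; [exact HK|].
      assert (0 < F Z).
      { unfold F; assert (H := pos_INR Z); apply Rinv_0_lt_compat, Rmult_lt_0_compat; lra. }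
      assert (F O = / w - / (w + 1)) by (unfold F; simpl; field; lra).
      replace (INR (S m) + INR (S Y)) with (w + 1) by (unfold w; rewrite (S_INR m); ring).
      lra. }
  eapply Rle_trans; [apply (Cmod_Csum_le _ _ _ (fun m _ => Hrow m))|].
  rewrite Rsum_mult_l.
  rewrite (Rsum_telescope (fun m => / (INR m + INR (S Y)))); unfold Rdiv.
  apply Rmult_le_compat_l; [exact HK|].
  assert (0 < / (INR X + INR (S Y))).
  { apply Rinv_0_lt_compat; rewrite S_INR; assert (H := pos_INR X); lra. }
  simpl (INR 0); rewrite Rplus_0_l; lra.
Qed.

Lemma Ccoth_minus_1 (z : C) : 0 < Re z ->
  Cmod (Ccoth z - 1) <= 2 * exp (- (2 * Re z)) / (1 - exp (- (2 * Re z))).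
Proof.
  intros Hz; assert (Ns := Csinh_neq_0 z Hz).
  assert (He : exp (- (2 * Re z)) < 1) by (rewrite <- exp_0; apply exp_increasing; lra).
  assert (Hp := exp_pos (- (2 * Re z))).
  assert (M : Cmod (Cexp (- (2 * z))) = exp (- (2 * Re z))).
  { rewrite Cmod_Cexp, re_opp, re_scal_l; reflexivity. }
  assert (Nd : (1 - Cexp (- (2 * z)))%C <> 0).
  { apply Cmod_gt_0; eapply Rlt_le_trans; [|apply Cmod_triangle_inv].
    rewrite Cmod_1, M; lra. }
  replace (Ccoth z - 1)%C with (2 * Cexp (- (2 * z)) / (1 - Cexp (- (2 * z))))%C.
  - rewrite Cmod_div, Cmod_mult, M, Cmod_R, Rabs_pos_eq by (auto; lra).
    unfold Rdiv; apply Rmult_le_compat_l; [lra|].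
    apply Rinv_le_contravar; [lra|].
    eapply Rle_trans; [|apply Cmod_triangle_inv]; rewrite Cmod_1, M; lra.
  - assert (E : Cexp (- (2 * z)) = (Cexp (- z) * Cexp (- z))%C).
    { rewrite <- Cexp_plus; f_equal; ring. }
    unfold Ccoth, Ccosh; rewrite E in *.
    assert (Nz := Cexp_neq_0 z).
    unfold Csinh in *; rewrite Cexp_opp in *.
    field; repeat split; auto using C2_neq_0.
    intros E2; apply Ns.
    transitivity ((Cexp z * Cexp z - 1) / (2 * Cexp z))%C; [field; auto using C2_neq_0|].
    rewrite E2; unfold Cdiv; ring.
Qed.

Definition row_remainder (t : C) (l : nat) : C :=
  (/ (2 * INR l) * (Ccoth (PI ^ 2 * INR l / t) - 1))%C.

Lemma Cmod_row_remainder (t : C) (l : nat) : 0 < Re t ->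
  let rho := exp (- (2 * Re (PI ^ 2 / t))) in
  Cmod (row_remainder t (S l)) <= / (1 - rho) * rho ^ S l.
Proof.
  intros Ht rho.
  assert (HL := INR_S_ge_1 l); set (L := INR (S l)) in *.
  assert (HPI := PI_bounds).
  assert (HX : 0 < Re (PI ^ 2 / t)).
  { rewrite <- RtoC_pow; apply Re_inv_pos; [exact Ht | apply pow_lt; lra]. }
  assert (Nt : t <> 0) by (apply Cmod_gt_0; assert (H := Re_le_Cmod t); lra).
  assert (EX : Re (PI ^ 2 * L / t) = L * Re (PI ^ 2 / t)).
  { rewrite <- re_scal_l; f_equal; field; exact Nt. }
  assert (Hrho : 0 < rho < 1).
  { split; [apply exp_pos | unfold rho; rewrite <- exp_0; apply exp_increasing; lra]. }
  assert (Erho : exp (- (2 * Re (PI ^ 2 * L / t))) = rho ^ S l).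
  { rewrite EX; unfold rho; rewrite <- (exp_ln (exp _ ^ S l)) by (apply pow_lt, exp_pos).
    rewrite ln_pow, ln_exp by apply exp_pos; fold L; f_equal; ring. }
  unfold row_remainder; fold L.
  rewrite Cmod_mult, <- RtoC_mult, <- RtoC_inv, Cmod_R, Rabs_pos_eq by
    (try (left; apply Rinv_0_lt_compat); lra).
  assert (H := Ccoth_minus_1 (PI ^ 2 * L / t)); rewrite Erho in H.
  assert (HXL : 0 < Re (PI ^ 2 * L / t)) by (rewrite EX; apply Rmult_lt_0_compat; lra).
  specialize (H HXL).
  assert (Hrl : 0 < rho ^ S l <= rho).
  { split; [apply pow_lt; lra|]; simpl.
    assert (rho ^ l <= 1 ^ l) by (apply pow_incr; lra); rewrite pow1 in *; nra. }
  apply Rle_trans with (/ (2 * L) * (2 * (/ (1 - rho) * rho ^ S l))).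
  - apply Rmult_le_compat_l; [left; apply Rinv_0_lt_compat; lra|].
    eapply Rle_trans; [exact H|].
    replace (2 * rho ^ S l / (1 - rho ^ S l)) with (2 * (/ (1 - rho ^ S l) * rho ^ S l)) by (field; lra).
    apply Rmult_le_compat_l; [lra|]; apply Rmult_le_compat_r; [lra|].
    apply Rinv_le_contravar; lra.
  - assert (P : 0 <= / (1 - rho) * rho ^ S l).
    { apply Rmult_le_pos; [left; apply Rinv_0_lt_compat|]; lra. }
    apply Rmult_le_reg_l with L; [lra|].
    replace (L * (/ (2 * L) * (2 * (/ (1 - rho) * rho ^ S l)))) with (/ (1 - rho) * rho ^ S l)
      by (field; lra).
    set (p := / (1 - rho) * rho ^ S l) in *; nra.
Qed.

(** Under alternating summation the three parts give the constant [- c], the exponentially small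
    error and the term [t / 24]. *)
Lemma row_limit_split (t : C) (l : nat) : 0 < Re t -> (0 < l)%nat ->
  row_limit t l = (RtoC (/ (2 * INR l)) + row_remainder t l
                   - t / (2 * PI ^ 2) * RtoC (/ INR l ^ 2))%C.
Proof.
  intros Ht Hl.
  assert (HL : 0 < INR l) by now apply lt_0_INR.
  assert (HPI := PI_bounds).
  unfold row_limit, row_remainder.
  rewrite !RtoC_inv, RtoC_mult, RtoC_pow by (try apply pow_nonzero; lra).
  field; repeat split; apply RtoC_neq_0; lra.
Qed.

(** The double sum of [lattice_pair] in two orders: over [j] first it is [log_gf] without its polar
    part [(PI^2 / 12) / t]; over [m] first it is the alternating sum of the [row_limit]. *)
Lemma log_gf_modular :
  exists c : R, forall t : C, 0 < Re t ->
  exists L : C, Clim (log_gf t) L /\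
    let rho := exp (- (2 * Re (PI ^ 2 / t))) in
    Cmod (L - ((PI ^ 2 / 12)%R / t + t / 24 - c)) <= rho / (1 - rho) ^ 2.
Proof.
  destruct ex_alternating_harmonic as [c Hc].
  exists c; intros t Ht.
  destruct (ex_lim_log_gf t Ht) as [L HL]; exists L; split; [exact HL|]; intros rho.
  destruct (lattice_tail t Ht) as [K [HK Htail]].
  assert (HPI := PI_bounds).
  assert (Nt : t <> 0) by (apply Cmod_gt_0; assert (H := Re_le_Cmod t); lra).
  assert (HX : 0 < Re (PI ^ 2 / t)).
  { rewrite <- RtoC_pow; apply Re_inv_pos; [exact Ht | apply pow_lt; lra]. }
  assert (Hrho : 0 < rho < 1).
  { split; [apply exp_pos | unfold rho; rewrite <- exp_0; apply exp_increasing; lra]. }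
  set (colsum := fun m => (/ (2 * INR (S m)) * (/ Csinh (INR (S m) * t) - / (INR (S m) * t)))%C).
  set (S_XY := fun X Y => Csum (fun m => Csum (lattice_pair t m) Y) X).
  set (b := fun Y => Csum (fun j => row_limit t (S (S (2 * j))) - row_limit t (S (2 * j)))%C Y).
  assert (HbY : forall Y, Clim (fun X => S_XY X Y) (b Y)).
  { intros Y; unfold S_XY, b.
    induction Y as [|Y IH].
    - apply (Clim_ext (fun _ => RtoC 0)); [|apply Clim_const].
      intros n; rewrite (Csum_ext _ (fun _ => 0 * 0)%C), Csum_mult_l; [ring | intros; simpl; ring].
    - apply (Clim_ext (fun X => Csum (fun m => Csum (lattice_pair t m) Y) X +
        (Csum (fun m => lattice_term t (S m) (S (S (2 * Y)))) X -
         Csum (fun m => lattice_term t (S m) (S (2 * Y))) X))%C).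
      + intros X; rewrite <- Csum_minus, <- Csum_plus; apply Csum_ext; intros; reflexivity.
      + rewrite Csum_S; apply Clim_plus; [exact IH|].
        apply Clim_minus; apply lattice_term_sum_rows; (exact Ht || lia). }
  (* The bound of [lattice_tail] survives the limit in the number of columns, and in [HLb] also the
     limit in the number of rows; this compares the two iterated sums. *)
  assert (HaX : forall X Y, Cmod (Csum colsum X - S_XY X Y) <= K / INR (S Y)).
  { intros X Y.
    apply (Clim_Cmod_le (fun Z => S_XY X (Y + Z)%nat)).
    - unfold S_XY; apply (Clim_Csum (fun Z m => Csum (lattice_pair t m) (Y + Z)) colsum).
      intros m _; assert (H := lattice_pair_sum_cols t m Ht).
      apply (Clim_subseq _ _ (fun Z => (Y + Z)%nat)) in H; [exact H|].
      apply eventually_subseq; intros; lia.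
    - intros Z; unfold S_XY; rewrite <- Csum_minus; apply Htail. }
  assert (HcolL : Clim (Csum colsum) (L - (PI ^ 2 / 12)%R / t)%C).
  { apply (Clim_ext (fun X => log_gf t X - / (2 * t) * RtoC (Rsum (fun l => / INR (S l) ^ 2)%R X))%C).
    - intros X; unfold log_gf; rewrite <- Csum_RtoC, <- Csum_mult_l, <- Csum_minus.
      apply Csum_ext; intros m _; unfold colsum.
      assert (Hm := INR_S_ge_1 m).
      assert (Nm : RtoC (INR (S m)) <> 0) by (apply RtoC_neq_0; lra).
      assert (Ns : Csinh (INR (S m) * t) <> 0).
      { apply Csinh_neq_0; rewrite Re_RtoC_mult; apply Rmult_lt_0_compat; lra. }
      rewrite RtoC_inv, RtoC_pow by (apply pow_nonzero; lra).
      field; repeat split; auto using C2_neq_0.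
    - replace ((PI ^ 2 / 12)%R / t)%C with (/ (2 * t) * RtoC (PI ^ 2 / 6))%C.
      + apply Clim_minus; [exact HL|]; apply Clim_mult_l, Clim_RtoC, basel.
      + rewrite !RtoC_div by lra; field; repeat split; auto; apply RtoC_neq_0; lra. }
  assert (HLb : forall Y, Cmod (L - (PI ^ 2 / 12)%R / t - b Y) <= K / INR (S Y)).
  { intros Y.
    assert (H := Clim_Cmod _ _ (Clim_minus _ _ _ _ HcolL (HbY Y))).
    exact (is_lim_seq_le _ _ _ _ (fun X => HaX X Y) H (is_lim_seq_const _)). }
  set (rem := fun Y => Csum (fun j => row_remainder t (S (S (2 * j))) - row_remainder t (S (2 * j)))%C Y).
  assert (Hrem : forall Y, Cmod (rem Y) <= rho / (1 - rho) ^ 2).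
  { intros Y; unfold rem.
    apply Rle_trans with (Rsum (fun j => / (1 - rho) * rho ^ S (2 * j) + / (1 - rho) * rho ^ S (S (2 * j))) Y).
    - apply Cmod_Csum_le; intros j _.
      eapply Rle_trans; [apply Cmod_triangle_minus|]; rewrite Rplus_comm.
      apply Rplus_le_compat; now apply Cmod_row_remainder.
    - rewrite (Rsum_pairs (fun l => / (1 - rho) * rho ^ S l)).
      rewrite (Rsum_ext _ (fun l => (/ (1 - rho) * rho) * rho ^ l)), Rsum_mult_l
        by (intros; simpl; ring).
      replace (rho / (1 - rho) ^ 2) with (/ (1 - rho) * rho * / (1 - rho)) by (field; lra).
      apply Rmult_le_compat_l; [|apply Rsum_geom_lt; lra].
      apply Rmult_le_pos; [left; apply Rinv_0_lt_compat|]; lra. }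
  assert (Hb : Clim (fun Y => b Y - rem Y)%C (t / 24 - c)%C).
  { apply (Clim_ext (fun Y =>
      t / (2 * PI ^ 2) * RtoC (Rsum (fun j => / INR (S (2 * j)) ^ 2 - / INR (S (S (2 * j))) ^ 2)%R Y)
      - RtoC (Rsum (fun j => / (2 * INR (S (2 * j))) - / (2 * INR (S (S (2 * j)))))%R Y))%C).
    - intros Y; unfold b, rem.
      rewrite <- !Csum_RtoC, <- Csum_mult_l, <- !Csum_minus; apply Csum_ext; intros j _.
      rewrite !row_limit_split by (exact Ht || lia).
      rewrite !RtoC_minus; ring.
    - apply Clim_minus; [|now apply Clim_RtoC].
      replace (t / 24)%C with (t / (2 * PI ^ 2) * RtoC (PI ^ 2 / 12))%C.
      + apply Clim_mult_l, Clim_RtoC, alternating_inv_sqr.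
      + rewrite RtoC_div, RtoC_pow by lra; field; repeat split; apply RtoC_neq_0; lra. }
  set (B := rho / (1 - rho) ^ 2) in *.
  assert (Hfin : is_lim_seq (fun Y => Cmod (L - (PI ^ 2 / 12)%R / t - (b Y - rem Y)))
     (Cmod (L - (PI ^ 2 / 12)%R / t - (t / 24 - c)))).
  { apply (Clim_Cmod (fun Y => L - (PI ^ 2 / 12)%R / t - (b Y - rem Y))%C).
    apply Clim_minus; [apply Clim_const | exact Hb]. }
  replace (L - ((PI ^ 2 / 12)%R / t + t / 24 - c))%C with
    (L - (PI ^ 2 / 12)%R / t - (t / 24 - c))%C by ring.
  refine (is_lim_seq_le _ (fun Y => K / INR (S Y) + B) _ (Finite B) _ Hfin _).
  - intros Y.
    replace (L - (PI ^ 2 / 12)%R / t - (b Y - rem Y))%C with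
      ((L - (PI ^ 2 / 12)%R / t - b Y) + rem Y)%C by ring.
    eapply Rle_trans; [apply Cmod_triangle|]; apply Rplus_le_compat; [apply HLb | apply Hrem].
  - replace (Finite B) with (Finite (K * 0 + B)) by (f_equal; ring).
    apply is_lim_seq_plus'; [|apply is_lim_seq_const].
    unfold Rdiv; apply is_lim_seq_mult'; [apply is_lim_seq_const|].
    apply (is_lim_seq_inv (fun Y => INR (S Y)) p_infty); [|discriminate].
    apply (is_lim_seq_incr_1 INR), is_lim_seq_INR.
Qed.

(** * The generating function and its coefficients *)

Fixpoint gf_prod (x : C) (K : nat) : C :=
  match K with O => 1 | S k => (gf_prod x k * (1 + x ^ S k))%C end.

Lemma Csum_swap (f : nat -> nat -> C) (K N : nat) :
  Csum (fun k => Csum (f k) N) K = Csum (fun m => Csum (fun k => f k m) K) N.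
Proof.
  induction K as [|K IH]; simpl.
  - rewrite (Csum_ext _ (fun _ => 0 * 0)%C), Csum_mult_l; [ring | intros; ring].
  - rewrite IH, <- Csum_plus; reflexivity.
Qed.

Lemma Clim_exp_log_sum (z : C) : Cmod z < 1 ->
  Clim (fun N => Cexp (Clog_sum z N)) (/ (1 - z))%C.
Proof.
  intros Hz.
  assert (H0 := Cmod_ge_0 z).
  assert (Nz : (1 - z)%C <> 0).
  { apply Cmod_gt_0; eapply Rlt_le_trans; [|apply Cmod_triangle_inv]; rewrite Cmod_1; lra. }
  assert (H : Clim (fun N => (1 - z) * Cexp (Clog_sum z N))%C 1).
  { apply (Clim_le _ _ (fun N => exp (Cmod z / (1 - Cmod z)) * (Cmod z * Cmod z ^ N))).
    - intros N; rewrite Rmult_comm; exact (one_minus_mult_exp_log_sum z N Hz).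
    - replace (Finite 0) with (Finite (exp (Cmod z / (1 - Cmod z)) * (Cmod z * 0))) by (f_equal; ring).
      repeat (apply is_lim_seq_mult'; [apply is_lim_seq_const|]).
      apply is_lim_seq_geom; rewrite Rabs_pos_eq; lra. }
  apply (Clim_mult_l (/ (1 - z))%C) in H.
  replace (/ (1 - z) * 1)%C with (/ (1 - z))%C in H by ring.
  revert H; apply Clim_ext; intros N; field; exact Nz.
Qed.

(** A truncated logarithm of [gf_prod], from [1 + z = (1 - z^2) / (1 - z)] in each factor. *)
Definition log_prod (x : C) (K N : nat) : C :=
  Csum (fun k => Clog_sum (x ^ S k) N - Clog_sum ((x ^ S k) ^ 2) N)%C K.

Lemma Cmod_pow_lt_1 (x : C) (k : nat) : Cmod x < 1 -> Cmod (x ^ S k) < 1.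
Proof.
  intros Hx; rewrite Cmod_pow; assert (H0 := Cmod_ge_0 x); simpl.
  assert (Cmod x ^ k <= 1 ^ k) by (apply pow_incr; lra); rewrite pow1 in *.
  assert (0 <= Cmod x ^ k) by now apply pow_le. nra.
Qed.

Lemma Clim_exp_log_prod (x : C) (K : nat) : Cmod x < 1 ->
  Clim (fun N => Cexp (log_prod x K N)) (gf_prod x K).
Proof.
  intros Hx; induction K as [|K IH].
  - apply (Clim_ext (fun _ => RtoC 1)); [|apply Clim_const].
    intros N; unfold log_prod; simpl; now rewrite Cexp_0.
  - change (gf_prod x (S K)) with (gf_prod x K * (1 + x ^ S K))%C; set (z := (x ^ S K)%C).
    assert (Hz : Cmod z < 1) by now apply Cmod_pow_lt_1.
    assert (Hz2 : Cmod (z ^ 2) < 1) by now apply Cmod_pow_lt_1.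
    apply (Clim_ext (fun N => Cexp (log_prod x K N) *
      (Cexp (Clog_sum z N) * / Cexp (Clog_sum (z ^ 2) N)))%C).
    { intros N; rewrite <- Cexp_opp, <- !Cexp_plus; reflexivity. }
    assert (Nz : (1 - z)%C <> 0).
    { apply Cmod_gt_0; eapply Rlt_le_trans; [|apply Cmod_triangle_inv]; rewrite Cmod_1; lra. }
    assert (Nz2 : (1 - z ^ 2)%C <> 0).
    { apply Cmod_gt_0; eapply Rlt_le_trans; [|apply Cmod_triangle_inv]; rewrite Cmod_1; lra. }
    apply Clim_mult; [exact IH|].
    replace (1 + z)%C with (/ (1 - z) * / / (1 - z ^ 2))%C.
    + apply Clim_mult; [now apply Clim_exp_log_sum|].
      apply Clim_inv; [| intros; apply Cexp_neq_0 | now apply Clim_exp_log_sum].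
      intros E; apply (f_equal (fun w => w * (1 - z ^ 2))%C) in E.
      rewrite Cinv_l, Cmult_0_l in E by exact Nz2; apply RtoC_inj in E; lra.
    + field; split; assumption.
Qed.

(** As [K] grows this tends to [y / (1 - y) - y^2 / (1 - y^2) = y / (1 - y^2)], the form that
    Euler's identity takes at a fixed power [m]; [inv_Csinh_exp] reads the limit as
    [1 / (2 sinh)]. *)
Lemma geom_pair_sum (y : C) (K : nat) : (1 - y)%C <> 0 -> (1 - y * y)%C <> 0 ->
  Csum (fun k => y ^ S k - (y ^ S k) ^ 2)%C K =
  ((y - y * y ^ K - y * y * y ^ K + y * y * (y ^ K) ^ 2) / (1 - y * y))%C.
Proof.
  intros H1 H2; induction K as [|K IH]; [simpl; field; exact H2|].
  rewrite Csum_S, IH, !(Cpow_S y K); field; exact H2.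
Qed.

Lemma inv_Csinh_exp (t : C) (M : R) : 0 < Re t -> 0 < M ->
  let y := Cexp (- (M * t)) in
  (1 - y * y)%C <> 0 /\ (/ (2 * Csinh (M * t)) = y / (1 - y * y))%C.
Proof.
  intros Ht HM y.
  assert (Hz : 0 < Re (M * t)) by (rewrite Re_RtoC_mult; now apply Rmult_lt_0_compat).
  assert (Ns := Csinh_neq_0 _ Hz).
  assert (Hy : Cmod y < 1).
  { unfold y; rewrite Cmod_Cexp, re_opp, <- exp_0; apply exp_increasing; lra. }
  assert (H0 := Cmod_ge_0 y).
  assert (Ny : (1 - y * y)%C <> 0).
  { apply Cmod_gt_0; eapply Rlt_le_trans; [|apply Cmod_triangle_inv].
    rewrite Cmod_1, Cmod_mult; nra. }
  split; [exact Ny|].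
  assert (Ne := Cexp_neq_0 (M * t)).
  assert (Ey : y = (/ Cexp (M * t))%C) by apply Cexp_opp.
  unfold Csinh in *; rewrite Cexp_opp in *; fold y in Ns |- *.
  rewrite Ey in *.
  field; repeat split; auto using C2_neq_0;
    intros E; apply Ns; transitivity ((Cexp (M * t) * Cexp (M * t) - 1) / (2 * Cexp (M * t)))%C;
    try (field; auto using C2_neq_0); rewrite E; unfold Cdiv; ring.
Qed.

(** Exchanging the finite sums makes [geom_pair_sum] at [y = x^m] the inner one. Its three tail
    terms give the factor 3, and the bound is uniform in the truncation [N]. *)
Lemma log_prod_approx (t : C) (K N : nat) : 0 < Re t ->
  let r := exp (- Re t) in
  Cmod (log_prod (Cexp (- t)) K N - log_gf t N) <= 3 * r ^ S K / ((1 - r ^ 2) * (1 - r)).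
Proof.
  intros Ht r.
  assert (Hr : 0 < r < 1).
  { split; [apply exp_pos | unfold r; rewrite <- exp_0; apply exp_increasing; lra]. }
  set (x := Cexp (- t)).
  assert (Mx : Cmod x = r) by (unfold x; rewrite Cmod_Cexp, re_opp; reflexivity).
  assert (E : log_prod x K N = Csum (fun m => / INR (S m) *
     Csum (fun k => (x ^ S m) ^ S k - ((x ^ S m) ^ S k) ^ 2)%C K)%C N).
  { unfold log_prod, Clog_sum.
    rewrite (Csum_ext _ (fun k => Csum (fun m => / INR (S m) *
      ((x ^ S m) ^ S k - ((x ^ S m) ^ S k) ^ 2))%C N)).
    - rewrite Csum_swap; apply Csum_ext; intros m _; now rewrite Csum_mult_l.
    - intros k _; rewrite <- Csum_minus; apply Csum_ext; intros m _.
      rewrite <- !Cpow_mult_r.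
      replace (S m * S k)%nat with (S k * S m)%nat by lia.
      replace (S k * (2 * S m))%nat with (S k * S m * 2)%nat by lia.
      unfold Cdiv; ring. }
  rewrite E; unfold log_gf; rewrite <- Csum_minus.
  apply Rle_trans with (Rsum (fun m => (3 * r ^ S K / (1 - r ^ 2)) * r ^ m) N).
  2:{ rewrite Rsum_mult_l.
      replace (3 * r ^ S K / ((1 - r ^ 2) * (1 - r))) with
        (3 * r ^ S K / (1 - r ^ 2) * / (1 - r)) by (field; nra).
      apply Rmult_le_compat_l; [|apply Rsum_geom_lt; lra].
      apply Rdiv_le_0_compat; [|nra].
      apply Rmult_le_pos; [lra | apply pow_le; lra]. }
  apply Cmod_Csum_le; intros m _.
  assert (HM := INR_S_ge_1 m); set (M := INR (S m)) in *.
  set (y := (x ^ S m)%C).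
  assert (Ey : y = Cexp (- (M * t))).
  { unfold y, x, M; rewrite <- Cexp_INR_mult; f_equal; ring. }
  destruct (inv_Csinh_exp t M Ht ltac:(lra)) as [Ny Es]; rewrite <- Ey in Ny, Es.
  assert (NM : RtoC M <> 0) by (apply RtoC_neq_0; lra).
  assert (Hz : 0 < Re (M * t)) by (rewrite Re_RtoC_mult; apply Rmult_lt_0_compat; lra).
  assert (Ns := Csinh_neq_0 _ Hz).
  assert (My : Cmod y = r ^ S m) by (unfold y; rewrite Cmod_pow, Mx; reflexivity).
  assert (Hy : 0 < Cmod y <= r).
  { rewrite My; split; [apply pow_lt; lra|]; simpl.
    assert (r ^ m <= 1 ^ m) by (apply pow_incr; lra); rewrite pow1 in *; nra. }
  assert (Ny1 : (1 - y)%C <> 0).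
  { apply Cmod_gt_0; eapply Rlt_le_trans; [|apply Cmod_triangle_inv]; rewrite Cmod_1; lra. }
  rewrite geom_pair_sum by assumption.
  replace (/ (2 * M * Csinh (M * t)))%C with (/ M * / (2 * Csinh (M * t)))%C
    by (field; repeat split; auto using C2_neq_0).
  rewrite Es.
  replace (/ M * ((y - y * y ^ K - y * y * y ^ K + y * y * (y ^ K) ^ 2) / (1 - y * y)) -
     / M * (y / (1 - y * y)))%C with
    (/ M * ((- (y * y ^ K) - y * (y * y ^ K) + (y * y ^ K) * (y * y ^ K)) / (1 - y * y)))%C
    by (field; auto).
  rewrite Cmod_mult, Cmod_inv, Cmod_R, Rabs_pos_eq by (auto; lra).
  rewrite Cmod_div by exact Ny.
  assert (MK : Cmod (y * y ^ K) = (r ^ S m) ^ S K).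
  { rewrite <- Cpow_S, Cmod_pow, My; reflexivity. }
  assert (HK : (r ^ S m) ^ S K <= r ^ S K * r ^ m).
  { rewrite <- pow_mult, <- pow_add.
    replace (S m * S K)%nat with (S K + m + m * K)%nat by lia.
    rewrite pow_add; rewrite <- (Rmult_1_r (r ^ (S K + m))) at 2.
    apply Rmult_le_compat_l; [apply pow_le; lra|].
    rewrite <- (pow1 (m * K)); apply pow_incr; lra. }
  assert (HK0 : 0 <= (r ^ S m) ^ S K) by (apply pow_le, pow_le; lra).
  assert (HK1 : (r ^ S m) ^ S K <= 1).
  { rewrite <- pow_mult, <- (pow1 (S m * S K)); apply pow_incr; lra. }
  assert (Num : Cmod (- (y * y ^ K) - y * (y * y ^ K) + (y * y ^ K) * (y * y ^ K)) <=
    3 * (r ^ S K * r ^ m)).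
  { eapply Rle_trans; [apply Cmod_triangle|].
    assert (H := Cmod_triangle_minus (- (y * y ^ K)) (y * (y * y ^ K))).
    rewrite Cmod_opp, (Cmod_mult y (y * y ^ K)), MK in H.
    rewrite (Cmod_mult (y * y ^ K) (y * y ^ K)), MK.
    set (p := (r ^ S m) ^ S K) in *. nra. }
  assert (Den : 1 - r ^ 2 <= Cmod (1 - y * y)).
  { eapply Rle_trans; [|apply Cmod_triangle_inv]; rewrite Cmod_1, Cmod_mult; nra. }
  assert (Dp : 0 < 1 - r ^ 2) by nra.
  assert (P0 : 0 <= r ^ S K * r ^ m) by (apply Rmult_le_pos; apply pow_le; lra).
  apply Rle_trans with (1 * (3 * (r ^ S K * r ^ m) / (1 - r ^ 2))).
  - apply Rmult_le_compat.
    + left; apply Rinv_0_lt_compat; lra.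
    + apply Rdiv_le_0_compat; [apply Cmod_ge_0 | lra].
    + rewrite <- Rinv_1; apply Rinv_le_contravar; lra.
    + unfold Rdiv; apply Rmult_le_compat; [apply Cmod_ge_0 | left; apply Rinv_0_lt_compat; lra | exact Num |].
      apply Rinv_le_contravar; lra.
  - right; field; lra.
Qed.

Lemma Cmod_log_gf_le (t : C) (N : nat) : 0 < Re t -> Cmod (log_gf t N) <= / Re t.
Proof.
  intros Ht.
  apply Rle_trans with (Rsum (fun m => / (2 * Re t) * / INR (S m) ^ 2) N).
  - apply Cmod_Csum_le; intros m _.
    eapply Rle_trans; [now apply Cmod_log_gf_term | now apply log_gf_term_le].
  - rewrite Rsum_mult_l.
    apply Rle_trans with (/ (2 * Re t) * 2); [|right; field; lra].
    apply Rmult_le_compat_l; [left; apply Rinv_0_lt_compat; lra | apply Rsum_inv_sqr_le].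
Qed.

(** Because [eta] depends on [s] only, the finite product can replace the infinite one under the
    integral over the whole circle. *)
Lemma gf_prod_approx (s : R) : 0 < s ->
  exists eta : nat -> R, is_lim_seq eta 0 /\
    forall (t L : C) (K : nat), Re t = s -> Clim (log_gf t) L ->
    Cmod (gf_prod (Cexp (- t)) K - Cexp L) <= eta K.
Proof.
  intros Hs; set (r := exp (- s)).
  assert (Hr : 0 < r < 1).
  { split; [apply exp_pos | unfold r; rewrite <- exp_0; apply exp_increasing; lra]. }
  set (beta := fun K => 3 / ((1 - r ^ 2) * (1 - r)) * (r * r ^ K)).
  assert (Hb : is_lim_seq beta 0).
  { unfold beta; replace (Finite 0) with (Finite (3 / ((1 - r ^ 2) * (1 - r)) * (r * 0))) by (f_equal; ring).
    repeat (apply is_lim_seq_mult'; [apply is_lim_seq_const|]).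
    apply is_lim_seq_geom; rewrite Rabs_pos_eq; lra. }
  exists (fun K => exp (/ s) * (beta K * exp (beta K))); split.
  - replace (Finite 0) with (Finite (exp (/ s) * (0 * exp 0))) by (f_equal; ring).
    apply is_lim_seq_mult'; [apply is_lim_seq_const|].
    apply is_lim_seq_mult'; [exact Hb|].
    apply (is_lim_seq_continuous exp); [|exact Hb].
    apply derivable_continuous_pt, derivable_pt_exp.
  - intros t L K Et HL.
    assert (Ht : 0 < Re t) by lra.
    assert (Hx : Cmod (Cexp (- t)) < 1) by (rewrite Cmod_Cexp, re_opp, Et; fold r; lra).
    assert (H1 := Clim_exp_log_prod _ K Hx).
    assert (H2 := Clim_Cexp _ _ HL).
    assert (H3 := Clim_Cmod _ _ (Clim_minus _ _ _ _ H1 H2)).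
    refine (is_lim_seq_le _ _ _ _ _ H3 (is_lim_seq_const _)).
    intros N; cbv beta.
    set (P := log_prod (Cexp (- t)) K N); set (G := log_gf t N).
    replace (Cexp P - Cexp G)%C with (Cexp G * (Cexp (P - G) - 1))%C.
    2:{ replace P with (G + (P - G))%C at 2 by ring; rewrite Cexp_plus; ring. }
    rewrite Cmod_mult.
    assert (HPG : Cmod (P - G) <= beta K).
    { eapply Rle_trans; [apply (log_prod_approx t K N Ht)|].
      rewrite Et; fold r; right; unfold beta; simpl; field; nra. }
    apply Rmult_le_compat; [apply Cmod_ge_0 | apply Cmod_ge_0 | |].
    + rewrite Cmod_Cexp; apply exp_le; eapply Rle_trans; [apply Re_le_Cmod|].
      rewrite <- Et; now apply Cmod_log_gf_le.
    + eapply Rle_trans; [apply Cmod_exp_minus_1|].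
      apply Rmult_le_compat; [apply Cmod_ge_0 | left; apply exp_pos | exact HPG | now apply exp_le].
Qed.

(** Partitions of [n] into distinct parts at most [K], split by whether the largest admissible part
    occurs; this mirrors the last factor of [gf_prod]. *)
Fixpoint cnt (K n : nat) : nat :=
  match K with
  | O => if Nat.eqb n 0 then 1%nat else 0%nat
  | S k => (cnt k n + if Nat.leb (S k) n then cnt k (n - S k) else 0)%nat
  end.

(** One more than the degree [K (K + 1) / 2] of the product, that is, its number of coefficients. *)
Fixpoint deg (K : nat) : nat := match K with O => 1%nat | S k => (deg k + S k)%nat end.

Lemma cnt_large (K n : nat) : (deg K <= n)%nat -> cnt K n = 0%nat.
Proof.
  revert n; induction K as [|K IH]; intros n Hn; simpl deg in Hn; simpl cnt.
  - destruct n; [lia | reflexivity].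
  - rewrite IH by lia.
    change (if match n with 0%nat => false | S m' => Nat.leb K m' end then cnt K (n - S K) else 0%nat)
      with (if Nat.leb (S K) n then cnt K (n - S K) else 0%nat).
    destruct (Nat.leb_spec (S K) n); [rewrite IH by lia|]; reflexivity.
Qed.

Lemma gf_prod_coef (x : C) (K : nat) :
  gf_prod x K = Csum (fun n => INR (cnt K n) * x ^ n)%C (deg K).
Proof.
  induction K as [|K IH]; [simpl; ring|].
  change (gf_prod x (S K)) with (gf_prod x K * (1 + x ^ S K))%C; simpl deg; rewrite IH.
  rewrite (Csum_ext (fun n => INR (cnt (S K) n) * x ^ n)%C (fun n => INR (cnt K n) * x ^ n +
    INR (if Nat.leb (S K) n then cnt K (n - S K) else 0%nat) * x ^ n)%C).
  2:{ intros n _; change (cnt (S K) n) with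
      (cnt K n + (if Nat.leb (S K) n then cnt K (n - S K) else 0))%nat.
      rewrite plus_INR, RtoC_plus; ring. }
  rewrite Csum_plus, Csum_add.
  rewrite (Csum_ext (fun k => INR (cnt K (deg K + k)) * x ^ (deg K + k))%C (fun _ => 0 * 0)%C).
  2:{ intros k _; rewrite cnt_large by lia; simpl; ring. }
  rewrite Csum_mult_l, (Nat.add_comm (deg K) (S K)), Csum_add.
  rewrite (Csum_ext (fun n => INR (if Nat.leb (S K) n then cnt K (n - S K) else 0%nat) * x ^ n)%C
    (fun _ => 0 * 0)%C (S K)).
  2:{ intros k Hk; replace (Nat.leb (S K) k) with false; [simpl; ring|].
      symmetry; apply Nat.leb_gt; lia. }
  rewrite Csum_mult_l.
  rewrite (Csum_ext (fun k => INR (if Nat.leb (S K) (S K + k) then cnt K (S K + k - S K) else 0%nat)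
     * x ^ (S K + k))%C (fun k => x ^ S K * (INR (cnt K k) * x ^ k))%C).
  2:{ intros k _; replace (Nat.leb (S K) (S K + k)) with true by (symmetry; apply Nat.leb_le; lia).
      replace (S K + k - S K)%nat with k by lia.
      rewrite Cpow_add_r; ring. }
  rewrite Csum_mult_l; ring.
Qed.

Lemma RInt_cos_INR (k : R) (j : nat) : (k = INR (S j) \/ k = - INR (S j)) ->
  is_RInt (fun th => cos (k * th)) (- PI) PI 0.
Proof.
  intros Hk.
  assert (Hk0 : k <> 0) by (assert (H := INR_S_ge_1 j); lra).
  assert (Hs : sin (k * PI) = 0).
  { destruct Hk as [E|E]; rewrite E.
    - apply sin_eq_0_1; exists (Z.of_nat (S j)); now rewrite <- INR_IZR_INZ.
    - apply sin_eq_0_1; exists (- Z.of_nat (S j))%Z; now rewrite opp_IZR, <- INR_IZR_INZ. }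
  replace 0 with (minus (sin (k * PI) / k) (sin (k * - PI) / k)).
  - apply (is_RInt_derive (fun th => sin (k * th) / k)).
    + intros x _; auto_derive; auto; field; exact Hk0.
    + intros x _; apply (ex_derive_continuous (fun th => cos (k * th))); auto_derive; auto.
  - unfold minus, plus, opp; simpl.
    replace (k * - PI) with (- (k * PI)) by ring; rewrite sin_neg, Hs; field; exact Hk0.
Qed.

Lemma Re_Csum (f : nat -> C) (n : nat) : Re (Csum f n) = Rsum (fun k => Re (f k)) n.
Proof. rewrite Csum_fst_snd; reflexivity. Qed.

(** Since the coefficients are real, the real part of Cauchy's integrand carries them and all
    integrals stay real. *)
Definition circle_integrand (K n : nat) (s th : R) : R :=
  Re (gf_prod (Cexp (- (s, th))) K * Cexp (INR n * (s, th))).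

Lemma circle_integrand_sum (K n : nat) (s th : R) :
  circle_integrand K n s th = Rsum (fun j => INR (cnt K j) *
    exp ((INR n - INR j) * s) * cos ((INR n - INR j) * th)) (deg K).
Proof.
  unfold circle_integrand; rewrite gf_prod_coef, Cmult_comm, <- Csum_mult_l.
  rewrite Re_Csum; apply Rsum_ext; intros j _.
  rewrite <- Cexp_INR_mult.
  replace (Cexp (INR n * (s, th)) * (INR (cnt K j) * Cexp (INR j * - (s, th))))%C with
    (INR (cnt K j) * Cexp ((INR n - INR j)%R * (s, th)))%C.
  - unfold Cexp, Re; simpl.
    replace ((INR n - INR j) * s - 0 * th) with ((INR n - INR j) * s) by ring.
    replace ((INR n - INR j) * th + 0 * s) with ((INR n - INR j) * th) by ring.
    ring.
  - rewrite RtoC_minus.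
    replace ((INR n - INR j) * (s, th))%C with (INR n * (s, th) + INR j * - (s, th))%C by ring.
    rewrite Cexp_plus; ring.
Qed.

Lemma ex_RInt_circle_integrand (K n : nat) (s a b : R) :
  ex_RInt (circle_integrand K n s) a b.
Proof.
  apply (ex_RInt_ext (fun th => Rsum (fun j => INR (cnt K j) *
    exp ((INR n - INR j) * s) * cos ((INR n - INR j) * th)) (deg K))).
  { intros; symmetry; apply circle_integrand_sum. }
  apply (ex_RInt_continuous (V := R_CompleteNormedModule)); intros x _.
  induction (deg K) as [|d IH]; simpl; [apply continuous_const|].
  apply (continuous_plus (fun th => Rsum (fun j => INR (cnt K j) *
    exp ((INR n - INR j) * s) * cos ((INR n - INR j) * th)) d)); [exact IH|].
  apply (ex_derive_continuous (fun th => INR (cnt K d) *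
    exp ((INR n - INR d) * s) * cos ((INR n - INR d) * th))); auto_derive; auto.
Qed.

(** Orthogonality of the cosines leaves the term [j = n], whose exponential weight is 1. For
    [deg K <= n] both sides vanish. *)
Lemma circle_integral (K n : nat) (s : R) :
  RInt (circle_integrand K n s) (- PI) PI = 2 * PI * INR (cnt K n).
Proof.
  apply is_RInt_unique.
  apply (is_RInt_ext (fun th => Rsum (fun j => INR (cnt K j) *
    exp ((INR n - INR j) * s) * cos ((INR n - INR j) * th)) (deg K))).
  { intros; symmetry; apply circle_integrand_sum. }
  assert (H : forall d, is_RInt (fun th => Rsum (fun j => INR (cnt K j) *
    exp ((INR n - INR j) * s) * cos ((INR n - INR j) * th)) d) (- PI) PI
    (if Nat.ltb n d then 2 * PI * INR (cnt K n) else 0)).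
  { induction d as [|d IH].
    - simpl Rsum; change (is_RInt (fun _ => 0) (- PI) PI 0).
      assert (H0 := is_RInt_const (V := R_NormedModule) (- PI) PI 0).
      unfold scal in H0; simpl in H0; unfold mult in H0; simpl in H0.
      rewrite Rmult_0_r in H0; exact H0.
    - assert (Hd : is_RInt (fun th => INR (cnt K d) * exp ((INR n - INR d) * s) *
         cos ((INR n - INR d) * th)) (- PI) PI (if Nat.eqb n d then 2 * PI * INR (cnt K n) else 0)).
      { destruct (Nat.eqb_spec n d) as [E|E].
        - subst d; apply (is_RInt_ext (fun _ => INR (cnt K n))).
          + intros; rewrite Rminus_diag, !Rmult_0_l, exp_0, cos_0, !Rmult_1_r; reflexivity.
          + assert (H0 := is_RInt_const (V := R_NormedModule) (- PI) PI (INR (cnt K n))).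
            unfold scal in H0; simpl in H0; unfold mult in H0; simpl in H0.
            replace (2 * PI * INR (cnt K n)) with ((PI - - PI) * INR (cnt K n)) by ring; exact H0.
        - assert (H0 : is_RInt (fun th => cos ((INR n - INR d) * th)) (- PI) PI 0).
          2:{ apply (is_RInt_scal _ _ _ (INR (cnt K d) * exp ((INR n - INR d) * s))) in H0.
              unfold scal in H0; simpl in H0; unfold mult in H0; simpl in H0.
              rewrite Rmult_0_r in H0; exact H0. }
          destruct (Nat.lt_ge_cases n d) as [L|L].
          + apply (RInt_cos_INR _ (d - n - 1)); right.
            replace (S (d - n - 1)) with (d - n)%nat by lia; rewrite minus_INR by lia; ring.
          + apply (RInt_cos_INR _ (n - d - 1)); left.
            replace (S (n - d - 1)) with (n - d)%nat by lia; rewrite minus_INR by lia; ring. }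
      assert (E : (if Nat.ltb n (S d) then 2 * PI * INR (cnt K n) else 0) =
        (if Nat.ltb n d then 2 * PI * INR (cnt K n) else 0) +
        (if Nat.eqb n d then 2 * PI * INR (cnt K n) else 0)).
      { destruct (Nat.ltb_spec n d), (Nat.eqb_spec n d), (Nat.ltb_spec n (S d)); try lia; ring. }
      exact (eq_ind_r (is_RInt _ (- PI) PI) (is_RInt_plus _ _ _ _ _ _ IH Hd) E). }
  specialize (H (deg K)).
  destruct (Nat.ltb_spec n (deg K)) as [L|L]; [exact H|].
  rewrite (cnt_large K n L); simpl INR; rewrite Rmult_0_r; exact H.
Qed.

(** * The main term as a contour integral *)

(** The coefficient of [t^-(k+1)] in [exp (A / t)], divided by [k!]: the termwise inverse Laplace
    transform. *)
Definition bessel_coef (A : R) (k : nat) : R := A ^ S k / (INR (fact k) * INR (fact (S k))).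

(* [bessel A x = sqrt (A / x) * I_1 (2 sqrt (A x))] *)
Definition bessel (A x : R) : R := PSeries (bessel_coef A) x.

Lemma CV_radius_bessel (A : R) : 0 < A -> CV_radius (bessel_coef A) = p_infty.
Proof.
  intros HA; apply CV_radius_infinite_DAlembert.
  - intros n; unfold bessel_coef, Rdiv; apply Rmult_integral_contrapositive; split.
    + apply pow_nonzero; lra.
    + apply Rinv_neq_0_compat, Rmult_integral_contrapositive; split; apply INR_fact_neq_0.
  - apply (is_lim_seq_ext (fun n => A * (/ INR (S n) * / INR (S (S n))))).
    + intros n.
      assert (H1 := INR_S_ge_1 n); assert (H2 := INR_S_ge_1 (S n)).
      assert (F1 := INR_fact_neq_0 n).
      assert (E : bessel_coef A (S n) / bessel_coef A n = A * (/ INR (S n) * / INR (S (S n)))).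
      { unfold bessel_coef; rewrite (fact_simpl (S n)), (fact_simpl n), !mult_INR.
        change (A ^ S (S n)) with (A * A ^ S n).
        assert (A ^ S n <> 0) by (apply pow_nonzero; lra).
        field; repeat split; auto; lra. }
      rewrite E, Rabs_pos_eq; [reflexivity|].
      apply Rmult_le_pos; [lra|]; apply Rmult_le_pos; left; apply Rinv_0_lt_compat; lra.
    + replace (Finite 0) with (Finite (A * (0 * 0))) by (f_equal; ring).
      assert (HS : is_lim_seq (fun n => / INR (S n)) 0).
      { apply (is_lim_seq_inv (fun n => INR (S n)) p_infty); [|discriminate].
        apply (is_lim_seq_incr_1 INR), is_lim_seq_INR. }
      apply is_lim_seq_mult'; [apply is_lim_seq_const|].
      apply is_lim_seq_mult'; [exact HS|].
      now apply (is_lim_seq_incr_1 (fun n => / INR (S n))).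
Qed.

Lemma is_lim_bessel (A x : R) : 0 < A ->
  is_lim_seq (Rsum (fun k => bessel_coef A k * x ^ k)) (bessel A x).
Proof.
  intros HA.
  assert (H : is_pseries (bessel_coef A) x (bessel A x)).
  { apply PSeries_correct, CV_radius_inside; now rewrite CV_radius_bessel. }
  apply is_pseries_R in H.
  apply (is_lim_seq_incr_1 (Rsum (fun k => bessel_coef A k * x ^ k))).
  apply (is_lim_seq_ext (sum_n (fun k => bessel_coef A k * x ^ k))); [|exact H].
  intros n; now rewrite Rsum_sum_n.
Qed.

Lemma is_RInt_Rsum (f : nat -> R -> R) (v : nat -> R) (a b : R) (n : nat) :
  (forall k, is_RInt (f k) a b (v k)) ->
  is_RInt (fun x => Rsum (fun k => f k x) n) a b (Rsum v n).
Proof.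
  intros H; induction n as [|n IH]; simpl.
  - assert (H0 := is_RInt_const (V := R_NormedModule) a b 0).
    unfold scal in H0; simpl in H0; unfold mult in H0; simpl in H0.
    rewrite Rmult_0_r in H0; exact H0.
  - exact (is_RInt_plus _ _ _ _ _ _ IH (H n)).
Qed.

Lemma Rabs_RInt_minus_le (f g : R -> R) (a b M : R) :
  a <= b -> ex_RInt f a b -> ex_RInt g a b ->
  (forall x, a <= x <= b -> Rabs (f x - g x) <= M) ->
  Rabs (RInt f a b - RInt g a b) <= (b - a) * M.
Proof.
  intros Hab Hf Hg HM.
  assert (E := RInt_minus f g a b Hf Hg : RInt (fun x => f x - g x) a b = RInt f a b - RInt g a b).
  rewrite <- E; apply abs_RInt_le_const; [exact Hab | exact (ex_RInt_minus f g a b Hf Hg) | exact HM].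
Qed.

Definition kernel (A nu : R) (t : C) : C := Cexp (A / t + nu * t).

Lemma Cmod_kernel (A nu : R) (t : C) : t <> 0 ->
  Cmod (kernel A nu t) = exp (A * Re t / Cmod t ^ 2 + nu * Re t).
Proof.
  intros Nt; unfold kernel; rewrite Cmod_Cexp, re_plus, re_scal_l; f_equal; f_equal.
  unfold Cdiv; rewrite re_scal_l; rewrite Cmod2_alt.
  assert (P : fst t ^ 2 + snd t ^ 2 <> 0).
  { intros E; apply Nt, Cmod_eq_0; apply Rsqr_0_uniq; unfold Rsqr; rewrite Cmod_sqr; lra. }
  unfold Re, Im; simpl; simpl in P; field; lra.
Qed.

Definition Cexp_trunc (z : C) (n : nat) : C := Csum (fun k => z ^ k / INR (fact k))%C n.

Lemma Re_polar_pow (rho ph : R) (k j : nat) : 0 < rho ->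
  let T := (rho * Cexp (Cim ph))%C in
  Re (T ^ k * (/ T) ^ j) = rho ^ k * / rho ^ j * cos ((INR k - INR j) * ph).
Proof.
  intros Hr T.
  assert (Nr : RtoC rho <> 0) by (apply RtoC_neq_0; lra).
  assert (Ne := Cexp_neq_0 (Cim ph)).
  assert (ET : (/ T)%C = (/ rho * Cexp (- Cim ph))%C).
  { unfold T; rewrite Cexp_opp; field; auto. }
  rewrite ET; unfold T; rewrite !Cpow_mult_l, <- !Cexp_INR_mult.
  replace (rho ^ k * Cexp (INR k * Cim ph) * ((/ rho) ^ j * Cexp (INR j * - Cim ph)))%C with
    (RtoC (rho ^ k * / rho ^ j) * Cexp ((INR k - INR j)%R * Cim ph))%C.
  - rewrite re_scal_l; f_equal; unfold Cexp, Cim, Re; simpl.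
    replace ((INR k - INR j) * 0 - 0 * ph) with 0 by ring.
    replace ((INR k - INR j) * ph + 0 * 0) with ((INR k - INR j) * ph) by ring.
    rewrite exp_0; ring.
  - rewrite RtoC_mult, RtoC_inv, !RtoC_pow, Cpow_inv by (try apply pow_nonzero; auto; lra).
    replace ((INR k - INR j)%R * Cim ph)%C with (INR k * Cim ph + INR j * - Cim ph)%C
      by (rewrite RtoC_minus; ring).
    rewrite Cexp_plus; ring.
Qed.

Lemma is_RInt_cos_diff (k j : nat) :
  is_RInt (fun ph => cos ((INR k - INR j) * ph)) (- PI) PI (if Nat.eqb j k then 2 * PI else 0).
Proof.
  destruct (Nat.eqb_spec j k) as [E|E].
  - subst j; apply (is_RInt_ext (fun _ => 1)).
    + intros; now rewrite Rminus_diag, Rmult_0_l, cos_0.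
    + assert (H0 := is_RInt_const (V := R_NormedModule) (- PI) PI 1).
      unfold scal in H0; simpl in H0; unfold mult in H0; simpl in H0.
      replace (2 * PI) with ((PI - - PI) * 1) by ring; exact H0.
  - destruct (Nat.lt_ge_cases k j) as [L|L].
    + apply (RInt_cos_INR _ (j - k - 1)); right.
      replace (S (j - k - 1)) with (j - k)%nat by lia; rewrite minus_INR by lia; ring.
    + apply (RInt_cos_INR _ (k - j - 1)); left.
      replace (S (k - j - 1)) with (k - j)%nat by lia; rewrite minus_INR by lia; ring.
Qed.

Lemma Rsum_delta (c : nat -> R) (i n : nat) :
  Rsum (fun j => if Nat.eqb j i then c j else 0) n = if Nat.ltb i n then c i else 0.
Proof.
  induction n as [|n IH]; [reflexivity|].
  rewrite Rsum_S, IH.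
  destruct (Nat.ltb_spec i n), (Nat.eqb_spec n i), (Nat.ltb_spec i (S n)); try lia; subst; ring.
Qed.

(** A residue computed by orthogonality: the factor [T] comes from [dT = i T dph], and only the
    products with [j = k + 1] have degree 0 in [T]. *)
Lemma truncated_circle_integral (A nu rho : R) (n : nat) : 0 < rho ->
  is_RInt (fun ph => let T := (rho * Cexp (Cim ph))%C in
     Re (Cexp_trunc (A / T) (S n) * Cexp_trunc (nu * T) (S n) * T)) (- PI) PI
    (2 * PI * Rsum (fun k => bessel_coef A k * nu ^ k) n).
Proof.
  intros Hr.
  set (c := fun j k => A ^ j / INR (fact j) * (nu ^ k / INR (fact k)) * (rho ^ S k * / rho ^ j)).
  assert (H : is_RInt (fun ph => Rsum (fun k => Rsum (fun j => c j k * cos ((INR (S k) - INR j) * ph)) (S n)) (S n))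
    (- PI) PI (Rsum (fun k => Rsum (fun j => c j k * (if Nat.eqb j (S k) then 2 * PI else 0)) (S n)) (S n))).
  { apply (is_RInt_Rsum (fun k ph => Rsum (fun j => c j k * cos ((INR (S k) - INR j) * ph)) (S n))).
    intros k; apply (is_RInt_Rsum (fun j ph => c j k * cos ((INR (S k) - INR j) * ph))).
    intros j; exact (is_RInt_scal _ _ _ (c j k) _ (is_RInt_cos_diff (S k) j)). }
  replace (Rsum (fun k => Rsum _ (S n)) (S n)) with
    (2 * PI * Rsum (fun k => bessel_coef A k * nu ^ k) n) in H.
  2:{ rewrite (Rsum_ext (fun k => Rsum (fun j => c j k * (if Nat.eqb j (S k) then 2 * PI else 0)) (S n))
        (fun k => if Nat.ltb (S k) (S n) then 2 * PI * c (S k) k else 0)).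
      (* The last index [k = n] would need [j = n + 1], which the truncation excludes; hence [n]
         terms remain. *)
      - rewrite Rsum_S.
        replace (Nat.ltb (S n) (S n)) with false by (symmetry; apply Nat.ltb_irrefl).
        rewrite Rplus_0_r, <- Rsum_mult_l; apply Rsum_ext; intros k Hk.
        replace (Nat.ltb (S k) (S n)) with true by (symmetry; apply Nat.ltb_lt; lia).
        unfold c, bessel_coef.
        assert (rho ^ S k <> 0) by (apply pow_nonzero; lra).
        field; repeat split; auto using INR_fact_neq_0.
      - intros k _.
        rewrite <- (Rsum_delta (fun j => 2 * PI * c j k) (S k) (S n)).
        apply Rsum_ext; intros j _; destruct (Nat.eqb j (S k)); ring. }
  revert H; apply is_RInt_ext; intros ph _; cbv zeta.
  set (T := (rho * Cexp (Cim ph))%C).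
  assert (NT : T <> 0).
  { unfold T; apply Cmult_neq_0; [apply RtoC_neq_0; lra | apply Cexp_neq_0]. }
  symmetry.
  unfold Cexp_trunc.
  replace (Csum (fun k => (A / T) ^ k / INR (fact k))%C (S n) *
     Csum (fun k => (nu * T) ^ k / INR (fact k))%C (S n) * T)%C with
    (Csum (fun k => Csum (fun j => ((A ^ j / INR (fact j) * (nu ^ k / INR (fact k)))%R
        * (T ^ S k * (/ T) ^ j))%C) (S n)) (S n)).
  - rewrite Re_Csum; apply Rsum_ext; intros k _.
    rewrite Re_Csum; apply Rsum_ext; intros j _.
    rewrite re_scal_l; unfold T; rewrite Re_polar_pow by exact Hr; unfold c; ring.
  - set (S1 := Csum (fun k => (A / T) ^ k / INR (fact k))%C (S n)).
    rewrite (Csum_ext _ (fun k => (S1 * T) * ((nu * T) ^ k / INR (fact k)))%C).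
    + rewrite Csum_mult_l; ring.
    + intros k _.
      rewrite (Csum_ext _ (fun j => (T * ((nu * T) ^ k / INR (fact k))) * ((A / T) ^ j / INR (fact j)))%C).
      * rewrite Csum_mult_l; fold S1; ring.
      * intros j _.
        assert (F1 : RtoC (INR (fact j)) <> 0) by apply RtoC_neq_0, INR_fact_neq_0.
        assert (F2 : RtoC (INR (fact k)) <> 0) by apply RtoC_neq_0, INR_fact_neq_0.
        unfold Cdiv; rewrite !Cpow_mult_l, Cpow_S.
        rewrite RtoC_mult, !RtoC_div, !RtoC_pow by apply INR_fact_neq_0.
        unfold Cdiv; ring.
Qed.

Lemma exp_trunc_error_lim (x : R) : is_lim_seq (fun n => x ^ n / INR (fact n) * exp x) 0.
Proof.
  replace (Finite 0) with (Finite (0 * exp x)) by (f_equal; ring).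
  apply is_lim_seq_mult'; [|apply is_lim_seq_const].
  assert (H := cv_speed_pow_fact x); apply is_lim_seq_Reals; exact H.
Qed.

Definition circle_kernel (A nu rho ph : R) : R :=
  let T := (rho * Cexp (Cim ph))%C in Re (kernel A nu T * T).

Lemma Cmod_polar (rho ph : R) : 0 < rho -> Cmod (rho * Cexp (Cim ph)) = rho.
Proof.
  intros Hr; rewrite Cmod_mult, Cmod_R, Rabs_pos_eq, Cmod_Cexp by lra.
  unfold Cim, Re; simpl; rewrite exp_0; ring.
Qed.

Lemma ex_RInt_circle_kernel (A nu rho a b : R) : 0 < rho -> ex_RInt (circle_kernel A nu rho) a b.
Proof.
  intros Hr; apply (ex_RInt_continuous (V := R_CompleteNormedModule)); intros ph _.
  apply (ex_derive_continuous (circle_kernel A nu rho)).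
  apply (ex_derive_ext (fun ph => exp (A * cos ph / rho + nu * rho * cos ph) *
    (cos (nu * rho * sin ph - A * sin ph / rho) * (rho * cos ph) -
     sin (nu * rho * sin ph - A * sin ph / rho) * (rho * sin ph)))).
  - intros x; unfold circle_kernel, kernel.
    set (T := (rho * Cexp (Cim x))%C).
    assert (ET : T = (rho * cos x, rho * sin x)).
    { unfold T, Cexp, Cim; apply injective_projections; simpl; rewrite exp_0; ring. }
    assert (EW : (A / T + nu * T)%C = (A * cos x / rho + nu * rho * cos x, nu * rho * sin x - A * sin x / rho)).
    { assert (Nr : RtoC rho <> 0) by (apply RtoC_neq_0; lra).
      assert (Einv : (/ T)%C = (/ rho * Cexp (- Cim x))%C).
      { unfold T; rewrite Cexp_opp; field; split; [apply Cexp_neq_0 | exact Nr]. }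
      unfold Cdiv; rewrite Einv, ET, <- RtoC_inv by lra.
      unfold Cexp, Cim; apply injective_projections; simpl; rewrite Ropp_0, exp_0, cos_neg, sin_neg; field; lra. }
    rewrite EW, ET; unfold Cexp, Re; simpl; ring.
  - auto_derive; lra.
Qed.

(** Both truncated exponentials converge uniformly on the circle, so the truncated integrals pass to
    the limit. *)
Lemma bessel_circle_integral (A nu rho : R) : 0 < A -> 0 < nu -> 0 < rho ->
  RInt (circle_kernel A nu rho) (- PI) PI = 2 * PI * bessel A nu.
Proof.
  intros HA Hnu Hr.
  assert (HPI := PI_bounds).
  set (x1 := A / rho); set (x2 := nu * rho).
  assert (Hx1 : 0 < x1) by (now apply Rdiv_lt_0_compat).
  assert (Hx2 : 0 < x2) by (now apply Rmult_lt_0_compat).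
  set (e1 := fun n => x1 ^ S n / INR (fact (S n)) * exp x1).
  set (e2 := fun n => x2 ^ S n / INR (fact (S n)) * exp x2).
  set (err := fun n => rho * (e1 n * exp x2 + (exp x1 + e1 n) * e2 n)).
  assert (L1 : is_lim_seq e1 0) by apply (is_lim_seq_incr_1 (fun n => x1 ^ n / INR (fact n) * exp x1)), exp_trunc_error_lim.
  assert (L2 : is_lim_seq e2 0) by apply (is_lim_seq_incr_1 (fun n => x2 ^ n / INR (fact n) * exp x2)), exp_trunc_error_lim.
  assert (Lerr : is_lim_seq err 0).
  { unfold err; replace (Finite 0) with (Finite (rho * (0 * exp x2 + (exp x1 + 0) * 0))) by (f_equal; ring).
    apply is_lim_seq_mult'; [apply is_lim_seq_const|].
    apply is_lim_seq_plus'; apply is_lim_seq_mult'; auto using is_lim_seq_const.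
    apply is_lim_seq_plus'; auto using is_lim_seq_const. }
  assert (Hpt : forall n ph, Rabs (circle_kernel A nu rho ph -
     (let T := (rho * Cexp (Cim ph))%C in
      Re (Cexp_trunc (A / T) (S n) * Cexp_trunc (nu * T) (S n) * T))) <= err n).
  { intros n ph; unfold circle_kernel, kernel; cbv zeta.
    set (T := (rho * Cexp (Cim ph))%C).
    assert (NT : T <> 0).
    { unfold T; apply Cmult_neq_0; [apply RtoC_neq_0; lra | apply Cexp_neq_0]. }
    assert (MT : Cmod T = rho) by now apply Cmod_polar.
    assert (M1 : Cmod (A / T) = x1) by (rewrite Cmod_div, Cmod_R, Rabs_pos_eq, MT by (auto; lra); reflexivity).
    assert (M2 : Cmod (nu * T) = x2) by (rewrite Cmod_mult, Cmod_R, Rabs_pos_eq, MT by lra; reflexivity).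
    rewrite Cexp_plus.
    set (a := Cexp (A / T)); set (b := Cexp (nu * T)).
    set (a' := Cexp_trunc (A / T) (S n)); set (b' := Cexp_trunc (nu * T) (S n)).
    assert (Ea : Cmod (a - a') <= e1 n) by (unfold e1; rewrite <- M1; apply Cmod_exp_taylor).
    assert (Eb : Cmod (b - b') <= e2 n) by (unfold e2; rewrite <- M2; apply Cmod_exp_taylor).
    assert (Ma : Cmod a <= exp x1) by (unfold a; rewrite Cmod_Cexp, <- M1; apply exp_le, Re_le_Cmod).
    assert (Mb : Cmod b <= exp x2) by (unfold b; rewrite Cmod_Cexp, <- M2; apply exp_le, Re_le_Cmod).
    assert (Ma' : Cmod a' <= exp x1 + e1 n).
    { assert (H := Cmod_triangle_inv a' a); rewrite Cmod_minus_sym in H; lra. }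
    replace (Re (a * b * T) - Re (a' * b' * T)) with (Re (((a - a') * b + a' * (b - b')) * T)).
    2:{ unfold Re; simpl; ring. }
    eapply Rle_trans; [apply re_le_Cmod|].
    rewrite Cmod_mult, MT; unfold err; rewrite Rmult_comm; apply Rmult_le_compat_l; [lra|].
    eapply Rle_trans; [apply Cmod_triangle|]; rewrite !Cmod_mult.
    apply Rplus_le_compat; apply Rmult_le_compat; auto using Cmod_ge_0. }
  assert (Hint : forall n, Rabs (RInt (circle_kernel A nu rho) (- PI) PI -
     2 * PI * Rsum (fun k => bessel_coef A k * nu ^ k) n) <= 2 * PI * err n).
  { intros n.
    assert (HT := truncated_circle_integral A nu rho n Hr).
    rewrite <- (is_RInt_unique _ _ _ _ HT).
    assert (E1 := ex_RInt_circle_kernel A nu rho (- PI) PI Hr).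
    assert (E2 : ex_RInt (fun ph => let T := (rho * Cexp (Cim ph))%C in
      Re (Cexp_trunc (A / T) (S n) * Cexp_trunc (nu * T) (S n) * T)) (- PI) PI) by (eexists; exact HT).
    replace (2 * PI * err n) with ((PI - - PI) * err n) by ring.
    apply Rabs_RInt_minus_le; [lra | exact E1 | exact E2 | intros ph _; apply (Hpt n ph)]. }
  assert (Lim : is_lim_seq (fun n => RInt (circle_kernel A nu rho) (- PI) PI -
     2 * PI * Rsum (fun k => bessel_coef A k * nu ^ k) n)
     (RInt (circle_kernel A nu rho) (- PI) PI - 2 * PI * bessel A nu)).
  { apply is_lim_seq_minus'; [apply is_lim_seq_const|].
    apply (is_lim_seq_scal_l _ (2 * PI) (bessel A nu)); now apply is_lim_bessel. }
  apply is_lim_seq_abs in Lim.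
  assert (Lerr2 : is_lim_seq (fun n => 2 * PI * err n) 0).
  { replace (Finite 0) with (Rbar_mult (2 * PI) 0) by (simpl; f_equal; ring).
    now apply is_lim_seq_scal_l. }
  assert (H := is_lim_seq_le _ _ _ _ Hint Lim Lerr2); simpl in H.
  apply Rminus_diag_uniq.
  assert (H2 := Rabs_pos (RInt (circle_kernel A nu rho) (- PI) PI - 2 * PI * bessel A nu)).
  destruct (Req_dec (RInt (circle_kernel A nu rho) (- PI) PI - 2 * PI * bessel A nu) 0) as [E|E]; [exact E|].
  apply Rabs_pos_lt in E; lra.
Qed.

(** * Cauchy's theorem between a chord and its arc *)

Lemma is_Cderive_inv (h : R -> C) (u : R) (d : C) : h u <> 0 ->
  is_Cderive h u d -> is_Cderive (fun x => / h x)%C u (- d / (h u * h u))%C.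
Proof.
  intros Hn [H1 H2].
  set (f := fun x => fst (h x)) in *; set (g := fun x => snd (h x)) in *.
  assert (P : f u * f u + g u * g u <> 0).
  { intros E; apply Hn, Cmod_eq_0, Rsqr_0_uniq; unfold Rsqr; rewrite Cmod_sqr; exact E. }
  assert (E1 : ex_derive f u) by (eexists; exact H1).
  assert (E2 : ex_derive g u) by (eexists; exact H2).
  assert (D1 : Derive f u = fst d) by (apply is_derive_unique; exact H1).
  assert (D2 : Derive g u = snd d) by (apply is_derive_unique; exact H2).
  split.
  - apply (is_derive_ext (fun x => f x / (f x * f x + g x * g x))).
    { intros x; unfold f, g, Cinv; simpl; f_equal; ring. }
    auto_derive; [tauto|].
    change (Derive (fun x => f x) u) with (Derive f u); change (Derive (fun x => g x) u) with (Derive g u).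
    rewrite D1, D2; unfold Cdiv, Cinv; simpl; fold (f u) (g u).
    replace ((f u * f u - g u * g u) * ((f u * f u - g u * g u) * 1) +
      (f u * g u + g u * f u) * ((f u * g u + g u * f u) * 1))
      with ((f u * f u + g u * g u) * (f u * f u + g u * g u)) by ring.
    field; exact P.
  - apply (is_derive_ext (fun x => - g x / (f x * f x + g x * g x))).
    { intros x; unfold f, g, Cinv; simpl; f_equal; ring. }
    auto_derive; [tauto|].
    change (Derive (fun x => f x) u) with (Derive f u); change (Derive (fun x => g x) u) with (Derive g u).
    rewrite D1, D2; unfold Cdiv, Cinv; simpl; fold (f u) (g u).
    replace ((f u * f u - g u * g u) * ((f u * f u - g u * g u) * 1) +
      (f u * g u + g u * f u) * ((f u * g u + g u * f u) * 1))
      with ((f u * f u + g u * g u) * (f u * f u + g u * g u)) by ring.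
    field; exact P.
Qed.

Lemma is_Cderive_kernel (A nu : R) (h : R -> C) (u : R) (d : C) : h u <> 0 ->
  is_Cderive h u d ->
  is_Cderive (fun x => kernel A nu (h x)) u
    ((A * (- d / (h u * h u)) + nu * d) * kernel A nu (h u))%C.
Proof.
  intros Hn Hd; unfold kernel.
  apply (is_Cderive_Cexp (fun x => A / h x + nu * h x)%C).
  apply is_Cderive_plus.
  - replace (A * (- d / (h u * h u)))%C with (0 * (/ h u) + A * (- d / (h u * h u)))%C by ring.
    apply (is_Cderive_mult (fun _ => RtoC A) (fun x => / h x)%C);
      [apply is_Cderive_const | now apply is_Cderive_inv].
  - replace (nu * d)%C with (0 * h u + nu * d)%C by ring.
    apply (is_Cderive_mult (fun _ => RtoC nu)); [apply is_Cderive_const | exact Hd].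
Qed.

(** Joint continuity in both parameters, as differentiation under the integral requires. *)
Definition Ccont2 (F : R -> R -> C) (x y : R) : Prop :=
  continuity_2d_pt (fun u v => fst (F u v)) x y /\
  continuity_2d_pt (fun u v => snd (F u v)) x y.

Lemma Ccont2_const (a : C) (x y : R) : Ccont2 (fun _ _ => a) x y.
Proof. split; apply continuity_2d_pt_const. Qed.

Lemma Ccont2_plus (F G : R -> R -> C) (x y : R) :
  Ccont2 F x y -> Ccont2 G x y -> Ccont2 (fun u v => F u v + G u v)%C x y.
Proof.
  intros [H1 H2] [H3 H4]; split; simpl; now apply continuity_2d_pt_plus.
Qed.

Lemma Ccont2_mult (F G : R -> R -> C) (x y : R) :
  Ccont2 F x y -> Ccont2 G x y -> Ccont2 (fun u v => F u v * G u v)%C x y.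
Proof.
  intros [H1 H2] [H3 H4]; split; simpl.
  - apply continuity_2d_pt_minus; now apply continuity_2d_pt_mult.
  - apply continuity_2d_pt_plus; now apply continuity_2d_pt_mult.
Qed.

Lemma Ccont2_opp (F : R -> R -> C) (x y : R) :
  Ccont2 F x y -> Ccont2 (fun u v => - F u v)%C x y.
Proof. intros [H1 H2]; split; simpl; now apply continuity_2d_pt_opp. Qed.

Lemma Ccont2_inv (F : R -> R -> C) (x y : R) : F x y <> 0 ->
  Ccont2 F x y -> Ccont2 (fun u v => / F u v)%C x y.
Proof.
  intros Hn [H1 H2].
  assert (P : fst (F x y) ^ 2 + snd (F x y) ^ 2 <> 0).
  { intros E; apply Hn, Cmod_eq_0, Rsqr_0_uniq; unfold Rsqr; rewrite Cmod_sqr; lra. }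
  assert (HD : continuity_2d_pt (fun u v => fst (F u v) ^ 2 + snd (F u v) ^ 2) x y).
  { apply (continuity_2d_pt_ext (fun u v => fst (F u v) * fst (F u v) + snd (F u v) * snd (F u v))).
    - intros; ring.
    - apply continuity_2d_pt_plus; now apply continuity_2d_pt_mult. }
  split; unfold Cinv; cbv beta delta [fst snd]; fold (@fst R R) (@snd R R).
  - apply (continuity_2d_pt_mult (fun u v => fst (F u v)) (fun u v => / (fst (F u v) ^ 2 + snd (F u v) ^ 2)));
      [exact H1 | now apply continuity_2d_pt_inv].
  - apply (continuity_2d_pt_mult (fun u v => - snd (F u v)) (fun u v => / (fst (F u v) ^ 2 + snd (F u v) ^ 2)));
      [now apply continuity_2d_pt_opp | now apply continuity_2d_pt_inv].
Qed.

Lemma Ccont2_Cexp (F : R -> R -> C) (x y : R) :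
  Ccont2 F x y -> Ccont2 (fun u v => Cexp (F u v)) x y.
Proof.
  intros [H1 H2].
  assert (He : continuity_2d_pt (fun u v => exp (fst (F u v))) x y).
  { apply (continuity_1d_2d_pt_comp exp); [|exact H1].
    apply derivable_continuous_pt, derivable_pt_exp. }
  assert (Hc : continuity_2d_pt (fun u v => cos (snd (F u v))) x y).
  { apply (continuity_1d_2d_pt_comp cos); [|exact H2]; apply continuity_cos. }
  assert (Hs : continuity_2d_pt (fun u v => sin (snd (F u v))) x y).
  { apply (continuity_1d_2d_pt_comp sin); [|exact H2]; apply continuity_sin. }
  split; simpl.
  - apply (continuity_2d_pt_mult _ _ _ _ He Hc).
  - apply (continuity_2d_pt_mult _ _ _ _ He Hs).
Qed.

Lemma continuity_2d_snd_comp (f : R -> R) (x y : R) :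
  continuity_pt f y -> continuity_2d_pt (fun _ v => f v) x y.
Proof. intros H; apply (continuity_1d_2d_pt_comp f (fun _ v => v)); [exact H | apply continuity_2d_pt_id2]. Qed.

(** The chord of the circle of radius [rho] through [s] is deformed to its arc along
    the segments parallel to the real axis. *)
Section Deformation.

Variables A nu s rho : R.

Definition path (l ph : R) : C := (s + l * (rho * cos ph - s), rho * sin ph).
Definition path_ph (l ph : R) : C := (- (l * (rho * sin ph)), rho * cos ph).
Definition path_l (ph : R) : C := (rho * cos ph - s, 0).
Definition path_l_ph (ph : R) : C := (- (rho * sin ph), 0).

Lemma is_Cderive_path_l (l ph : R) : is_Cderive (fun x => path x ph) l (path_l ph).
Proof. split; simpl; auto_derive; auto; ring. Qed.

Lemma is_Cderive_path_ph (l ph : R) : is_Cderive (path l) ph (path_ph l ph).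
Proof. split; simpl; auto_derive; auto; ring. Qed.

Lemma is_Cderive_path_ph_l (l ph : R) : is_Cderive (fun x => path_ph x ph) l (path_l_ph ph).
Proof. split; simpl; auto_derive; auto; ring. Qed.

Lemma is_Cderive_path_l_ph (ph : R) : is_Cderive path_l ph (path_l_ph ph).
Proof. split; simpl; auto_derive; auto; ring. Qed.

(** The common value of [d/dl (kernel * path_ph)] and [d/dph (kernel * path_l)]. Their equality is
    the closedness of the form [kernel dt]. *)
Definition deform (l ph : R) : C :=
  ((A * (- path_l ph / (path l ph * path l ph)) + nu * path_l ph) * kernel A nu (path l ph)
     * path_ph l ph + kernel A nu (path l ph) * path_l_ph ph)%C.

Lemma is_Cderive_deform_l (l ph : R) : path l ph <> 0 ->
  is_Cderive (fun x => kernel A nu (path x ph) * path_ph x ph)%C l (deform l ph).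
Proof.
  intros Hn; unfold deform.
  apply (is_Cderive_mult (fun x => kernel A nu (path x ph)) (fun x => path_ph x ph));
    [|apply is_Cderive_path_ph_l].
  apply (is_Cderive_kernel A nu (fun x => path x ph)); [exact Hn | apply is_Cderive_path_l].
Qed.

Lemma is_Cderive_deform_ph (l ph : R) : path l ph <> 0 ->
  is_Cderive (fun x => kernel A nu (path l x) * path_l x)%C ph (deform l ph).
Proof.
  intros Hn.
  replace (deform l ph) with
    ((A * (- path_ph l ph / (path l ph * path l ph)) + nu * path_ph l ph) * kernel A nu (path l ph)
      * path_l ph + kernel A nu (path l ph) * path_l_ph ph)%C by (unfold deform, Cdiv; ring).
  apply (is_Cderive_mult (fun x => kernel A nu (path l x)) path_l); [|apply is_Cderive_path_l_ph].
  apply (is_Cderive_kernel A nu (path l)); [exact Hn | apply is_Cderive_path_ph].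
Qed.

Lemma Ccont2_path (l ph : R) : Ccont2 path l ph.
Proof.
  split; simpl.
  - apply continuity_2d_pt_plus; [apply continuity_2d_pt_const|].
    apply continuity_2d_pt_mult; [apply continuity_2d_pt_id1|].
    apply (continuity_2d_snd_comp (fun v => rho * cos v - s)); reg.
  - apply (continuity_2d_snd_comp (fun v => rho * sin v)); reg.
Qed.

Lemma Ccont2_deform (l ph : R) : path l ph <> 0 -> Ccont2 deform l ph.
Proof.
  intros Hn.
  assert (H0 := Ccont2_path l ph).
  assert (Hl : Ccont2 (fun _ v => path_l v) l ph).
  { split; simpl; [|apply continuity_2d_pt_const].
    apply (continuity_2d_snd_comp (fun v => rho * cos v - s)); reg. }
  assert (Hlp : Ccont2 (fun _ v => path_l_ph v) l ph).
  { split; simpl; [|apply continuity_2d_pt_const].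
    apply (continuity_2d_snd_comp (fun v => - (rho * sin v))); reg. }
  assert (Hp : Ccont2 path_ph l ph).
  { split; simpl.
    - apply continuity_2d_pt_opp, continuity_2d_pt_mult; [apply continuity_2d_pt_id1|].
      apply (continuity_2d_snd_comp (fun v => rho * sin v)); reg.
    - apply (continuity_2d_snd_comp (fun v => rho * cos v)); reg. }
  assert (Hk : Ccont2 (fun u v => kernel A nu (path u v)) l ph).
  { unfold kernel; apply Ccont2_Cexp, Ccont2_plus; apply Ccont2_mult; auto using Ccont2_const.
    now apply Ccont2_inv. }
  unfold deform; apply Ccont2_plus; [|now apply Ccont2_mult].
  apply Ccont2_mult; [|exact Hp]; apply Ccont2_mult; [|exact Hk].
  apply Ccont2_plus; apply Ccont2_mult; auto using Ccont2_const.
  unfold Cdiv; apply Ccont2_mult; [now apply Ccont2_opp|].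
  apply (Ccont2_inv (fun u v => path u v * path u v)%C); [now apply Cmult_neq_0 | now apply Ccont2_mult].
Qed.

Lemma path_neq_0_of_fst (l ph : R) : fst (path l ph) <> 0 -> path l ph <> 0.
Proof. intros H E; apply H; rewrite E; reflexivity. Qed.

Variable ph1 : R.
Hypothesis Hs : 0 < s < rho.
Hypothesis Hph1 : 0 < ph1 < PI / 2.
Hypothesis Hcos : rho * cos ph1 = s.

Lemma chord_le_arc (ph : R) : - ph1 <= ph <= ph1 -> s <= rho * cos ph <= rho.
Proof using Hs Hph1 Hcos.
  intros Hph; assert (HPI := PI_bounds); assert (Hb := COS_bound ph).
  split; [|nra].
  rewrite <- Hcos; apply Rmult_le_compat_l; [lra|].
  destruct (Rle_dec 0 ph) as [H|H].
  - apply cos_decr_1; lra.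
  - rewrite <- (cos_neg ph); apply cos_decr_1; lra.
Qed.

Lemma path_fst_pos (l ph : R) : - (s / rho) < l -> - ph1 <= ph <= ph1 -> 0 < fst (path l ph).
Proof using Hs Hph1 Hcos.
  intros Hl Hph; simpl; assert (Hc := chord_le_arc ph Hph).
  destruct (Rle_dec 0 l) as [H|H]; [nra|].
  assert (Hsr : s / rho * (rho - s) < s).
  { replace (s / rho * (rho - s)) with (s - s * s / rho) by (field; lra).
    assert (0 < s * s / rho) by (apply Rdiv_lt_0_compat; nra); lra. }
  assert ((- l) * (rho * cos ph - s) <= s / rho * (rho - s)); [|lra].
  apply Rmult_le_compat; lra.
Qed.

(** The imaginary part is taken since [dt] carries a factor [i]: it is [i dth] on the chord and
    [i T dph] on the arc. *)
Definition deformed_integral (l : R) : R :=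
  RInt (fun ph => snd (kernel A nu (path l ph) * path_ph l ph)%C) (- ph1) ph1.

(** Differentiation under the integral gives a [ph]-derivative of [kernel * path_l], hence boundary
    terms; these vanish because the endpoints do not move with [l]. *)
Lemma is_derive_deformed_integral (l : R) : 0 <= l <= 1 ->
  is_derive deformed_integral l 0.
Proof using Hs Hph1 Hcos.
  intros Hl.
  assert (Hsr : 0 < s / rho) by (apply Rdiv_lt_0_compat; lra).
  assert (Emin : Rmin (- ph1) ph1 = - ph1) by (apply Rmin_left; lra).
  assert (Emax : Rmax (- ph1) ph1 = ph1) by (apply Rmax_right; lra).
  assert (Hnz : forall l' ph, - (s / rho) < l' -> - ph1 <= ph <= ph1 -> path l' ph <> 0).
  { intros l' ph H1 H2; apply path_neq_0_of_fst; assert (H := path_fst_pos l' ph H1 H2); lra. }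
  assert (Hder := is_derive_RInt_param
    (fun l ph => snd (kernel A nu (path l ph) * path_ph l ph)%C) (- ph1) ph1 l).
  rewrite Emin, Emax in Hder.
  assert (E : RInt (fun t => Derive (fun u => snd (kernel A nu (path u t) * path_ph u t)%C) l) (- ph1) ph1 = 0).
  { rewrite (RInt_ext _ (fun t => snd (deform l t))).
    - apply is_RInt_unique.
      assert (H := is_RInt_derive (fun t => snd (kernel A nu (path l t) * path_l t)%C)
        (fun t => snd (deform l t)) (- ph1) ph1).
      rewrite Emin, Emax in H.
      assert (Z : forall p, rho * cos p = s -> snd (kernel A nu (path l p) * path_l p)%C = 0).
      { intros p Hp; unfold path_l; rewrite Hp; simpl; ring. }
      assert (H' := H (fun x Hx => proj2 (is_Cderive_deform_ph l x (Hnz l x ltac:(lra) Hx)))).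
      rewrite (Z ph1 Hcos), (Z (- ph1)) in H' by (rewrite cos_neg; exact Hcos).
      replace 0 with (minus 0 0 : R) by (unfold minus, plus, opp; simpl; ring).
      apply H'; intros x Hx.
      assert (Hc := proj2 (Ccont2_deform l x (Hnz l x ltac:(lra) Hx))).
      apply continuity_pt_filterlim.
      intros eps Heps; destruct (Hc (mkposreal eps Heps)) as [d Hd].
      exists d; split; [apply cond_pos|].
      intros y [_ Hy]; apply Hd; [rewrite Rminus_diag, Rabs_R0; apply cond_pos | exact Hy].
    - intros t Ht; rewrite Emin, Emax in Ht.
      apply is_derive_unique, (is_Cderive_deform_l l t), Hnz; lra. }
  rewrite E in Hder; apply Hder; clear Hder.
  - exists (mkposreal _ Hsr); intros l' Hl' ph Hph.
    assert (Hb : Rabs (l' - l) < s / rho) by exact Hl'.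
    apply Rabs_def2 in Hb.
    eexists; apply (is_Cderive_deform_l l' ph), Hnz; lra.
  - intros ph Hph.
    apply (continuity_2d_pt_ext_loc (fun u v => snd (deform u v))).
    + assert (Hc := continuity_2d_pt_neq_0 _ l ph (proj1 (Ccont2_path l ph))).
      assert (Hp := path_fst_pos l ph ltac:(lra) Hph).
      destruct (Hc ltac:(lra)) as [d Hd]; exists d; intros u v Hu Hv.
      symmetry; apply is_derive_unique, (is_Cderive_deform_l u v).
      apply path_neq_0_of_fst, (Hd u v Hu Hv).
    + apply (Ccont2_deform l ph), Hnz; lra.
  - exists (mkposreal _ Hsr); intros l' Hl'.
    assert (Hb : Rabs (l' - l) < s / rho) by exact Hl'.
    apply Rabs_def2 in Hb.
    apply (ex_RInt_continuous (V := R_CompleteNormedModule)); intros ph Hph.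
    rewrite Emin, Emax in Hph.
    apply (ex_derive_continuous (fun t => snd (kernel A nu (path l' t) * path_ph l' t)%C)).
    assert (Hpp : is_Cderive (path_ph l') ph (- (l' * (rho * cos ph)), - (rho * sin ph)))
      by (split; simpl; auto_derive; auto; ring).
    eexists; apply (is_Cderive_mult (fun t => kernel A nu (path l' t)) (path_ph l'));
      [|exact Hpp].
    apply (is_Cderive_kernel A nu (path l')); [apply Hnz; lra | apply is_Cderive_path_ph].
Qed.

Lemma chord_integral_eq_arc_integral :
  RInt (fun th => Re (kernel A nu (s, th))) (- (rho * sin ph1)) (rho * sin ph1) =
  RInt (circle_kernel A nu rho) (- ph1) ph1.
Proof using Hs Hph1 Hcos.
  assert (E01 : deformed_integral 0 = deformed_integral 1).
  { apply Rle_antisym.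
    - apply (increasing_of_derive_nonneg _ (fun _ => 0)); [lra | | intros; lra].
      intros x Hx; now apply is_derive_deformed_integral.
    - assert (H : - deformed_integral 0 <= - deformed_integral 1); [|lra].
      apply (increasing_of_derive_nonneg (fun x => - deformed_integral x) (fun _ => - 0)); [lra | | intros; lra].
      intros x Hx; apply (is_derive_opp deformed_integral x 0); now apply is_derive_deformed_integral. }
  transitivity (deformed_integral 0).
  - replace (- (rho * sin ph1)) with (rho * sin (- ph1)) by (rewrite sin_neg; ring).
    rewrite <- (RInt_comp (fun th => Re (kernel A nu (s, th))) (fun ph => rho * sin ph)
      (fun ph => rho * cos ph)).
    + unfold deformed_integral; apply RInt_ext; intros ph _.
      unfold scal; simpl; unfold mult; simpl.
      unfold path, path_ph.
      replace (s + 0 * (rho * cos ph - s)) with s by ring.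
      unfold Re; ring.
    + intros x _; apply (ex_derive_continuous (fun th => Re (kernel A nu (s, th)))).
      assert (Hc : is_Cderive (fun th => (s, th)) (rho * sin x) (0, 1))
        by (split; simpl; auto_derive; auto).
      assert (Nz : (s, rho * sin x) <> RtoC 0) by (intros E; apply (f_equal fst) in E; simpl in E; lra).
      destruct (is_Cderive_kernel A nu (fun th => (s, th)) (rho * sin x) (0, 1) Nz Hc) as [H1 _].
      eexists; exact H1.
    + intros x _; split; [auto_derive; auto; ring|].
      apply (ex_derive_continuous (fun ph => rho * cos ph)); auto_derive; auto.
  - rewrite E01; unfold deformed_integral; apply RInt_ext; intros ph _.
    unfold circle_kernel; cbv zeta.
    assert (EP : path 1 ph = (rho * Cexp (Cim ph))%C).
    { unfold path, Cexp, Cim; apply injective_projections; simpl; rewrite exp_0; ring. }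
    assert (EQ : path_ph 1 ph = (Ci * (rho * Cexp (Cim ph)))%C).
    { unfold path_ph, Cexp, Cim; apply injective_projections; simpl; rewrite exp_0; ring. }
    rewrite EP, EQ; set (T := (rho * Cexp (Cim ph))%C).
    unfold Re; simpl; ring.
Qed.

End Deformation.

(** The chord replaces the arc to its right in the full circle. On the rest of the circle
    [Re T <= s], so the kernel is at most its modulus at the ends of the chord. *)
Lemma chord_integral_bessel (A nu s rho : R) : 0 < A -> 0 < nu -> 0 < s < rho ->
  let th1 := sqrt (rho ^ 2 - s ^ 2) in
  Rabs (RInt (fun th => Re (kernel A nu (s, th))) (- th1) th1 - 2 * PI * bessel A nu) <=
  2 * PI * (rho * exp (A * s / rho ^ 2 + nu * s)).
Proof.
  intros HA Hnu Hs th1.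
  assert (HPI := PI_bounds).
  set (ph1 := acos (s / rho)).
  assert (Hq : 0 < s / rho < 1).
  { split; [apply Rdiv_lt_0_compat; lra | apply Rlt_div_l; lra]. }
  assert (Hb := acos_bound_lt (s / rho) ltac:(lra)); fold ph1 in Hb.
  assert (Hc : cos ph1 = s / rho) by (apply cos_acos; lra).
  assert (Hph1 : 0 < ph1 < PI / 2).
  { split; [lra|]; destruct (Rlt_le_dec ph1 (PI / 2)) as [H|H]; [exact H|].
    assert (cos ph1 <= cos (PI / 2)) by (apply cos_decr_1; lra); rewrite cos_PI2 in *; lra. }
  assert (Hcos : rho * cos ph1 = s) by (rewrite Hc; field; lra).
  assert (Hsin : rho * sin ph1 = th1).
  { assert (P : 0 <= sin ph1) by (apply sin_ge_0; lra).
    unfold th1; rewrite <- (sqrt_Rsqr (rho * sin ph1)) by (apply Rmult_le_pos; lra).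
    f_equal; unfold Rsqr; rewrite <- Hcos.
    assert (H := sin2_cos2 ph1); unfold Rsqr in H.
    replace (rho ^ 2) with (rho ^ 2 * (sin ph1 * sin ph1 + cos ph1 * cos ph1)) by (rewrite H; ring).
    ring. }
  rewrite <- Hsin, (chord_integral_eq_arc_integral A nu s rho ph1 Hs Hph1 Hcos).
  assert (EX : forall a b, ex_RInt (circle_kernel A nu rho) a b)
    by (intros; apply ex_RInt_circle_kernel; lra).
  rewrite <- (bessel_circle_integral A nu rho) by lra.
  set (M := rho * exp (A * s / rho ^ 2 + nu * s)).
  assert (Hpt : forall ph, cos ph <= s / rho -> Rabs (circle_kernel A nu rho ph) <= M).
  { intros ph Hph; unfold circle_kernel; cbv zeta.
    set (T := (rho * Cexp (Cim ph))%C).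
    assert (MT : Cmod T = rho) by (apply Cmod_polar; lra).
    assert (NT : T <> 0) by (apply Cmod_gt_0; lra).
    eapply Rle_trans; [apply re_le_Cmod|].
    rewrite Cmod_mult, MT, Cmod_kernel, MT by exact NT.
    unfold M; rewrite Rmult_comm; apply Rmult_le_compat_l; [lra|].
    assert (RT : Re T <= s).
    { unfold T; rewrite re_scal_l; unfold Cexp, Cim, Re; simpl; rewrite exp_0.
      apply Rmult_le_compat_l with (r := rho) in Hph; [|lra].
      replace (rho * (s / rho)) with s in Hph by (field; lra); lra. }
    apply exp_le, Rplus_le_compat; [|apply Rmult_le_compat_l; lra].
    unfold Rdiv; apply Rmult_le_compat_r; [left; apply Rinv_0_lt_compat, pow_lt; lra|].
    apply Rmult_le_compat_l; lra. }
  assert (C1 := RInt_Chasles (circle_kernel A nu rho) (- PI) (- ph1) PI (EX _ _) (EX _ _)).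
  assert (C2 := RInt_Chasles (circle_kernel A nu rho) (- ph1) ph1 PI (EX _ _) (EX _ _)).
  unfold plus in C1, C2; simpl in C1, C2.
  assert (B1 : Rabs (RInt (circle_kernel A nu rho) (- PI) (- ph1)) <= (- ph1 - - PI) * M).
  { apply abs_RInt_le_const; [lra | apply EX |]; intros ph Hph; apply Hpt.
    rewrite <- Hc, <- (cos_neg ph); apply cos_decr_1; lra. }
  assert (B2 : Rabs (RInt (circle_kernel A nu rho) ph1 PI) <= (PI - ph1) * M).
  { apply abs_RInt_le_const; [lra | apply EX |]; intros ph Hph; apply Hpt.
    rewrite <- Hc; apply cos_decr_1; lra. }
  assert (HM : 0 <= M) by (apply Rmult_le_pos; [lra | left; apply exp_pos]).
  rewrite <- C1, <- C2.
  apply Rabs_le_between in B1; apply Rabs_le_between in B2.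
  assert (0 <= ph1 * M) by (apply Rmult_le_pos; lra).
  apply Rabs_le; split; lra.
Qed.

(** * The circle method *)

Lemma cnt_stable (K n : nat) : (n <= K)%nat -> cnt K n = cnt n n.
Proof.
  intros H; induction K as [|K IH]; [now replace n with 0%nat by lia|].
  destruct (Nat.eq_dec n (S K)) as [->|E]; [reflexivity|].
  rewrite <- (IH ltac:(lia)).
  change (cnt (S K) n) with (cnt K n + (if Nat.leb (S K) n then cnt K (n - S K) else 0))%nat.
  replace (Nat.leb (S K) n) with false by (symmetry; apply Nat.leb_gt; lia); lia.
Qed.

Lemma Re_div_pair (x s th : R) : 0 < s -> Re (x / (s, th)) = x * s / (s ^ 2 + th ^ 2).
Proof.
  intros Hs; unfold Cdiv; rewrite re_scal_l; unfold Cinv, Re; cbn [fst snd].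
  unfold Rdiv; ring.
Qed.

Lemma Csinh_RtoC (x : R) : Csinh x = RtoC (sinh x).
Proof.
  rewrite Csinh_pair; simpl; rewrite cos_0, sin_0.
  apply injective_projections; simpl; ring.
Qed.

Lemma Re_inv_Csinh (s th : R) : 0 < s ->
  Re (/ (2 * Csinh (s, th))) = sinh s * cos th / (2 * (sinh s ^ 2 + sin th ^ 2)).
Proof.
  intros Hs.
  assert (H0 := sinh_ge s ltac:(lra)).
  assert (Ns : Csinh (s, th) <> 0) by (apply Csinh_neq_0; exact Hs).
  assert (M := Cmod_Csinh_sqr (s, th)); rewrite Cmod_sqr in M; cbn [fst snd] in M.
  assert (P : 0 < sinh s * sinh s + sin th * sin th).
  { assert (0 <= sin th * sin th) by nra; nra. }
  replace (/ (2 * Csinh (s, th)))%C with (RtoC (/ 2) * / Csinh (s, th))%C.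
  2:{ rewrite RtoC_inv by lra; field; repeat split; auto using C2_neq_0. }
  assert (F : fst (Csinh (s, th)) = sinh s * cos th) by (rewrite Csinh_pair; reflexivity).
  rewrite re_scal_l; unfold Re, Cinv; cbn [fst].
  replace (fst (Csinh (s, th)) ^ 2 + snd (Csinh (s, th)) ^ 2) with
    (sinh s * sinh s + sin th * sin th) by (rewrite <- M; ring).
  rewrite F; field; nra.
Qed.

(** Only the term [m = 1] is made to gain from moving off the real axis; every other term is bounded
    by its value at [th = 0]. *)
Lemma log_gf_real_part (s th : R) (N : nat) : 0 < s ->
  Re (log_gf (s, th) (S N)) <=
  Re (log_gf s (S N)) - (/ (2 * sinh s) - Re (/ (2 * Csinh (s, th)))).
Proof.
  intros Hs; unfold log_gf; rewrite !Csum_S_l, !re_plus, !Re_Csum.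
  assert (H0 := sinh_ge s ltac:(lra)).
  assert (E0 : forall t : C, (/ (2 * INR 1 * Csinh (INR 1 * t)))%C = (/ (2 * Csinh t))%C).
  { intros t; simpl INR; rewrite Cmult_1_r, Cmult_1_l; reflexivity. }
  rewrite !E0, Csinh_RtoC, <- RtoC_mult, <- RtoC_inv, re_RtoC by lra.
  assert (H : Rsum (fun k => Re (/ (2 * INR (S (S k)) * Csinh (INR (S (S k)) * (s, th))))) N <=
    Rsum (fun k => Re (/ (2 * INR (S (S k)) * Csinh (INR (S (S k)) * s)))) N); [|lra].
  apply Rsum_le; intros k _.
  eapply Rle_trans; [apply Re_le_Cmod|].
  eapply Rle_trans; [apply (Cmod_log_gf_term (s, th) (S k) Hs)|].
  assert (HM := INR_S_ge_1 (S k)).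
  assert (HMs : 0 < INR (S (S k)) * s) by (apply Rmult_lt_0_compat; lra).
  assert (H1 := sinh_ge _ (Rlt_le _ _ HMs)).
  rewrite <- (RtoC_mult (INR (S (S k))) s), Csinh_RtoC, <- !RtoC_mult, <- RtoC_inv, re_RtoC;
    [right; reflexivity|].
  apply Rgt_not_eq, Rmult_lt_0_compat; lra.
Qed.

Lemma exp_le_inv (x : R) : 0 <= x < 1 -> exp x <= / (1 - x).
Proof.
  intros Hx.
  assert (H : 1 - x <= exp (- x)) by (assert (H := exp_ineq1_le (- x)); lra).
  rewrite <- (Ropp_involutive x) at 1; rewrite exp_Ropp.
  apply Rinv_le_contravar; lra.
Qed.

Lemma exp_m2_le (X : R) : 1 <= X -> exp (- (2 * X)) <= / 5.
Proof.
  intros HX; apply Rle_trans with (exp (- (2))); [apply exp_le; lra|].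
  rewrite exp_Ropp; apply Rinv_le_contravar; [lra|].
  replace 2 with (1 / 2 + 1 / 2 + (1 / 2 + 1 / 2)) by field; rewrite !exp_plus.
  assert (H := exp_ineq1_le (1 / 2)).
  set (h := exp (1 / 2)) in *; assert (9 / 4 <= h * h) by nra; nra.
Qed.

(** Here [p] stands for [exp (- 2 X)] with [X >= 1], and [B exp B] is the relative error that
    [Cmod_exp_minus_1] yields after exponentiating the modular relation. *)
Lemma modular_error_le (p : R) : 0 < p <= / 5 ->
  let B := p / (1 - p) ^ 2 in 0 <= B <= 5 / 16 /\ B * exp B <= 3 * p.
Proof.
  intros Hp B.
  assert (HB : 0 <= B <= 25 / 16 * p).
  { unfold B; split; [apply Rdiv_le_0_compat; [lra | apply pow_lt; lra]|].
    apply Rle_div_l; [apply pow_lt; lra|].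
    assert (16 / 25 <= (1 - p) ^ 2) by nra; nra. }
  split; [lra|].
  assert (HE : exp B <= 16 / 11).
  { eapply Rle_trans; [apply exp_le_inv; lra|].
    replace (16 / 11) with (/ (1 - 5 / 16)) by field; apply Rinv_le_contravar; lra. }
  assert (H0 := exp_pos B). nra.
Qed.

Section CircleMethod.

Variable c : R.
Hypothesis Hc : forall t : C, 0 < Re t ->
  exists L : C, Clim (log_gf t) L /\
    let rho := exp (- (2 * Re (PI ^ 2 / t))) in
    Cmod (L - ((PI ^ 2 / 12)%R / t + t / 24 - c)) <= rho / (1 - rho) ^ 2.

(** The hypothesis says [X = Re (PI^2 / t) >= 1]. The kernel has modulus [exp (X / 12) exp (nu s)]
    and the relative error is at most [3 exp (- 2 X)], so the growth in [X] is absorbed. *)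
Lemma major_arc (n : nat) (s th : R) (L : C) : 0 < s ->
  s ^ 2 + th ^ 2 <= PI ^ 2 * s -> Clim (log_gf (s, th)) L ->
  Cmod (Cexp L * Cexp (INR n * (s, th)) -
        exp (- c) * kernel (PI ^ 2 / 12) (INR n + / 24) (s, th)) <=
  exp (- c) * (3 * exp ((INR n + / 24) * s)).
Proof using Hc.
  intros Hs Hth HL.
  set (t := (s, th) : C) in *; set (nu := INR n + / 24).
  assert (HPI := PI_bounds).
  assert (Ht : 0 < Re t) by exact Hs.
  assert (Nt : t <> 0) by (apply Cmod_gt_0; assert (H := Re_le_Cmod t); lra).
  destruct (Hc t Ht) as [L' [HL' HB]].
  rewrite (Clim_unique _ _ _ HL' HL) in HB; clear L' HL'.
  set (W := ((PI ^ 2 / 12)%R / t + t / 24 - c)%C) in *.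
  set (X := PI ^ 2 * s / (s ^ 2 + th ^ 2)).
  assert (EX : Re (PI ^ 2 / t) = X) by (rewrite <- RtoC_pow; now apply Re_div_pair).
  rewrite EX in HB; cbv zeta in HB.
  assert (P : 0 < s ^ 2 + th ^ 2) by (assert (0 <= th ^ 2) by apply pow2_ge_0; nra).
  assert (HX : 1 <= X) by (apply Rle_div_r; lra).
  set (p := exp (- (2 * X))) in *.
  assert (Hp : 0 < p <= / 5) by (split; [apply exp_pos | now apply exp_m2_le]).
  destruct (modular_error_le p Hp) as [HB1 HB2]; cbv zeta in HB1, HB2.
  set (B := p / (1 - p) ^ 2) in *.
  set (Rm := (L - W)%C) in *.
  replace (Cexp L * Cexp (INR n * t) - exp (- c) * kernel (PI ^ 2 / 12) nu t)%C with
    (exp (- c) * kernel (PI ^ 2 / 12) nu t * (Cexp Rm - 1))%C.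
  2:{ replace L with (W + Rm)%C by (unfold Rm; ring).
      rewrite <- Cexp_RtoC; unfold kernel.
      rewrite (Cexp_plus W Rm).
      assert (E : (Cexp W * Cexp (INR n * t) = Cexp (- c)%R * Cexp ((PI ^ 2 / 12)%R / t + nu * t))%C).
      { rewrite <- !Cexp_plus; f_equal; unfold W, nu.
        rewrite RtoC_opp, RtoC_plus, RtoC_inv by lra; field.
        repeat split; (exact Nt || (apply RtoC_neq_0; lra)). }
      replace (Cexp W * Cexp Rm * Cexp (INR n * t))%C with
        ((Cexp W * Cexp (INR n * t)) * Cexp Rm)%C by ring.
      rewrite E; ring. }
  rewrite !Cmod_mult, Cmod_R, Rabs_pos_eq by (left; apply exp_pos).
  rewrite Rmult_assoc; apply Rmult_le_compat_l; [left; apply exp_pos|].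
  assert (MK : Cmod (kernel (PI ^ 2 / 12) nu t) = exp (X / 12) * exp (nu * s)).
  { rewrite Cmod_kernel by exact Nt; rewrite <- exp_plus; f_equal; f_equal.
    rewrite Cmod2_alt; unfold X, t, Re, Im; simpl fst; simpl snd; field; lra. }
  rewrite MK.
  assert (ME : Cmod (Cexp Rm - 1) <= 3 * p).
  { eapply Rle_trans; [apply Cmod_exp_minus_1|].
    eapply Rle_trans; [|exact HB2].
    apply Rmult_le_compat; [apply Cmod_ge_0 | left; apply exp_pos | exact HB | now apply exp_le]. }
  assert (PX : exp (X / 12) * p <= 1).
  { unfold p; rewrite <- exp_plus, <- exp_0; apply exp_le; lra. }
  assert (E1 := exp_pos (nu * s)); assert (E2 := exp_pos (X / 12)).
  apply Rle_trans with (exp (X / 12) * exp (nu * s) * (3 * p)).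
  - apply Rmult_le_compat_l; [|exact ME]; apply Rmult_le_pos; lra.
  - replace (exp (X / 12) * exp (nu * s) * (3 * p)) with
      (3 * exp (nu * s) * (exp (X / 12) * p)) by ring.
    rewrite <- (Rmult_1_r (3 * exp (nu * s))) at 2; apply Rmult_le_compat_l; lra.
Qed.

(** Almost the whole first term is gained. For [|th| <= PI / 2] the hypothesis gives [th^2 >= 9 s]
    and then [sin^2 th >= 2 s >= sinh s]; beyond [PI / 2] the cosine is nonpositive. *)
Lemma minor_arc_gain (s th : R) : 0 < s <= / 20 ->
  PI ^ 2 * s <= s ^ 2 + th ^ 2 -> Rabs th <= PI ->
  / (2 * s) - 1 <= / (2 * sinh s) - Re (/ (2 * Csinh (s, th))).
Proof.
  intros Hs Hth Hpi; assert (HPI := PI_bounds).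
  assert (H0 := sinh_ge s ltac:(lra)).
  assert (HT : sinh s <= s + 5 * s ^ 3).
  { assert (H := Cmod_Csinh_taylor s).
    rewrite Csinh_RtoC, <- RtoC_minus, !Cmod_R, (Rabs_pos_eq s) in H by lra.
    specialize (H ltac:(lra)); apply Rabs_le_between in H; lra. }
  assert (G1 : / (2 * s) - / 2 <= / (2 * sinh s)).
  { assert (Hd : / (2 * s) - / (2 * sinh s) = (sinh s - s) * / (2 * s * sinh s)) by (field; lra).
    assert (Hd2 : (sinh s - s) * / (2 * s * sinh s) <= / 2); [|lra].
    apply Rmult_le_reg_r with (2 * s * sinh s); [nra|].
    rewrite Rmult_assoc, Rinv_l, Rmult_1_r by nra.
    assert (s * s <= s * sinh s) by nra.
    assert (5 * s ^ 3 <= s * s) by (simpl; nra). lra. }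
  assert (G2 : Re (/ (2 * Csinh (s, th))) <= / 2); [|lra].
  rewrite Re_inv_Csinh by lra.
  assert (P : 0 < sinh s ^ 2 + sin th ^ 2) by (assert (0 <= sin th ^ 2) by apply pow2_ge_0; nra).
  apply Rle_div_l; [lra|].
  destruct (Rle_dec (Rabs th) (PI / 2)) as [Hq|Hq].
  - assert (Hsin : 2 * s <= sin th ^ 2).
    { assert (HP2 : 9.5 <= PI ^ 2) by nra.
      assert (Hth2 : 9 * s <= th ^ 2) by nra.
      set (a := Rabs th) in *.
      assert (Ha : 0 <= a) by apply Rabs_pos.
      assert (Ea : a ^ 2 = th ^ 2) by (unfold a; rewrite RPow_abs; apply Rabs_pos_eq, pow2_ge_0).
      assert (Es : sin th ^ 2 = sin a ^ 2).
      { unfold a, Rabs; destruct (Rcase_abs th); [rewrite sin_neg; ring | reflexivity]. }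
      assert (Hc1 := sin_ge_cubic a Ha).
      assert (Ha2 : a ^ 2 <= 2.5) by nra.
      (* The factor is [1 - 2.5 / 6], from the cubic lower bound of the sine. *)
      assert (Hc2 : a * (7 / 12) <= sin a) by nra.
      rewrite Es.
      assert ((a * (7 / 12)) * (a * (7 / 12)) <= sin a * sin a) by (apply Rmult_le_compat; nra).
      nra. }
    assert (Hcos := COS_bound th).
    assert (sinh s * cos th <= sinh s) by nra.
    assert (sinh s <= 2 * s) by nra. nra.
  - assert (Hcos : cos th <= 0).
    { replace (cos th) with (cos (Rabs th)).
      - apply cos_le_0; lra.
      - unfold Rabs; destruct (Rcase_abs th); [apply cos_neg | reflexivity]. }
    nra.
Qed.

(** The modular relation is applied at the real point [s], where it is precise, and [minor_arc_gain]
    transports the bound to [th]. The [4 / 3] covers the loss 1 there and the modular error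
    [5 / 16]. *)
Lemma minor_arc (n : nat) (s th : R) (L : C) : 0 < s <= / 20 ->
  PI ^ 2 * s <= s ^ 2 + th ^ 2 -> Rabs th <= PI -> Clim (log_gf (s, th)) L ->
  Cmod (Cexp L * Cexp (INR n * (s, th))) <=
  exp (- c) * exp (PI ^ 2 / 12 / s + (INR n + / 24) * s - / (2 * s) + 4 / 3).
Proof using Hc.
  intros Hs Hth Hpi HL; assert (HPI := PI_bounds).
  assert (G := minor_arc_gain s th Hs Hth Hpi).
  destruct (Hc s ltac:(simpl; lra)) as [L0 [HL0 HB]]; cbv zeta in HB.
  set (X := Re (PI ^ 2 / s)) in *.
  assert (EX : X = PI ^ 2 / s).
  { unfold X; rewrite <- RtoC_pow, <- RtoC_div by lra; reflexivity. }
  assert (HX : 1 <= X) by (rewrite EX; apply Rle_div_r; nra).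
  destruct (modular_error_le (exp (- (2 * X)))) as [HB1 _].
  { split; [apply exp_pos | now apply exp_m2_le]. }
  cbv zeta in HB1.
  set (B := exp (- (2 * X)) / (1 - exp (- (2 * X))) ^ 2) in *.
  assert (RL0 : Re L0 <= PI ^ 2 / 12 / s + s / 24 - c + 5 / 16).
  { assert (H := Re_le_Cmod (L0 - ((PI ^ 2 / 12)%R / s + s / 24 - c))).
    replace (Re (L0 - ((PI ^ 2 / 12)%R / s + s / 24 - c))) with
      (Re L0 - (PI ^ 2 / 12 / s + s / 24 - c)) in H; [lra|].
    rewrite <- !RtoC_div, <- RtoC_plus, <- RtoC_minus by lra.
    unfold Re; simpl; ring. }
  assert (RL : Re L <= Re L0 - (/ (2 * sinh s) - Re (/ (2 * Csinh (s, th))))).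
  { assert (H1 := Clim_Re _ _ HL); assert (H2 := Clim_Re _ _ HL0).
    apply is_lim_seq_incr_1 in H1; apply is_lim_seq_incr_1 in H2.
    apply (is_lim_seq_le _ _ _ _ (fun N => log_gf_real_part s th N (proj1 Hs)) H1
      (is_lim_seq_minus' _ _ _ _ H2 (is_lim_seq_const _))). }
  rewrite Cmod_mult, !Cmod_Cexp, re_scal_l, <- !exp_plus.
  apply exp_le; unfold Re at 2; simpl fst; lra.
Qed.

(** The point [s] is the saddle point of [A / t + nu t], where the kernel equals [exp (2 nu s)]. The
    constant 9 is [3 + 4 + 2]: the major arc, the minor arcs, and the part of the circle left of the
    chord. *)
Lemma coefficient_estimate (n : nat) (s : R) : 0 < s <= / 20 ->
  s ^ 2 * (INR n + / 24) = PI ^ 2 / 12 ->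
  Rabs (INR (cnt n n) - exp (- c) * bessel (PI ^ 2 / 12) (INR n + / 24)) <=
  exp (- c) * (9 * exp (2 * (INR n + / 24) * s - / (2 * s))).
Proof using Hc.
  intros Hs Hsn; assert (HPI := PI_bounds).
  set (A := PI ^ 2 / 12) in *; set (nu := INR n + / 24) in *.
  assert (Hnu : 0 < nu) by (unfold nu; assert (H := pos_INR n); lra).
  assert (HA : 0 < A) by (unfold A; nra).
  assert (EA : A / s = nu * s) by (rewrite <- Hsn; field; lra).
  assert (HA2 : 3 / 4 <= A) by (unfold A; nra).
  (* With this radius the chord on [Re t = s] is exactly the major arc, and [A * s / rho ^ 2] is
     [1 / 12]. *)
  set (rho := PI * sqrt s).
  assert (Hsq : 0 < sqrt s) by (apply sqrt_lt_R0; lra).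
  assert (Hsq2 : sqrt s * sqrt s = s) by (apply sqrt_sqrt; lra).
  assert (Erho : rho ^ 2 = PI ^ 2 * s).
  { unfold rho; replace ((PI * sqrt s) ^ 2) with (PI ^ 2 * (sqrt s * sqrt s)) by ring.
    now rewrite Hsq2. }
  assert (Hrho : s < rho <= 1).
  { unfold rho; split; [nra|].
    assert (sqrt s <= 1 / 4); [|nra].
    apply Rsqr_incr_0_var; [|lra]; unfold Rsqr; lra. }
  set (th1 := sqrt (rho ^ 2 - s ^ 2)).
  assert (Hth1sq : th1 ^ 2 = PI ^ 2 * s - s ^ 2).
  { unfold th1; rewrite pow2_sqrt by nra; rewrite Erho; reflexivity. }
  assert (Hth1 : 0 <= th1) by apply sqrt_pos.
  assert (Hth1b : th1 <= 1).
  { apply Rsqr_incr_0_var; [|lra]; unfold Rsqr; nra. }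
  destruct (gf_prod_approx s (proj1 Hs)) as [eta [Heta Happ]].
  set (E0 := exp (INR n * s)).
  set (b1 := exp (- c) * (3 * exp (nu * s))).
  set (b2 := exp (- c) * exp (PI ^ 2 / 12 / s + nu * s - / (2 * s) + 4 / 3)).
  (* The coefficient of index [n] is final once [n <= K], so [K] can tend to infinity afterwards and
     removes the error [eta K]. *)
  assert (HK : forall K, (n <= K)%nat ->
    Rabs (INR (cnt n n) - exp (- c) * bessel A nu) <=
    b1 + b2 + exp (- c) * (rho * exp (/ 12 + nu * s)) + eta K * E0).
  { intros K HnK.
    set (G := circle_integrand K n s).
    assert (EG : forall a b, ex_RInt G a b) by (intros; apply ex_RInt_circle_integrand).
    assert (HG := circle_integral K n s); fold G in HG; rewrite (cnt_stable K n HnK) in HG.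
    assert (Hdiff : forall th L, Clim (log_gf (s, th)) L ->
      Rabs (G th - Re (Cexp L * Cexp (INR n * (s, th)))) <= eta K * E0).
    { intros th L HL; unfold G, circle_integrand.
      replace (Re (gf_prod (Cexp (- (s, th))) K * Cexp (INR n * (s, th))) -
        Re (Cexp L * Cexp (INR n * (s, th)))) with
        (Re ((gf_prod (Cexp (- (s, th))) K - Cexp L) * Cexp (INR n * (s, th)))).
      2:{ set (u := gf_prod _ K); set (v := Cexp (INR n * (s, th))); unfold Re; simpl; ring. }
      eapply Rle_trans; [apply re_le_Cmod|].
      rewrite Cmod_mult, Cmod_Cexp, re_scal_l; unfold Re at 1; simpl fst; fold E0.
      apply Rmult_le_compat_r; [left; apply exp_pos|].
      now apply Happ. }
    set (H := fun th => exp (- c) * Re (kernel A nu (s, th))).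
    assert (EXk : forall a b, ex_RInt (fun th => Re (kernel A nu (s, th))) a b).
    { intros a b; apply (ex_RInt_continuous (V := R_CompleteNormedModule)); intros x _.
      apply (ex_derive_continuous (fun th => Re (kernel A nu (s, th)))).
      assert (Hcv : is_Cderive (fun th => (s, th)) x (0, 1)) by (split; simpl; auto_derive; auto).
      assert (Nz : (s, x) <> RtoC 0) by (intros E; apply (f_equal fst) in E; simpl in E; lra).
      destruct (is_Cderive_kernel A nu (fun th => (s, th)) x (0, 1) Nz Hcv) as [H1 _].
      eexists; exact H1. }
    assert (EXH : ex_RInt H (- th1) th1).
    { apply (ex_RInt_scal (fun th => Re (kernel A nu (s, th))) (- th1) th1 (exp (- c))), EXk. }
    assert (IH : RInt H (- th1) th1 = exp (- c) * RInt (fun th => Re (kernel A nu (s, th))) (- th1) th1).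
    { exact (RInt_scal (fun th => Re (kernel A nu (s, th))) (- th1) th1 (exp (- c)) (EXk _ _)). }
    assert (P1 : forall th, - th1 <= th <= th1 -> Rabs (G th - H th) <= b1 + eta K * E0).
    { intros th Hth.
      destruct (Hc (s, th) (proj1 Hs)) as [L [HL _]].
      assert (D := Hdiff th L HL).
      assert (M := major_arc n s th L (proj1 Hs) ltac:(nra) HL).
      fold A nu in M.
      assert (M2 := re_le_Cmod (Cexp L * Cexp (INR n * (s, th)) - exp (- c) * kernel A nu (s, th))).
      replace (Re (Cexp L * Cexp (INR n * (s, th)) - exp (- c) * kernel A nu (s, th))) with
        (Re (Cexp L * Cexp (INR n * (s, th))) - H th) in M2.
      2:{ unfold H; set (u := (Cexp L * _)%C); set (v := kernel A nu (s, th)); unfold Re; simpl; ring. }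
      replace (G th - H th) with ((G th - Re (Cexp L * Cexp (INR n * (s, th)))) +
        (Re (Cexp L * Cexp (INR n * (s, th))) - H th)) by ring.
      eapply Rle_trans; [apply Rabs_triang|]; unfold b1; lra. }
    assert (P2 : forall th, th1 <= Rabs th <= PI -> Rabs (G th) <= b2 + eta K * E0).
    { intros th Hth.
      destruct (Hc (s, th) (proj1 Hs)) as [L [HL _]].
      assert (D := Hdiff th L HL).
      assert (Hsqth : th1 ^ 2 <= th ^ 2).
      { replace (th ^ 2) with (Rabs th ^ 2) by (rewrite RPow_abs; apply Rabs_pos_eq, pow2_ge_0).
        apply pow_incr; lra. }
      assert (M := minor_arc n s th L Hs ltac:(lra) (proj2 Hth) HL); fold nu in M.
      assert (M2 := re_le_Cmod (Cexp L * Cexp (INR n * (s, th)))).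
      replace (G th) with ((G th - Re (Cexp L * Cexp (INR n * (s, th)))) +
        Re (Cexp L * Cexp (INR n * (s, th)))) by ring.
      eapply Rle_trans; [apply Rabs_triang|]; unfold b2; lra. }
    assert (B1 : Rabs (RInt G (- PI) (- th1)) <= (- th1 - - PI) * (b2 + eta K * E0)).
    { apply abs_RInt_le_const; [lra | apply EG |]; intros th Hth; apply P2.
      rewrite Rabs_left1 by lra; lra. }
    assert (B3 : Rabs (RInt G th1 PI) <= (PI - th1) * (b2 + eta K * E0)).
    { apply abs_RInt_le_const; [lra | apply EG |]; intros th Hth; apply P2.
      rewrite Rabs_pos_eq by lra; lra. }
    assert (B2 : Rabs (RInt G (- th1) th1 - RInt H (- th1) th1) <= (th1 - - th1) * (b1 + eta K * E0)).
    { apply Rabs_RInt_minus_le; [lra | apply EG | exact EXH | exact P1]. }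
    assert (B4 := chord_integral_bessel A nu s rho HA Hnu ltac:(lra)); cbv zeta in B4; fold th1 in B4.
    replace (A * s / rho ^ 2) with (/ 12) in B4 by (rewrite Erho; unfold A; field; lra).
    assert (C1 := RInt_Chasles G (- PI) (- th1) PI (EG _ _) (EG _ _)).
    assert (C2 := RInt_Chasles G (- th1) th1 PI (EG _ _) (EG _ _)).
    unfold plus in C1, C2; simpl in C1, C2.
    rewrite IH in B2.
    set (I := RInt (fun th => Re (kernel A nu (s, th))) (- th1) th1) in *.
    set (b3 := rho * exp (/ 12 + nu * s)) in *.
    assert (Ec := exp_pos (- c)).
    assert (B5 : Rabs (exp (- c) * I - 2 * PI * (exp (- c) * bessel A nu)) <= 2 * PI * (exp (- c) * b3)).
    { replace (exp (- c) * I - 2 * PI * (exp (- c) * bessel A nu)) with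
        (exp (- c) * (I - 2 * PI * bessel A nu)) by ring.
      rewrite Rabs_mult, Rabs_pos_eq by lra.
      replace (2 * PI * (exp (- c) * b3)) with (exp (- c) * (2 * PI * b3)) by ring.
      apply Rmult_le_compat_l; lra. }
    assert (Peta : 0 <= eta K * E0).
    { destruct (Hc (s, 0) (proj1 Hs)) as [L [HL _]].
      eapply Rle_trans; [apply Rabs_pos | exact (Hdiff 0 L HL)]. }
    assert (Pb1 : 0 <= b1) by (unfold b1; assert (H1 := exp_pos (nu * s)); nra).
    assert (Pb2 : 0 <= b2) by (unfold b2; left; apply Rmult_lt_0_compat; apply exp_pos).
    set (e := eta K * E0) in *.
    apply Rmult_le_reg_l with (2 * PI); [lra|].
    rewrite <- (Rabs_pos_eq (2 * PI)) at 1 by lra; rewrite <- Rabs_mult.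
    replace (2 * PI * (INR (cnt n n) - exp (- c) * bessel A nu)) with
      (RInt G (- PI) (- th1) + (RInt G (- th1) th1 - exp (- c) * I) + RInt G th1 PI +
       (exp (- c) * I - 2 * PI * (exp (- c) * bessel A nu))).
    2:{ rewrite Rmult_minus_distr_l, <- HG, <- C1, <- C2; ring. }
    eapply Rle_trans; [apply Rabs_triang|].
    eapply Rle_trans; [apply Rplus_le_compat_r, Rabs_triang|].
    eapply Rle_trans; [apply Rplus_le_compat_r, Rplus_le_compat_r, Rabs_triang|].
    assert (0 <= th1 * b2) by (apply Rmult_le_pos; lra).
    assert (th1 * b1 <= PI * b1) by (apply Rmult_le_compat_r; lra).
    lra. }
  assert (Hlim : Rabs (INR (cnt n n) - exp (- c) * bessel A nu) <=
    b1 + b2 + exp (- c) * (rho * exp (/ 12 + nu * s))).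
  { assert (L0 : is_lim_seq (fun K => b1 + b2 + exp (- c) * (rho * exp (/ 12 + nu * s)) + eta (K + n)%nat * E0)
      (b1 + b2 + exp (- c) * (rho * exp (/ 12 + nu * s)) + 0 * E0)).
    { apply is_lim_seq_plus'; [apply is_lim_seq_const|].
      apply is_lim_seq_mult'; [|apply is_lim_seq_const].
      now apply (is_lim_seq_incr_n eta n). }
    assert (H := is_lim_seq_le (fun _ => Rabs (INR (cnt n n) - exp (- c) * bessel A nu)) _ _ _
      (fun K => HK (K + n)%nat ltac:(lia)) (is_lim_seq_const _) L0).
    simpl in H; lra. }
  eapply Rle_trans; [exact Hlim|].
  unfold b1, b2; fold A; rewrite EA, <- !Rmult_plus_distr_l.
  apply Rmult_le_compat_l; [left; apply exp_pos|].
  set (E := exp (2 * nu * s - / (2 * s))).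
  assert (I1 : exp (nu * s) <= E).
  { unfold E; apply exp_le.
    assert (/ (2 * s) <= nu * s); [|lra].
    rewrite <- EA; unfold Rdiv; rewrite Rinv_mult; apply Rmult_le_compat_r; [|lra].
    left; apply Rinv_0_lt_compat; lra. }
  assert (I2 : exp (nu * (s + s) - / (2 * s) + 4 / 3) <= 4 * E).
  { replace (nu * (s + s) - / (2 * s) + 4 / 3) with (4 / 3 + (2 * nu * s - / (2 * s))) by ring.
    rewrite exp_plus; fold E; apply Rmult_le_compat_r; [left; apply exp_pos|].
    replace (4 / 3) with (1 + 1 / 3) by field; rewrite exp_plus.
    assert (H1 := exp_taylor5 1); rewrite Rabs_R1 in H1; specialize (H1 ltac:(lra)).
    apply Rabs_le_between in H1.
    assert (H2 := exp_taylor5 (1 / 3)); rewrite Rabs_pos_eq in H2 by lra; specialize (H2 ltac:(lra)).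
    apply Rabs_le_between in H2.
    assert (P1 := exp_pos 1); assert (P2 := exp_pos (1 / 3)).
    apply Rle_trans with (2.74 * 1.4); [|lra].
    apply Rmult_le_compat; lra. }
  assert (I3 : rho * exp (/ 12 + nu * s) <= 2 * E).
  { rewrite exp_plus.
    assert (H1 : exp (/ 12) <= / (1 - / 12)) by (apply exp_le_inv; lra).
    assert (H2 := exp_pos (/ 12)); assert (H3 := exp_pos (nu * s)).
    apply Rle_trans with (1 * (2 * exp (nu * s))); [|lra].
    apply Rmult_le_compat; [lra | nra | lra |].
    apply Rmult_le_compat_r; lra. }
  lra.
Qed.

End CircleMethod.

(** * The main term: Riccati equation and log-concavity *)

Section Riccati.

Variable A : R.
Hypothesis HA : 0 < A.

Definition bessel1 (x : R) : R := PSeries (PS_derive (bessel_coef A)) x.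
Definition bessel2 (x : R) : R := PSeries (PS_derive (PS_derive (bessel_coef A))) x.

Lemma is_derive_bessel (x : R) : is_derive (bessel A) x (bessel1 x).
Proof using HA. apply is_derive_PSeries; rewrite CV_radius_bessel by exact HA; exact I. Qed.

Lemma is_derive_bessel1 (x : R) : is_derive bessel1 x (bessel2 x).
Proof using HA.
  apply is_derive_PSeries; rewrite CV_radius_derive, CV_radius_bessel by exact HA; exact I.
Qed.

Lemma bessel_coef_S (n : nat) :
  INR (S n) * INR (S (S n)) * bessel_coef A (S n) = A * bessel_coef A n.
Proof.
  unfold bessel_coef; rewrite (fact_simpl (S n)), (fact_simpl n), !mult_INR.
  change (A ^ S (S n)) with (A * A ^ S n).
  assert (H1 := INR_S_ge_1 n); assert (H2 := INR_S_ge_1 (S n)).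
  field; repeat split; try apply INR_fact_neq_0; lra.
Qed.

Lemma bessel_ode (x : R) : x * bessel2 x + 2 * bessel1 x = A * bessel A x.
Proof using HA.
  unfold bessel2, bessel1, bessel.
  set (a := bessel_coef A).
  assert (Ea : CV_radius a = p_infty) by now apply CV_radius_bessel.
  assert (E1 : CV_radius (PS_derive a) = p_infty) by (rewrite CV_radius_derive; exact Ea).
  assert (E2 : CV_radius (PS_derive (PS_derive a)) = p_infty) by (rewrite CV_radius_derive; exact E1).
  rewrite <- PSeries_incr_1, <- !PSeries_scal, <- PSeries_plus.
  - apply PSeries_ext; intros n.
    unfold PS_plus, PS_scal, PS_incr_1, PS_derive, plus, scal; simpl; unfold mult; simpl.
    assert (H := bessel_coef_S n); fold a in H.
    destruct n as [|n].
    + simpl INR in *; change (@zero R_NormedModule) with 0; lra.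
    + rewrite <- H.
      change (match n with 0%nat => 1 | S _ => INR n + 1 end) with (INR (S n)).
      change (match n with 0%nat => 1 | S _ => INR n + 1 end + 1) with (INR (S n) + 1).
      rewrite !S_INR; ring.
  - apply ex_pseries_incr_1, CV_radius_inside; rewrite E2; exact I.
  - apply ex_pseries_scal; [intros; apply Rmult_comm|].
    apply CV_radius_inside; rewrite E1; exact I.
Qed.

Lemma bessel_coef_pos (n : nat) : 0 < bessel_coef A n.
Proof using HA.
  unfold bessel_coef; apply Rdiv_lt_0_compat; [now apply pow_lt|].
  apply Rmult_lt_0_compat; apply INR_fact_lt_0.
Qed.

Lemma bessel_pos (x : R) : 0 <= x -> 0 < bessel A x.
Proof using HA.
  intros Hx; apply Rlt_le_trans with (bessel_coef A 0); [apply bessel_coef_pos|].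
  assert (H := is_lim_bessel A x HA); apply is_lim_seq_incr_1 in H.
  refine (is_lim_seq_le (fun _ => bessel_coef A 0) _ _ _ _ (is_lim_seq_const _) H).
  intros n; induction n as [|n IH]; [simpl; lra|].
  rewrite Rsum_S.
  assert (0 <= bessel_coef A (S n) * x ^ S n)
    by (apply Rmult_le_pos; [left; apply bessel_coef_pos | now apply pow_le]); lra.
Qed.

Lemma is_lim_bessel1 (x : R) :
  is_lim_seq (Rsum (fun k => PS_derive (bessel_coef A) k * x ^ k)) (bessel1 x).
Proof using HA.
  assert (H : is_pseries (PS_derive (bessel_coef A)) x (bessel1 x)).
  { apply PSeries_correct, CV_radius_inside; now rewrite CV_radius_derive, CV_radius_bessel. }
  apply is_pseries_R in H.
  apply (is_lim_seq_incr_1 (Rsum (fun k => PS_derive (bessel_coef A) k * x ^ k))).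
  apply (is_lim_seq_ext (sum_n (fun k => PS_derive (bessel_coef A) k * x ^ k))); [|exact H].
  intros n; now rewrite Rsum_sum_n.
Qed.

(** Termwise, since [(k + 1) a_(k+1) = A a_k / (k + 2)]. These bounds start the comparisons at
    [x = 1 / 4]. *)
Lemma bessel1_bounds (x : R) : 0 <= x -> 0 <= bessel1 x <= A / 2 * bessel A x.
Proof using HA.
  intros Hx.
  assert (Hk : forall k, 0 <= PS_derive (bessel_coef A) k * x ^ k <= A / 2 * (bessel_coef A k * x ^ k)).
  { intros k; unfold PS_derive.
    assert (P := bessel_coef_pos k); assert (PS := bessel_coef_pos (S k)).
    assert (Px : 0 <= x ^ k) by now apply pow_le.
    assert (H1 := INR_S_ge_1 k).
    assert (H := bessel_coef_S k); rewrite (S_INR (S k)) in H.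
    assert (0 <= INR (S k) * bessel_coef A (S k) <= A / 2 * bessel_coef A k); [|split; nra].
    split; [nra|].
    assert (2 * (INR (S k) * bessel_coef A (S k)) <= (INR (S k) + 1) * (INR (S k) * bessel_coef A (S k))).
    { apply Rmult_le_compat_r; nra. }
    nra. }
  split.
  - refine (is_lim_seq_le (fun _ => 0) _ _ _ _ (is_lim_seq_const _) (is_lim_bessel1 x)).
    intros n; apply Rsum_nonneg; intros k _; apply Hk.
  - refine (is_lim_seq_le _ _ _ _ _ (is_lim_bessel1 x)
      (is_lim_seq_scal_l _ (A / 2) _ (is_lim_bessel A x HA))).
    intros n; rewrite <- Rsum_mult_l; apply Rsum_le; intros k _; apply Hk.
Qed.

Variable al : R.
Hypothesis Hal : 0.9068 < al < 0.9070.
Hypothesis HalA : A = al ^ 2.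

(** The formal solution of the Riccati equation in powers of [w = x^(-1/2)] up to [w^3]. The next
    coefficient is left free: 0 gives a subsolution and [1 / 5] a supersolution. *)
Definition barrier (c x : R) : R :=
  let w := / sqrt x in al * w - 3 / 4 * w ^ 2 + 3 / (32 * al) * w ^ 3 + c * w ^ 4.

(** An antiderivative of [2 / x + barrier c x], whose exponential is the integrating factor of the
    comparison; [5 / 4] is [2 - 3 / 4]. *)
Definition barrier_prim (c x : R) : R :=
  5 / 4 * ln x + 2 * al * sqrt x - 2 * (3 / (32 * al)) / sqrt x - c / x.

Lemma is_derive_barrier (c x : R) : 0 < x ->
  let w := / sqrt x in
  is_derive (barrier c) x
    (- / 2 * (al * w ^ 3 - 3 / 2 * w ^ 4 + 3 * (3 / (32 * al)) * w ^ 5 + 4 * c * w ^ 6)).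
Proof using Hal.
  intros Hx w; unfold barrier.
  assert (Hs : 0 < sqrt x) by now apply sqrt_lt_R0.
  auto_derive; [repeat split; lra|].
  unfold w; field; lra.
Qed.

Lemma is_derive_barrier_prim (c x : R) : 0 < x ->
  is_derive (barrier_prim c) x (2 / x + barrier c x).
Proof using Hal.
  intros Hx; unfold barrier_prim, barrier.
  assert (Hs : 0 < sqrt x) by now apply sqrt_lt_R0.
  assert (E : x = sqrt x * sqrt x) by (symmetry; apply sqrt_sqrt; lra).
  auto_derive; [repeat split; lra|].
  set (y := sqrt x) in *; rewrite E; field; lra.
Qed.

Definition barrier_defect (c w : R) : R :=
  (2 * al * c - 3 / (32 * al)) * w ^ 5 + ((3 / (32 * al)) ^ 2 - 3 / 2 * c) * w ^ 6 +
  2 * (3 / (32 * al)) * c * w ^ 7 + c ^ 2 * w ^ 8.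

(** The coefficients of [barrier] are those that cancel the orders [w^2], [w^3] and [w^4], so the
    residual starts at [w^5]. *)
Lemma barrier_riccati (c x : R) : 0 < x ->
  let w := / sqrt x in
  - / 2 * (al * w ^ 3 - 3 / 2 * w ^ 4 + 3 * (3 / (32 * al)) * w ^ 5 + 4 * c * w ^ 6)
  + 2 / x * barrier c x + barrier c x ^ 2 - A / x = barrier_defect c w.
Proof using Hal HalA.
  intros Hx w; unfold barrier, barrier_defect; fold w.
  assert (Hs : 0 < sqrt x) by now apply sqrt_lt_R0.
  assert (E : / x = w ^ 2).
  { unfold w; rewrite <- (sqrt_sqrt x) at 1 by lra; field; lra. }
  replace (2 / x) with (2 * w ^ 2) by (rewrite <- E; reflexivity).
  replace (A / x) with (al ^ 2 * w ^ 2) by (rewrite <- E, HalA; reflexivity).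
  field; lra.
Qed.

(** Comparing [b f] with [f'] instead of [b] with [f' / f] makes the problem linear. After
    multiplication by the integrating factor the derivative has the sign of the defect. *)
Lemma bessel_barrier_derive (c x : R) : 0 < x ->
  is_derive (fun u => (barrier c u * bessel A u - bessel1 u) * exp (barrier_prim c u)) x
    (bessel A x * barrier_defect c (/ sqrt x) * exp (barrier_prim c x)).
Proof using HA Hal HalA.
  intros Hx.
  assert (D1 := is_derive_barrier c x Hx); cbv zeta in D1.
  assert (D2 := is_derive_barrier_prim c x Hx).
  assert (RE := barrier_riccati c x Hx); cbv zeta in RE.
  set (b' := - / 2 * _) in D1, RE.
  assert (D3 : is_derive (fun u => exp (barrier_prim c u)) x
    ((2 / x + barrier c x) * exp (barrier_prim c x))).
  { apply (is_derive_comp exp (barrier_prim c)); [|exact D2].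
    auto_derive; auto; ring. }
  assert (D4 := is_derive_mult_R _ _ _ _ _ D1 (is_derive_bessel x)).
  assert (D5 := is_derive_minus _ _ _ _ _ D4 (is_derive_bessel1 x)).
  assert (D6 := is_derive_mult_R _ _ _ _ _ D5 D3).
  replace (bessel A x * barrier_defect c (/ sqrt x) * exp (barrier_prim c x)) with
    (minus (b' * bessel A x + barrier c x * bessel1 x) (bessel2 x) * exp (barrier_prim c x) +
     (barrier c x * bessel A x - bessel1 x) * ((2 / x + barrier c x) * exp (barrier_prim c x))).
  - exact D6.
  - unfold minus, plus, opp; simpl.
    assert (OD := bessel_ode x).
    assert (E2 : bessel2 x = (A * bessel A x - 2 * bessel1 x) / x) by (rewrite <- OD; field; lra).
    rewrite E2, <- RE; field; lra.
Qed.

Lemma inv_sqrt_le_2 (x : R) : / 4 <= x -> 0 < / sqrt x <= 2.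
Proof.
  intros Hx.
  assert (Hs : / 2 <= sqrt x).
  { rewrite <- (sqrt_Rsqr (/ 2)) by lra; apply sqrt_le_1_alt; unfold Rsqr; lra. }
  split; [apply Rinv_0_lt_compat; lra|].
  replace 2 with (/ / 2) by field; apply Rinv_le_contravar; lra.
Qed.

Lemma d_bounds : 0.1033 < 3 / (32 * al) < 0.1034.
Proof using Hal.
  assert (E : 3 / (32 * al) * al = 3 / 32) by (field; lra).
  split; nra.
Qed.

Lemma sqrt_quarter : sqrt (/ 4) = / 2.
Proof.
  replace (/ 4) with (Rsqr (/ 2)) by (unfold Rsqr; field); apply sqrt_Rsqr; lra.
Qed.

(** The comparison starts at [x = 1 / 4], that is [w = 2], where [barrier 0] is negative while
    [bessel1] is nonnegative; the defect is nonpositive from there on. *)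
Lemma log_derivative_lower (x : R) : / 4 <= x -> barrier 0 x * bessel A x <= bessel1 x.
Proof using HA Hal HalA.
  intros Hx; assert (Hd := d_bounds).
  assert (H : - ((barrier 0 (/ 4) * bessel A (/ 4) - bessel1 (/ 4)) * exp (barrier_prim 0 (/ 4))) <=
              - ((barrier 0 x * bessel A x - bessel1 x) * exp (barrier_prim 0 x))).
  { apply (increasing_of_derive_nonneg
      (fun u => - ((barrier 0 u * bessel A u - bessel1 u) * exp (barrier_prim 0 u)))
      (fun u => - (bessel A u * barrier_defect 0 (/ sqrt u) * exp (barrier_prim 0 u)))); [exact Hx | |].
    - intros u Hu.
      apply (is_derive_opp (fun u => (barrier 0 u * bessel A u - bessel1 u) * exp (barrier_prim 0 u))).
      apply bessel_barrier_derive; lra.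
    - intros u Hu.
      assert (Hw := inv_sqrt_le_2 u ltac:(lra)); set (w := / sqrt u) in *.
      assert (HN : barrier_defect 0 w <= 0).
      { unfold barrier_defect; set (dd := 3 / (32 * al)) in *.
        replace (_ + _) with (- (dd * w ^ 5 * (1 - dd * w))) by ring.
        assert (0 < w ^ 5) by (apply pow_lt; lra).
        assert (0 <= dd * w ^ 5 * (1 - dd * w)) by (apply Rmult_le_pos; nra). lra. }
      assert (P := bessel_pos u ltac:(lra)); assert (E := exp_pos (barrier_prim 0 u)).
      assert (0 <= bessel A u * exp (barrier_prim 0 u) * - barrier_defect 0 w)
        by (apply Rmult_le_pos; [apply Rmult_le_pos|]; lra).
      lra. }
  assert (H4 : barrier 0 (/ 4) <= 0).
  { unfold barrier; rewrite sqrt_quarter, Rinv_inv. nra. }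
  assert (P4 := bessel_pos (/ 4) ltac:(lra)).
  assert (Q4 := bessel1_bounds (/ 4) ltac:(lra)).
  assert (E4 := exp_pos (barrier_prim 0 (/ 4))).
  assert (Ex := exp_pos (barrier_prim 0 x)).
  assert (L4 : (barrier 0 (/ 4) * bessel A (/ 4) - bessel1 (/ 4)) * exp (barrier_prim 0 (/ 4)) <= 0).
  { assert (M4 : barrier 0 (/ 4) * bessel A (/ 4) - bessel1 (/ 4) <= 0) by nra.
    set (m := barrier 0 (/ 4) * bessel A (/ 4) - bessel1 (/ 4)) in *; nra. }
  assert (Lx : (barrier 0 x * bessel A x - bessel1 x) * exp (barrier_prim 0 x) <= 0) by lra.
  destruct (Rle_dec (barrier 0 x * bessel A x) (bessel1 x)) as [G|G]; [exact G | exfalso].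
  assert (0 < (barrier 0 x * bessel A x - bessel1 x) * exp (barrier_prim 0 x))
    by (apply Rmult_lt_0_compat; lra); lra.
Qed.

(** The formal coefficient of [w^4] is [3 / (64 al^2)], about 0.057; [1 / 5] exceeds it by enough to
    keep the defect nonnegative up to [w = 2], where [barrier (/ 5)] is above the starting bound
    [A / 2]. *)
Lemma log_derivative_upper (x : R) : / 4 <= x -> bessel1 x <= barrier (/ 5) x * bessel A x.
Proof using HA Hal HalA.
  intros Hx; assert (Hd := d_bounds).
  assert (H : (barrier (/ 5) (/ 4) * bessel A (/ 4) - bessel1 (/ 4)) * exp (barrier_prim (/ 5) (/ 4)) <=
              (barrier (/ 5) x * bessel A x - bessel1 x) * exp (barrier_prim (/ 5) x)).
  { apply (increasing_of_derive_nonneg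
      (fun u => (barrier (/ 5) u * bessel A u - bessel1 u) * exp (barrier_prim (/ 5) u))
      (fun u => bessel A u * barrier_defect (/ 5) (/ sqrt u) * exp (barrier_prim (/ 5) u))); [exact Hx | |].
    - intros u Hu; apply bessel_barrier_derive; lra.
    - intros u Hu.
      assert (Hw := inv_sqrt_le_2 u ltac:(lra)); set (w := / sqrt u) in *.
      assert (HN : 0 <= barrier_defect (/ 5) w).
      { unfold barrier_defect; set (dd := 3 / (32 * al)) in *.
        replace (_ + _) with (w ^ 5 * ((2 * al * / 5 - dd) + (dd ^ 2 - 3 / 2 * / 5) * w +
          2 * dd * / 5 * w ^ 2 + (/ 5) ^ 2 * w ^ 3)) by ring.
        apply Rmult_le_pos; [apply pow_le; lra|].
        (* Tangents to [w^3] and [w^2] at [5 / 4], close to the minimum of the polynomial, reduce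
           its positivity to a linear inequality. *)
        assert (T3 : 4.6875 * w - 3.90625 <= w ^ 3).
        { assert (0 <= (w - 1.25) ^ 2 * (w + 2.5)) by (apply Rmult_le_pos; [apply pow2_ge_0 | lra]); nra. }
        assert (T2 : 2.5 * w - 1.5625 <= w ^ 2).
        { assert (0 <= (w - 1.25) ^ 2) by apply pow2_ge_0; nra. }
        assert (0.01 <= dd ^ 2) by nra.
        assert (0 <= w ^ 2) by apply pow2_ge_0.
        assert ((0.01 - 0.3) * w <= (dd ^ 2 - 3 / 2 * / 5) * w) by (apply Rmult_le_compat_r; lra).
        assert (0.0413 * w ^ 2 <= 2 * dd * / 5 * w ^ 2) by (apply Rmult_le_compat_r; lra).
        lra. }
      apply Rmult_le_pos; [apply Rmult_le_pos; [left; apply bessel_pos; lra | exact HN]|].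
      left; apply exp_pos. }
  assert (H4 : A / 2 <= barrier (/ 5) (/ 4)).
  { unfold barrier; rewrite sqrt_quarter, Rinv_inv, HalA. nra. }
  assert (P4 := bessel_pos (/ 4) ltac:(lra)).
  assert (Q4 := bessel1_bounds (/ 4) ltac:(lra)).
  assert (E4 := exp_pos (barrier_prim (/ 5) (/ 4))).
  assert (Ex := exp_pos (barrier_prim (/ 5) x)).
  assert (L4 : 0 <= (barrier (/ 5) (/ 4) * bessel A (/ 4) - bessel1 (/ 4)) * exp (barrier_prim (/ 5) (/ 4))).
  { apply Rmult_le_pos; [nra | lra]. }
  assert (Lx : 0 <= (barrier (/ 5) x * bessel A x - bessel1 x) * exp (barrier_prim (/ 5) x)) by lra.
  destruct (Rle_dec (bessel1 x) (barrier (/ 5) x * bessel A x)) as [G|G]; [exact G | exfalso].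
  assert (0 < (bessel1 x - barrier (/ 5) x * bessel A x) * exp (barrier_prim (/ 5) x))
    by (apply Rmult_lt_0_compat; lra); lra.
Qed.

Definition ldb (x : R) : R := bessel1 x / bessel A x.
(** The Riccati equation solved for the derivative. Differentiating it repeatedly expresses [ldb2]
    and [ldb3] through [ldb] and [x], so bounds on [ldb] alone control all derivatives. *)
Definition ldb1 (x : R) : R := A / x - 2 * ldb x / x - ldb x ^ 2.
Definition ldb2 (x : R) : R := - A / x ^ 2 + 2 * ldb x / x ^ 2 - 2 * (/ x + ldb x) * ldb1 x.
Definition ldb3 (x : R) : R :=
  2 * A / x ^ 3 - 4 * ldb x / x ^ 3 + 4 * ldb1 x / x ^ 2 - 2 * ldb1 x ^ 2 - 2 * (/ x + ldb x) * ldb2 x.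

Lemma is_derive_ln_bessel (x : R) : 0 < x -> is_derive (fun u => ln (bessel A u)) x (ldb x).
Proof using HA.
  intros Hx; assert (P := bessel_pos x ltac:(lra)).
  unfold ldb, Rdiv; apply (is_derive_comp ln (bessel A)); [|apply is_derive_bessel].
  apply is_derive_Reals, derivable_pt_lim_ln; exact P.
Qed.

Lemma is_derive_ldb (x : R) : 0 < x -> is_derive ldb x (ldb1 x).
Proof using HA.
  intros Hx; assert (P := bessel_pos x ltac:(lra)).
  assert (OD := bessel_ode x).
  assert (E2 : bessel2 x = (A * bessel A x - 2 * bessel1 x) / x) by (rewrite <- OD; field; lra).
  replace (ldb1 x) with ((bessel2 x * bessel A x - bessel1 x * bessel1 x) / bessel A x ^ 2).
  - apply (is_derive_div bessel1 (bessel A)); [apply is_derive_bessel1 | apply is_derive_bessel | lra].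
  - unfold ldb1, ldb; rewrite E2; field; lra.
Qed.

Lemma is_derive_ldb1 (x : R) : 0 < x -> is_derive ldb1 x (ldb2 x).
Proof using HA.
  intros Hx; assert (D := is_derive_ldb x Hx).
  assert (E : ex_derive ldb x) by (eexists; exact D).
  unfold ldb1 at 1; auto_derive; [repeat split; auto; lra|].
  change (Derive (fun u => ldb u) x) with (Derive ldb x); rewrite (is_derive_unique _ _ _ D).
  unfold ldb2; field; lra.
Qed.

Lemma is_derive_ldb2 (x : R) : 0 < x -> is_derive ldb2 x (ldb3 x).
Proof using HA.
  intros Hx; assert (D := is_derive_ldb x Hx); assert (D1 := is_derive_ldb1 x Hx).
  assert (E : ex_derive ldb x) by (eexists; exact D).
  assert (E1 : ex_derive ldb1 x) by (eexists; exact D1).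
  unfold ldb2 at 1; auto_derive; [repeat split; auto; nra|].
  change (Derive (fun u => ldb u) x) with (Derive ldb x); rewrite (is_derive_unique _ _ _ D).
  change (Derive (fun u => ldb1 u) x) with (Derive ldb1 x); rewrite (is_derive_unique _ _ _ D1).
  unfold ldb3; field; lra.
Qed.

(* With [w = / sqrt x], the barriers give [ldb x = w (al - 3/4 w + r2 w^2)] with [r2] bounded. *)
Lemma ldb_expansion (x : R) : 100 <= x ->
  let w := / sqrt x in
  0 < w <= / 10 /\
  exists s2 : R, 0 <= s2 <= 0.43 /\ ldb1 x = - w ^ 3 * (al / 2 - 3 / 4 * w + s2 * w ^ 2) /\ ldb3 x <= 0.
Proof using HA Hal HalA.
  intros Hx w; assert (Hd := d_bounds).
  assert (Hs : 10 <= sqrt x).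
  { rewrite <- (sqrt_Rsqr 10) by lra; apply sqrt_le_1_alt; unfold Rsqr; lra. }
  assert (Hw : 0 < w <= / 10).
  { unfold w; split; [apply Rinv_0_lt_compat; lra | apply Rinv_le_contravar; lra]. }
  split; [exact Hw|].
  assert (Ex : / x = w ^ 2).
  { unfold w; rewrite <- (sqrt_sqrt x) at 1 by lra; field; lra. }
  assert (P := bessel_pos x ltac:(lra)).
  assert (L := log_derivative_lower x ltac:(lra)); assert (U := log_derivative_upper x ltac:(lra)).
  assert (Hl : barrier 0 x <= ldb x) by (unfold ldb; apply Rle_div_r; lra).
  assert (Hu : ldb x <= barrier (/ 5) x) by (unfold ldb; apply Rle_div_l; lra).
  unfold barrier in Hl, Hu; fold w in Hl, Hu.
  set (dd := 3 / (32 * al)) in *.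
  assert (Ead : al * dd = 3 / 32) by (unfold dd; field; lra).
  assert (Hw4 : 0 < w ^ 4) by (apply pow_lt; lra).
  set (e := (ldb x - (al * w - 3 / 4 * w ^ 2 + dd * w ^ 3)) / w ^ 4).
  assert (Ee : ldb x = al * w - 3 / 4 * w ^ 2 + dd * w ^ 3 + e * w ^ 4) by (unfold e; field; lra).
  assert (He : 0 <= e <= / 5).
  { unfold e; split; [apply Rdiv_le_0_compat; lra | apply Rle_div_l; lra]. }
  clearbody e; clear L U Hl Hu.
  set (r2 := dd + e * w).
  set (s2 := (dd / 2 + 2 * al * e) + (e / 2 + dd ^ 2) * w + 2 * dd * e * w ^ 2 + e ^ 2 * w ^ 3).
  assert (E1 : ldb1 x = - w ^ 3 * (al / 2 - 3 / 4 * w + s2 * w ^ 2)).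
  { unfold ldb1, Rdiv; rewrite Ex, Ee, HalA; unfold s2.
    assert (Edd : dd = 3 / 32 / al) by (unfold dd; field; lra).
    rewrite Edd; field; lra. }
  set (q1 := 2 * al * s2 + al * r2 - 15 / 8 + (s2 / 2 + r2 / 2) * w + 2 * r2 * s2 * w ^ 2).
  assert (Er : ldb x = w * (al - 3 / 4 * w + r2 * w ^ 2)) by (rewrite Ee; unfold r2; ring).
  assert (E2 : ldb2 x = w ^ 5 * (3 / 4 * al + q1 * w)).
  { unfold ldb2; rewrite E1, Er, HalA.
    replace (- al ^ 2 / x ^ 2) with (- al ^ 2 * (/ x) ^ 2) by (field; lra).
    replace (2 * (w * (al - 3 / 4 * w + r2 * w ^ 2)) / x ^ 2) with
      (2 * (w * (al - 3 / 4 * w + r2 * w ^ 2)) * (/ x) ^ 2) by (field; lra).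
    rewrite Ex; unfold q1; field. }
  assert (Hs2 : 0 <= s2 <= 0.43).
  { assert (0 <= al * e <= 0.1815) by nra.
    assert (0 <= dd ^ 2 <= 0.011) by nra.
    assert (B1 : 0 <= (e / 2 + dd ^ 2) * w <= 0.0112) by nra.
    assert (B2 : 0 <= 2 * dd * e * w ^ 2 <= 0.001).
    { assert (0 <= dd * e <= 0.021) by nra. assert (0 <= w ^ 2 <= 0.01) by nra. nra. }
    assert (B3 : 0 <= e ^ 2 * w ^ 3 <= 0.001).
    { assert (0 <= e ^ 2 <= 0.04) by nra. assert (0 <= w ^ 2 <= 0.01) by nra.
      assert (0 <= w ^ 3 <= 0.001) by (simpl in *; nra). nra. }
    unfold s2; lra. }
  assert (Hr2 : 0 <= r2 <= 0.13) by (unfold r2; nra).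
  exists s2; split; [exact Hs2|]; split; [exact E1|].
  assert (E3 : ldb3 x = w ^ 7 * (- 39 / 8 * al - 2 * al * q1 +
     w * (39 / 8 - 2 * al * s2 - q1 / 2 - 3 / 2 * al * r2) +
     w ^ 2 * (- 4 * r2 - s2 - 2 * r2 * q1) - 2 * s2 ^ 2 * w ^ 3)).
  { unfold ldb3; rewrite E2, E1, Er, HalA.
    replace (2 * al ^ 2 / x ^ 3) with (2 * al ^ 2 * (/ x) ^ 3) by (field; lra).
    replace (4 * (w * (al - 3 / 4 * w + r2 * w ^ 2)) / x ^ 3) with
      (4 * (w * (al - 3 / 4 * w + r2 * w ^ 2)) * (/ x) ^ 3) by (field; lra).
    replace (4 * (- w ^ 3 * (al / 2 - 3 / 4 * w + s2 * w ^ 2)) / x ^ 2) with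
      (4 * (- w ^ 3 * (al / 2 - 3 / 4 * w + s2 * w ^ 2)) * (/ x) ^ 2) by (field; lra).
    rewrite Ex; unfold q1; field. }
  rewrite E3.
  (* This makes the leading coefficient [- 39 / 8 al - 2 al q1] at most [- 9 / 8 al], below -1,
     which outweighs the other terms for [w <= 1 / 10]. *)
  assert (Hq1 : - 15 / 8 <= q1).
  { unfold q1.
    assert (0 <= al * s2) by nra. assert (0 <= al * r2) by nra.
    assert (0 <= (s2 / 2 + r2 / 2) * w) by nra.
    assert (0 <= r2 * s2) by nra. assert (0 <= r2 * s2 * w ^ 2) by nra. lra. }
  assert (T0 : - 2 * al * q1 <= 15 / 4 * al) by nra.
  assert (T1 : w * (39 / 8 - 2 * al * s2 - q1 / 2 - 3 / 2 * al * r2) <= w * 5.82).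
  { apply Rmult_le_compat_l; [lra|].
    assert (0 <= al * s2) by nra. assert (0 <= al * r2) by nra. lra. }
  assert (T2 : w ^ 2 * (- 4 * r2 - s2 - 2 * r2 * q1) <= w ^ 2 * 0.5).
  { apply Rmult_le_compat_l; [nra|]. assert (- 2 * r2 * q1 <= 15 / 4 * r2) by nra. lra. }
  assert (T3 : 0 <= s2 ^ 2 * w ^ 3).
  { apply Rmult_le_pos; [apply pow2_ge_0 | apply pow_le; lra]. }
  assert (w ^ 2 <= / 100) by nra.
  assert (0 < w ^ 7) by (apply pow_lt; lra).
  set (Z := _ - 2 * s2 ^ 2 * w ^ 3) in *.
  assert (Z <= 0) by (unfold Z; lra).
  nra.
Qed.

End Riccati.

(** * Finite differences and the inequality for the main term *)

(** The symmetric difference of half-width [u] is compared with [M u^2] by integrating twice from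
    [u = 0]. *)
Lemma second_difference_le (f f1 f2 : R -> R) (m M : R) :
  (forall x, m - 1 <= x <= m + 1 -> is_derive f x (f1 x)) ->
  (forall x, m - 1 <= x <= m + 1 -> is_derive f1 x (f2 x)) ->
  (forall x, m - 1 <= x <= m + 1 -> f2 x <= M) ->
  f (m + 1) + f (m - 1) - 2 * f m <= M.
Proof.
  intros D1 D2 HM.
  assert (Sh : forall (g g' : R -> R) (j : R), (forall x, m - 1 <= x <= m + 1 -> is_derive g x (g' x)) ->
     0 <= j <= 1 -> is_derive (fun u => g (m + u)) j (g' (m + j)) /\
                    is_derive (fun u => g (m - u)) j (- g' (m - j))).
  { intros g g' j Hg Hj; split.
    - replace (g' (m + j)) with (1 * g' (m + j)) by ring.
      apply (is_derive_comp g (fun u => m + u)); [apply Hg; lra | auto_derive; auto; ring].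
    - replace (- g' (m - j)) with (- (1) * g' (m - j)) by ring.
      apply (is_derive_comp g (fun u => m - u)); [apply Hg; lra | auto_derive; auto; ring]. }
  assert (H1 : forall j, 0 <= j <= 1 -> 0 <= 2 * M * j - (f1 (m + j) - f1 (m - j))).
  { intros j Hj.
    assert (H : 2 * M * 0 - (f1 (m + 0) - f1 (m - 0)) <= 2 * M * j - (f1 (m + j) - f1 (m - j))).
    { apply (increasing_of_derive_nonneg (fun u => 2 * M * u - (f1 (m + u) - f1 (m - u)))
        (fun u => 2 * M - (f2 (m + u) - - f2 (m - u)))); [lra | |].
      - intros u Hu; destruct (Sh f1 f2 u D2 ltac:(lra)) as [S1 S2].
        apply (is_derive_minus (fun u => 2 * M * u) (fun u => f1 (m + u) - f1 (m - u))).
        + auto_derive; auto; ring.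
        + exact (is_derive_minus _ _ _ _ _ S1 S2).
      - intros u Hu; assert (G1 := HM (m + u)); assert (G2 := HM (m - u)); lra. }
    rewrite Rplus_0_r, Rminus_0_r in H; lra. }
  assert (H : M * 0 ^ 2 - (f (m + 0) + f (m - 0)) <= M * 1 ^ 2 - (f (m + 1) + f (m - 1))).
  { apply (increasing_of_derive_nonneg (fun u => M * u ^ 2 - (f (m + u) + f (m - u)))
      (fun u => 2 * M * u - (f1 (m + u) + - f1 (m - u)))); [lra | |].
    - intros u Hu; destruct (Sh f f1 u D1 Hu) as [S1 S2].
      apply (is_derive_minus (fun u => M * u ^ 2) (fun u => f (m + u) + f (m - u))).
      + auto_derive; auto; ring.
      + exact (is_derive_plus _ _ _ _ _ S1 S2).
    - intros u Hu; assert (G := H1 u Hu); lra. }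
  rewrite Rplus_0_r, Rminus_0_r in H; lra.
Qed.

(** The two sides differ by the fourth central difference. As a function of the step [u] its second
    derivative carries equal weights 4 at the distances [u] and [2 u], so it suffices that
    [f2 (m + i) + f2 (m - i)] decreases in [i]. *)
Lemma fourth_difference_nonpos (f f1 f2 f3 f4 : R -> R) (m : R) :
  (forall x, m - 2 <= x <= m + 2 -> is_derive f x (f1 x)) ->
  (forall x, m - 2 <= x <= m + 2 -> is_derive f1 x (f2 x)) ->
  (forall x, m - 2 <= x <= m + 2 -> is_derive f2 x (f3 x)) ->
  (forall x, m - 2 <= x <= m + 2 -> is_derive f3 x (f4 x)) ->
  (forall x, m - 2 <= x <= m + 2 -> f4 x <= 0) ->
  f (m + 2) + f (m - 2) - 2 * f m <= 4 * (f (m + 1) + f (m - 1) - 2 * f m).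
Proof.
  intros D1 D2 D3 D4 H4.
  assert (Sh : forall (g g' : R -> R) (k j : R), (forall x, m - 2 <= x <= m + 2 -> is_derive g x (g' x)) ->
     0 <= k * j <= 2 -> 0 <= k <= 2 ->
     is_derive (fun u => g (m + k * u)) j (k * g' (m + k * j)) /\
     is_derive (fun u => g (m - k * u)) j (- k * g' (m - k * j))).
  { intros g g' k j Hg Hj Hk; split.
    - apply (is_derive_comp g (fun u => m + k * u)); [apply Hg; lra | auto_derive; auto; ring].
    - apply (is_derive_comp g (fun u => m - k * u)); [apply Hg; lra | auto_derive; auto; ring]. }
  assert (H3 : forall i, 0 <= i <= 2 -> f3 (m + i) <= f3 (m - i)).
  { intros i Hi.
    assert (H : - f3 (m - i) <= - f3 (m + i)); [|lra].
    apply (increasing_of_derive_nonneg (fun u => - f3 u) (fun u => - f4 u)); [lra | |].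
    - intros u Hu; apply (is_derive_opp f3); apply D4; lra.
    - intros u Hu; assert (G := H4 u); lra. }
  assert (H2 : forall i j, 0 <= i <= j -> j <= 2 ->
    f2 (m + j) + f2 (m - j) <= f2 (m + i) + f2 (m - i)).
  { intros i j Hij Hj.
    assert (H : - (f2 (m + 1 * i) + f2 (m - 1 * i)) <= - (f2 (m + 1 * j) + f2 (m - 1 * j))).
    { apply (increasing_of_derive_nonneg (fun u => - (f2 (m + 1 * u) + f2 (m - 1 * u)))
        (fun u => - (1 * f3 (m + 1 * u) + - (1) * f3 (m - 1 * u)))); [lra | |].
      - intros u Hu; destruct (Sh f2 f3 1 u D3 ltac:(lra) ltac:(lra)) as [S1 S2].
        apply (is_derive_opp (fun u => f2 (m + 1 * u) + f2 (m - 1 * u))).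
        exact (is_derive_plus _ _ _ _ _ S1 S2).
      - intros u Hu; assert (G := H3 u); rewrite !Rmult_1_l; lra. }
    rewrite !Rmult_1_l in H; lra. }
  assert (H1 : forall j, 0 <= j <= 1 ->
    0 <= 4 * (f1 (m + j) - f1 (m - j)) - 2 * (f1 (m + 2 * j) - f1 (m - 2 * j))).
  { intros j Hj.
    assert (H : 4 * (f1 (m + 1 * 0) - f1 (m - 1 * 0)) - 2 * (f1 (m + 2 * 0) - f1 (m - 2 * 0)) <=
                4 * (f1 (m + 1 * j) - f1 (m - 1 * j)) - 2 * (f1 (m + 2 * j) - f1 (m - 2 * j))).
    { apply (increasing_of_derive_nonneg
        (fun u => 4 * (f1 (m + 1 * u) - f1 (m - 1 * u)) - 2 * (f1 (m + 2 * u) - f1 (m - 2 * u)))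
        (fun u => 4 * (1 * f2 (m + 1 * u) - - (1) * f2 (m - 1 * u)) -
                  2 * (2 * f2 (m + 2 * u) - - (2) * f2 (m - 2 * u)))); [lra | |].
      - intros u Hu.
        destruct (Sh f1 f2 1 u D2 ltac:(lra) ltac:(lra)) as [S1 S2].
        destruct (Sh f1 f2 2 u D2 ltac:(lra) ltac:(lra)) as [S3 S4].
        apply (is_derive_minus (fun u => 4 * (f1 (m + 1 * u) - f1 (m - 1 * u)))
          (fun u => 2 * (f1 (m + 2 * u) - f1 (m - 2 * u)))).
        + exact (is_derive_scal _ _ 4 _ (is_derive_minus _ _ _ _ _ S1 S2)).
        + exact (is_derive_scal _ _ 2 _ (is_derive_minus _ _ _ _ _ S3 S4)).
      - intros u Hu; assert (G := H2 u (2 * u) ltac:(lra) ltac:(lra)); rewrite !Rmult_1_l; lra. }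
    rewrite !Rmult_0_r, !Rmult_1_l, !Rplus_0_r, !Rminus_0_r in H; lra. }
  assert (H : 4 * (f (m + 1 * 0) + f (m - 1 * 0)) - (f (m + 2 * 0) + f (m - 2 * 0)) <=
              4 * (f (m + 1 * 1) + f (m - 1 * 1)) - (f (m + 2 * 1) + f (m - 2 * 1))).
  { apply (increasing_of_derive_nonneg
      (fun u => 4 * (f (m + 1 * u) + f (m - 1 * u)) - (f (m + 2 * u) + f (m - 2 * u)))
      (fun u => 4 * (1 * f1 (m + 1 * u) + - (1) * f1 (m - 1 * u)) -
                (2 * f1 (m + 2 * u) + - (2) * f1 (m - 2 * u)))); [lra | |].
    - intros u Hu.
      destruct (Sh f f1 1 u D1 ltac:(lra) ltac:(lra)) as [S1 S2].
      destruct (Sh f f1 2 u D1 ltac:(lra) ltac:(lra)) as [S3 S4].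
      apply (is_derive_minus (fun u => 4 * (f (m + 1 * u) + f (m - 1 * u)))
        (fun u => f (m + 2 * u) + f (m - 2 * u))).
      + exact (is_derive_scal _ _ 4 _ (is_derive_plus _ _ _ _ _ S1 S2)).
      + exact (is_derive_plus _ _ _ _ _ S3 S4).
    - intros u Hu; assert (G := H1 u Hu); rewrite !Rmult_1_l; lra. }
  rewrite !Rmult_0_r, !Rmult_1_r, !Rplus_0_r, !Rminus_0_r in H; lra.
Qed.

(** The constant and linear terms cancel and [- 6 u^2] is the exact quadratic term. Integrating
    twice, the claim rests on [z^4 <= z] for [z = exp (- w)]. *)
Lemma exp_combination_ge (u : R) : 0 <= u -> - (6 * u ^ 2) <= 4 * exp (- u) - exp (- 4 * u) - 3.
Proof.
  intros Hu.
  assert (H1 : forall v, 0 <= v -> 0 <= - 4 * exp (- v) + 4 * exp (- 4 * v) + 12 * v).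
  { intros v Hv.
    assert (H : - 4 * exp (- 0) + 4 * exp (- 4 * 0) + 12 * 0 <= - 4 * exp (- v) + 4 * exp (- 4 * v) + 12 * v).
    { apply (increasing_of_derive_nonneg (fun w => - 4 * exp (- w) + 4 * exp (- 4 * w) + 12 * w)
        (fun w => 4 * exp (- w) - 16 * exp (- 4 * w) + 12)); [exact Hv | |].
      - intros w _; auto_derive; auto; ring.
      - intros w Hw.
        assert (E : exp (- 4 * w) = exp (- w) * exp (- w) * (exp (- w) * exp (- w))).
        { rewrite <- !exp_plus; f_equal; ring. }
        assert (Hz : 0 < exp (- w) <= 1).
        { split; [apply exp_pos | rewrite <- exp_0; apply exp_le; lra]. }
        rewrite E; set (z := exp (- w)) in *.
        assert (z * z <= z) by nra. assert (z * z * (z * z) <= z) by nra. nra. }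
    rewrite Rmult_0_r, Ropp_0, exp_0 in H; lra. }
  assert (H : 4 * exp (- 0) - exp (- 4 * 0) - 3 + 6 * 0 ^ 2 <= 4 * exp (- u) - exp (- 4 * u) - 3 + 6 * u ^ 2).
  { apply (increasing_of_derive_nonneg (fun w => 4 * exp (- w) - exp (- 4 * w) - 3 + 6 * w ^ 2)
      (fun w => - 4 * exp (- w) + 4 * exp (- 4 * w) + 12 * w)); [exact Hu | |].
    - intros w _; auto_derive; auto; ring.
    - intros w Hw; apply H1; lra. }
  rewrite Rmult_0_r, Ropp_0, exp_0 in H; lra.
Qed.

(** The witnesses are minus the second differences of the logarithm with steps 1 and 2. The interval
    that bounds [u] begins at [n + 1 / 24], so its bound may be taken at [w = / sqrt (INR n)], the
    variable of the claim. *)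
Lemma bessel_inequality (A al : R) (n : nat) :
  0.9068 < al < 0.9070 -> A = al ^ 2 -> (1000 <= n)%nat ->
  let F := fun j : R => bessel A (INR n + 1 + / 24 + j) in
  let w := / sqrt (INR n) in
  exists u v : R, F 1 * F (-1) = F 0 ^ 2 * exp (- u) /\ F 2 * F (-2) = F 0 ^ 2 * exp (- v) /\
    0 <= u <= 1 /\ 4 * u <= v /\
    4 * exp (- u) - exp (- 4 * u) - 3 + 3 / 2 * A * w ^ 6 * exp (- u) >= 3 * w ^ 7.
Proof.
  intros Hal HA Hn F w.
  assert (HA0 : 0 < A) by (rewrite HA; apply pow_lt; lra).
  assert (Hn1 : 1000 <= INR n) by (replace 1000 with (INR 1000) by (simpl; ring); now apply le_INR).
  set (m := INR n + 1 + / 24).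
  assert (Fpos : forall j, - 2 <= j <= 2 -> 0 < F j) by (intros j Hj; apply bessel_pos; [exact HA0 | lra]).
  set (ell := fun x => ln (bessel A x)).
  set (g1 := ell (m + 1) + ell (m - 1) - 2 * ell m).
  set (g2 := ell (m + 2) + ell (m - 2) - 2 * ell m).
  assert (X := fun x (Hx : m - 2 <= x <= m + 2) => ldb_expansion A HA0 al Hal HA x ltac:(unfold m in Hx; lra)).
  assert (Hw : 0 < w <= / 30).
  { assert (Hs : 30 <= sqrt (INR n)).
    { rewrite <- (sqrt_Rsqr 30) by lra; apply sqrt_le_1_alt; unfold Rsqr; lra. }
    unfold w; split; [apply Rinv_0_lt_compat; lra | apply Rinv_le_contravar; lra]. }
  (* Lowering [3 / 4] to [7 / 10] absorbs the term [s2 * w ^ 2], at most [0.43 * w / 30]. *)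
  set (U := w ^ 3 * (al / 2 - 7 / 10 * w)).
  assert (Bnd : forall x, m - 1 <= x <= m + 1 -> 0 <= - ldb1 A x <= U).
  { intros x Hx; destruct (X x ltac:(lra)) as [Hwx [s2 [Hs2 [E1 _]]]].
    set (wx := / sqrt x) in *; rewrite E1.
    assert (Hle : wx <= w).
    { unfold wx, w; apply Rinv_le_contravar; [apply sqrt_lt_R0; lra|].
      apply sqrt_le_1_alt; unfold m in Hx; lra. }
    replace (- (- wx ^ 3 * (al / 2 - 3 / 4 * wx + s2 * wx ^ 2))) with
      (wx ^ 3 * (al / 2 - 3 / 4 * wx + s2 * wx ^ 2)) by ring.
    assert (P3 : 0 < wx ^ 3) by (apply pow_lt; lra).
    assert (Pw2 : 0 <= wx ^ 2 <= wx / 30) by nra.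
    assert (Ps : 0 <= s2 * wx ^ 2 <= 0.43 * (wx / 30)).
    { split; [apply Rmult_le_pos; lra | apply Rmult_le_compat; lra]. }
    split; [apply Rmult_le_pos; lra|].
    apply Rle_trans with (wx ^ 3 * (al / 2 - 7 / 10 * wx)).
    - apply Rmult_le_compat_l; lra.
    - unfold U.
      (* The factored difference of the bound at [w] and at [wx]: the expression increases in this
         range. *)
      assert (M : 0 <= (w - wx) * ((w ^ 2 + w * wx + wx ^ 2) * (al / 2 - 7 / 10 * (w + wx)) + 7 / 10 * (w + wx) * (w * wx))).
      { apply Rmult_le_pos; [lra|].
        assert (0 <= w ^ 2 + w * wx + wx ^ 2) by nra.
        assert (0 <= (w ^ 2 + w * wx + wx ^ 2) * (al / 2 - 7 / 10 * (w + wx))) by (apply Rmult_le_pos; lra).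
        assert (0 <= (w + wx) * (w * wx)) by (apply Rmult_le_pos; nra). lra. }
      lra. }
  assert (G1u : g1 <= 0).
  { apply (second_difference_le ell (ldb A) (ldb1 A) m 0); unfold m in *; intros x Hx.
    - apply is_derive_ln_bessel; [exact HA0 | lra].
    - apply is_derive_ldb; [exact HA0 | lra].
    - assert (B := Bnd x Hx); lra. }
  assert (G1l : - g1 <= U).
  { replace (- g1) with ((- ell (m + 1)) + (- ell (m - 1)) - 2 * - ell m) by (unfold g1; ring).
    apply (second_difference_le (fun x => - ell x) (fun x => - ldb A x) (fun x => - ldb1 A x) m U);
      intros x Hx.
    - apply (is_derive_opp ell), is_derive_ln_bessel; [exact HA0 | unfold m in Hx; lra].
    - apply (is_derive_opp (ldb A)), is_derive_ldb; [exact HA0 | unfold m in Hx; lra].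
    - assert (B := Bnd x Hx); lra. }
  assert (G2 : g2 <= 4 * g1).
  { apply (fourth_difference_nonpos ell (ldb A) (ldb1 A) (ldb2 A) (ldb3 A) m); intros x Hx;
      try (unfold m in Hx; lra).
    - apply is_derive_ln_bessel; [exact HA0 | unfold m in Hx; lra].
    - apply is_derive_ldb; [exact HA0 | unfold m in Hx; lra].
    - apply is_derive_ldb1; [exact HA0 | unfold m in Hx; lra].
    - apply is_derive_ldb2; [exact HA0 | unfold m in Hx; lra].
    - destruct (X x Hx) as [_ [s2 [_ [_ H3]]]]; exact H3. }
  assert (Prod : forall j, 0 <= j <= 2 -> F j * F (- j) =
    F 0 ^ 2 * exp (ell (m + j) + ell (m - j) - 2 * ell m)).
  { intros j Hj; unfold ell.
    replace (ln (bessel A (m + j)) + ln (bessel A (m - j)) - 2 * ln (bessel A m)) with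
      (ln (F j) + ln (F (- j)) + (- ln (F 0) + - ln (F 0))).
    2:{ unfold F; fold m; replace (m + 0) with m by ring; replace (m + - j) with (m - j) by ring; ring. }
    assert (P0 := Fpos 0 ltac:(lra)).
    rewrite !exp_plus, !exp_Ropp, !exp_ln by (apply Fpos; lra); field; lra. }
  exists (- g1), (- g2).
  split; [rewrite Ropp_involutive; apply (Prod 1); lra|].
  split; [rewrite Ropp_involutive; apply (Prod 2); lra|].
  set (u := - g1) in *.
  assert (Hu0 : 0 <= u) by (unfold u; lra).
  assert (W3 : 0 < w ^ 3 <= / 27000).
  { split; [apply pow_lt; lra|]. replace (/ 27000) with ((/ 30) ^ 3) by field; apply pow_incr; lra. }
  assert (HU : 0 <= U <= w ^ 3 / 2).
  { unfold U; split; [apply Rmult_le_pos; lra|]. nra. }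
  split; [lra|]; split; [unfold u; lra|].
  assert (HC := exp_combination_ge u Hu0).
  assert (Hexp : 1 - u <= exp (- u)) by (assert (H := exp_ineq1_le (- u)); lra).
  assert (W6 : 0 < w ^ 6) by (apply pow_lt; lra).
  assert (W7 : 0 < w ^ 7) by (apply pow_lt; lra).
  assert (U2 : u ^ 2 <= U ^ 2) by (apply pow_incr; lra).
  assert (C1 : 3 / 2 * A * w ^ 6 * (1 - U) <= 3 / 2 * A * w ^ 6 * exp (- u)).
  { apply Rmult_le_compat_l; [|lra]. apply Rmult_le_pos; lra. }
  apply Rle_ge.
  apply Rle_trans with (3 / 2 * A * w ^ 6 * (1 - U) - 6 * U ^ 2); [|lra].
  assert (A1 : A <= 0.83) by (rewrite HA; nra).
  assert (C2 : 3 / 2 * A * w ^ 6 * U <= w ^ 7 * / 1000).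
  { apply Rle_trans with (3 / 2 * (83 / 100) * w ^ 6 * (w ^ 3 / 2)).
    - apply Rmult_le_compat; try lra; [apply Rmult_le_pos; lra|].
      apply Rmult_le_compat_r; lra.
    - replace (3 / 2 * (83 / 100) * w ^ 6 * (w ^ 3 / 2)) with (w ^ 7 * (249 / 400 * w ^ 2)) by field.
      apply Rmult_le_compat_l; [lra|]. assert (w ^ 2 <= / 900) by nra. lra. }
  replace (3 / 2 * A * w ^ 6 * (1 - U) - 6 * U ^ 2) with
    (3 / 2 * A * w ^ 6 - 3 / 2 * A * w ^ 6 * U - 6 * U ^ 2) by ring.
  (* The [w^6] term is cancelled exactly by the one coming from [PI^2]; the surviving [w^7] term has
     coefficient about 3.7, which leaves the margin 3. *)
  assert (C3 : 6 * U ^ 2 = 3 / 2 * A * w ^ 6 - w ^ 7 * (42 / 10 * al - 294 / 100 * w)).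
  { unfold U; rewrite HA; field. }
  rewrite C3.
  assert (w ^ 7 * 3.6 <= w ^ 7 * (42 / 10 * al - 294 / 100 * w)) by (apply Rmult_le_compat_l; lra).
  lra.
Qed.

(** * A lower bound for the main term *)

(** The termwise comparison between the cosh series and the Bessel series; consecutive ratios
    satisfy [4 (k + 1) (k + 2) <= (2 k + 4) (2 k + 3)]. *)
Lemma fact_double_ge (k : nat) : (2 * 4 ^ k * (fact k * fact (S k)) <= fact (2 * k + 2))%nat.
Proof.
  induction k as [|k IH]; [simpl; lia|].
  replace (2 * S k + 2)%nat with (S (S (2 * k + 2))) by lia.
  rewrite (fact_simpl (S (2 * k + 2))), (fact_simpl (2 * k + 2)), (fact_simpl (S k)).
  rewrite (fact_simpl k) in *.
  replace (4 ^ S k)%nat with (4 * 4 ^ k)%nat by reflexivity.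
  set (a := (4 ^ k)%nat) in *; set (b := fact k) in *; set (c := fact (2 * k + 2)) in *.
  assert (H : (2 * (4 * a) * (S k * b * (S (S k) * (S k * b))) =
    (4 * S k * S (S k)) * (2 * a * (b * (S k * b))))%nat) by ring.
  rewrite H.
  replace (S (S (2 * k + 2)) * (S (2 * k + 2) * c))%nat with
    ((S (S (2 * k + 2)) * S (2 * k + 2)) * c)%nat by ring.
  apply Nat.mul_le_mono; [|exact IH]. nia.
Qed.

Lemma is_lim_exp_series (x : R) : is_lim_seq (Rsum (fun k => x ^ k / INR (fact k))) (exp x).
Proof.
  assert (H := is_exp_Reals x); apply is_pseries_R in H.
  apply (is_lim_seq_incr_1 (Rsum (fun k => x ^ k / INR (fact k)))).
  apply (is_lim_seq_ext (sum_n (fun k => / INR (fact k) * x ^ k))); [|exact H].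
  intros n; rewrite Rsum_sum_n; apply sum_n_ext; intros k; unfold Rdiv; apply Rmult_comm.
Qed.

Lemma is_lim_cosh_series (x : R) :
  is_lim_seq (Rsum (fun k => x ^ (2 * k + 2) / INR (fact (2 * k + 2)))) (cosh x - 1).
Proof.
  assert (H1 := is_lim_seq_double _ _ (is_lim_exp_series x)).
  assert (H2 := is_lim_seq_double _ _ (is_lim_exp_series (- x))).
  assert (H := is_lim_seq_scal_l _ (/ 2) _ (is_lim_seq_plus' _ _ _ _ H1 H2)).
  apply is_lim_seq_incr_1 in H.
  assert (H3 := is_lim_seq_minus' _ _ _ _ H (is_lim_seq_const 1)).
  replace (cosh x - 1) with (/ 2 * (exp x + exp (- x)) - 1) by (unfold cosh; field).
  revert H3; apply is_lim_seq_ext; intros n; cbv beta.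
  rewrite <- !Rsum_pairs, <- Rsum_plus, <- Rsum_mult_l.
  induction n as [|n IH].
  - rewrite Rsum_S; simpl; field.
  - rewrite Rsum_S.
    rewrite (Rsum_S (fun k => x ^ (2 * k + 2) / INR (fact (2 * k + 2)))), <- IH.
    replace (2 * n + 2)%nat with (2 * S n)%nat by lia.
    rewrite !Ropp_mult_distr_l_reverse || idtac.
    assert (Ev : (- x) ^ (2 * S n) = x ^ (2 * S n)).
    { rewrite !pow_mult; f_equal; ring. }
    assert (Od : (- x) ^ S (2 * S n) = - x ^ S (2 * S n)).
    { change (- x * (- x) ^ (2 * S n) = - (x * x ^ (2 * S n))); rewrite Ev; ring. }
    rewrite Ev, Od; field; split; apply INR_fact_neq_0.
Qed.

(** Only a power of [nu] is lost against the true size, which is harmless next to the exponential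
    saving of [coefficient_estimate]. *)
Lemma bessel_ge_cosh (A nu x : R) : 0 < A -> 0 < nu -> x ^ 2 = 4 * A * nu ->
  (cosh x - 1) / (2 * nu) <= bessel A nu.
Proof.
  intros HA Hnu Hx.
  replace ((cosh x - 1) / (2 * nu)) with (/ (2 * nu) * (cosh x - 1)) by (field; lra).
  refine (is_lim_seq_le _ _ _ _ _ (is_lim_seq_scal_l _ (/ (2 * nu)) _ (is_lim_cosh_series x))
    (is_lim_bessel A nu HA)).
  intros n; rewrite <- Rsum_mult_l; apply Rsum_le; intros k _.
  replace (2 * k + 2)%nat with (2 * S k)%nat at 1 by lia.
  rewrite pow_mult, Hx, !Rpow_mult_distr; unfold bessel_coef.
  assert (F := fact_double_ge k); apply le_INR in F.
  rewrite !mult_INR, pow_INR in F; simpl (INR 2) in F; simpl (INR 4) in F.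
  assert (P1 := INR_fact_lt_0 k); assert (P2 := INR_fact_lt_0 (S k)); assert (P3 := INR_fact_lt_0 (2 * k + 2)).
  set (a := INR (fact k)) in *; set (b := INR (fact (S k))) in *; set (c := INR (fact (2 * k + 2))) in *.
  assert (E4 : 1 + 1 + 1 + 1 = 4) by ring; rewrite E4 in F.
  assert (PA : 0 < A ^ S k) by now apply pow_lt.
  assert (Pn : 0 < nu ^ k) by now apply pow_lt.
  change (nu ^ S k) with (nu * nu ^ k); change (4 ^ S k) with (4 * 4 ^ k).
  replace (/ (2 * nu) * (4 * 4 ^ k * A ^ S k * (nu * nu ^ k) / c)) with
    (A ^ S k * nu ^ k * (2 * 4 ^ k / c)) by (field; lra).
  replace (A ^ S k / (a * b) * nu ^ k) with (A ^ S k * nu ^ k * / (a * b)) by (field; lra).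
  apply Rmult_le_compat_l; [apply Rmult_le_pos; lra|].
  apply Rle_div_l; [lra|].
  assert (Pab : 0 < a * b) by now apply Rmult_lt_0_compat.
  apply Rmult_le_reg_l with (a * b); [exact Pab|].
  replace (a * b * (/ (a * b) * c)) with c by (field; lra); lra.
Qed.

(** * Large n: error terms against the margin *)

Lemma exp_1_ge : 2.68 <= exp 1.
Proof.
  assert (H := exp_taylor5 1); rewrite Rabs_R1 in H; specialize (H ltac:(lra)).
  apply Rabs_le_between in H; lra.
Qed.

(** The constants are those of [relative_error]: [1 / (2 al)] exceeds 0.55, and the factors 9 of
    [coefficient_estimate], [6 nu] and [8 y^7] multiply to less than [433 y^9], as
    [nu <= 1.001 y^2]. *)
Lemma exp_beats_pow9 (y : R) : 89 <= y -> 433 * y ^ 9 < exp (55 / 100 * y).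
Proof.
  intros Hy.
  assert (N : 433 * 89 ^ 9 < exp 48).
  { apply Rlt_le_trans with ((268 / 100) ^ 48).
    - apply Rmult_lt_reg_r with (100 ^ 48); [apply pow_lt; lra|].
      replace ((268 / 100) ^ 48 * 100 ^ 48) with (268 ^ 48)
        by (rewrite <- Rpow_mult_distr; f_equal; field).
      rewrite !pow_IZR, <- !mult_IZR; apply IZR_lt; reflexivity.
    - replace 48 with (INR 48 * 1) by (simpl; ring).
      replace (exp (INR 48 * 1)) with (exp 1 ^ 48).
      + apply pow_incr; assert (H := exp_1_ge); lra.
      + rewrite <- (exp_ln (exp 1 ^ 48)) by (apply pow_lt, exp_pos).
        rewrite ln_pow, ln_exp by apply exp_pos; reflexivity. }
  (* The ninth root of the growth of the exponential beyond 89; [1 + z] already dominates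
     [y / 89]. *)
  set (z := (y - 89) * (55 / 900)).
  assert (Hz : y / 89 <= 1 + z) by (unfold z; lra).
  assert (E : exp (55 / 100 * y) = exp (55 / 100 * 89) * exp z ^ 9).
  { rewrite <- (exp_ln (exp z ^ 9)) by (apply pow_lt, exp_pos).
    rewrite ln_pow, ln_exp, <- exp_plus by apply exp_pos; f_equal; unfold z; simpl; field. }
  rewrite E.
  assert (E1 : exp 48 <= exp (55 / 100 * 89)) by (apply exp_le; lra).
  assert (E2 : (y / 89) ^ 9 <= exp z ^ 9).
  { apply pow_incr; split; [lra|]. assert (H := exp_ineq1_le z); lra. }
  assert (P : 0 < (y / 89) ^ 9) by (apply pow_lt; lra).
  apply Rlt_le_trans with (exp 48 * (y / 89) ^ 9).
  - replace (433 * y ^ 9) with (433 * 89 ^ 9 * (y / 89) ^ 9) by field.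
    now apply Rmult_lt_compat_r.
  - apply Rmult_le_compat; [left; apply exp_pos | lra | exact E1 | exact E2].
Qed.

Lemma alpha_exists : exists al : R, 0.9068 < al < 0.9070 /\ PI ^ 2 / 12 = al ^ 2.
Proof.
  assert (HPI := PI_bounds).
  exists (sqrt (PI ^ 2 / 12)).
  assert (P : 0.8224 < PI ^ 2 / 12 < 0.8225) by (split; nra).
  assert (E : sqrt (PI ^ 2 / 12) ^ 2 = PI ^ 2 / 12) by (apply pow2_sqrt; lra).
  assert (S0 := sqrt_pos (PI ^ 2 / 12)).
  split; [split; nra | now rewrite E].
Qed.

Lemma half_inverse_ge (al y Y : R) :
  0.9068 < al < 0.9070 -> 89.4 <= y -> y - / 100 <= Y -> 55 / 100 * y <= / (2 * (al / Y)).
Proof.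
  intros Hal Hy HY.
  replace (/ (2 * (al / Y))) with (Y / (2 * al)) by (field; lra).
  assert (y * al <= y * (9070 / 10000)) by (apply Rmult_le_compat_l; lra).
  apply (proj1 (Rle_div_r (55 / 100 * y) Y (2 * al) ltac:(lra))); lra.
Qed.

Lemma relative_error (c al : R) (n m : nat) :
  (forall t : C, 0 < Re t -> exists L : C, Clim (log_gf t) L /\
    let rho := exp (- (2 * Re (PI ^ 2 / t))) in
    Cmod (L - ((PI ^ 2 / 12)%R / t + t / 24 - c)) <= rho / (1 - rho) ^ 2) ->
  0.9068 < al < 0.9070 -> PI ^ 2 / 12 = al ^ 2 ->
  8000 <= INR n -> (n - 1 <= m <= n + 3)%nat ->
  let f := exp (- c) * bessel (PI ^ 2 / 12) (INR m + / 24) in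
  Rabs (INR (cnt m m) - f) <= f * ((/ sqrt (INR n)) ^ 7 / 8).
Proof.
  intros Hc Hal HA Hn1 Hm f.
  assert (Hn4 : (4000 <= n)%nat) by (apply INR_le; rewrite (INR_IZR_INZ 4000); apply Rle_trans with 8000; [simpl; lra | exact Hn1]).
  assert (Hm1 : INR n - 1 <= INR m <= INR n + 3).
  { split.
    - replace 1 with (INR 1) by reflexivity; rewrite <- minus_INR by lia; apply le_INR; lia.
    - replace 3 with (INR 3) by (simpl; ring); rewrite <- plus_INR; apply le_INR; lia. }
  set (nu := INR m + / 24) in *.
  set (Y := sqrt nu).
  assert (HY2 : Y * Y = nu) by (apply sqrt_sqrt; unfold nu; lra).
  assert (HY0 : 0 <= Y) by apply sqrt_pos.
  set (y := sqrt (INR n)).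
  assert (Hy2 : y * y = INR n) by (apply sqrt_sqrt; lra).
  assert (Hy0 : 0 <= y) by apply sqrt_pos.
  assert (Hy : 89.4 <= y) by nra.
  assert (HY : y - / 100 <= Y).
  { assert (y * y - 1 <= Y * Y) by (rewrite HY2, Hy2; unfold nu; lra). nra. }
  (* The saddle point, as [s^2 nu = al^2 = A]. *)
  set (s := al / Y).
  assert (HYp : 89 < Y) by lra.
  assert (Hs : 0 < s <= / 20).
  { unfold s; split; [apply Rdiv_lt_0_compat; lra | apply Rle_div_l; lra]. }
  assert (Hsn : s ^ 2 * nu = PI ^ 2 / 12) by (rewrite HA, <- HY2; unfold s; field; lra).
  assert (CE := coefficient_estimate c Hc m s Hs Hsn); fold nu f in CE.
  eapply Rle_trans; [exact CE|].
  unfold f; rewrite (Rmult_assoc (exp (- c)) (bessel _ _)); apply Rmult_le_compat_l; [left; apply exp_pos|].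
  set (x := 2 * nu * s).
  assert (Ex : x = 2 * al * Y) by (unfold x, s; rewrite <- HY2; field; lra).
  assert (HA0 : 0 < PI ^ 2 / 12) by (rewrite HA; apply pow_lt; lra).
  assert (Hnu : 0 < nu) by (unfold nu; lra).
  assert (BG : (cosh x - 1) / (2 * nu) <= bessel (PI ^ 2 / 12) nu).
  { apply bessel_ge_cosh; [exact HA0 | exact Hnu|].
    rewrite HA, Ex, <- HY2; ring. }
  assert (HE : 6 <= exp x) by (assert (H := exp_ineq1_le x); rewrite Ex in *; nra).
  assert (BG2 : exp x / (6 * nu) <= bessel (PI ^ 2 / 12) nu).
  { eapply Rle_trans; [|exact BG].
    replace (exp x / (6 * nu)) with ((exp x / 3) / (2 * nu)) by (field; lra).
    unfold Rdiv at 1 3; apply Rmult_le_compat_r; [left; apply Rinv_0_lt_compat; lra|].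
    unfold cosh; assert (H := exp_pos (- x)); lra. }
  assert (EN : exp (x - / (2 * s)) = exp x * exp (- / (2 * s))).
  { rewrite <- exp_plus; f_equal. }
  rewrite EN.
  set (w7 := (/ y) ^ 7 / 8).
  assert (Hw7 : 0 < w7) by (unfold w7; apply Rdiv_lt_0_compat; [apply pow_lt, Rinv_0_lt_compat; lra | lra]).
  apply Rle_trans with (exp x / (6 * nu) * w7); [|apply Rmult_le_compat_r; lra].
  replace (exp x / (6 * nu) * w7) with (exp x * (w7 / (6 * nu))) by (field; lra).
  replace (9 * (exp x * exp (- / (2 * s)))) with (exp x * (9 * exp (- / (2 * s)))) by ring.
  apply Rmult_le_compat_l; [left; apply exp_pos|].
  assert (E9 := exp_beats_pow9 y ltac:(lra)).
  assert (Hinv : 55 / 100 * y <= / (2 * s)).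
  { now apply half_inverse_ge. }
  assert (Hexp : exp (55 / 100 * y) <= exp (/ (2 * s))) by now apply exp_le.
  rewrite exp_Ropp.
  assert (Hp := exp_pos (/ (2 * s))).
  apply Rle_trans with (9 * / (433 * y ^ 9)).
  - apply Rmult_le_compat_l; [lra|]; apply Rinv_le_contravar; [|lra].
    apply Rmult_lt_0_compat; [lra | apply pow_lt; lra].
  - assert (Hnu2 : nu <= 1.001 * (y * y)) by (rewrite Hy2; unfold nu; lra).
    assert (Y7 : 0 < y ^ 7) by (apply pow_lt; lra).
    replace (w7 / (6 * nu)) with (/ (48 * nu * y ^ 7)) by (unfold w7; field; lra).
    replace (9 * / (433 * y ^ 9)) with (/ (433 / 9 * (y * y) * y ^ 7)).
    2:{ replace (y ^ 9) with (y * y * y ^ 7) by ring; field; lra. }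
    apply Rinv_le_contravar.
    + apply Rmult_lt_0_compat; [nra | exact Y7].
    + apply Rmult_le_compat_r; nra.
Qed.

Lemma turan_large (n : nat) : 8000 <= INR n ->
  4 * (1 + PI ^ 2 / (32 * INR n ^ 3)) * INR (cnt n n) * INR (cnt (n + 2) (n + 2)) >
  INR (cnt (n - 1) (n - 1)) * INR (cnt (n + 3) (n + 3)) + 3 * INR (cnt (n + 1) (n + 1)) ^ 2.
Proof.
  intros Hn1.
  destruct log_gf_modular as [c Hc].
  destruct alpha_exists as [al [Hal HA]].
  assert (Hn4 : (4000 <= n)%nat) by (apply INR_le; rewrite (INR_IZR_INZ 4000); apply Rle_trans with 8000; [simpl; lra | exact Hn1]).
  assert (RE := fun m => relative_error c al n m Hc Hal HA Hn1); cbv zeta in RE.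
  destruct (bessel_inequality (PI ^ 2 / 12) al n Hal HA ltac:(lia))
    as [u [v [E1 [E2 [Hu [Huv Hmain]]]]]].
  set (A := PI ^ 2 / 12) in *; set (y := sqrt (INR n)) in *; set (w := / y) in *.
  set (F := fun j : R => bessel A (INR n + 1 + / 24 + j)) in *.
  change (F 1 * F (-1) = F 0 ^ 2 * exp (- u)) in E1.
  change (F 2 * F (-2) = F 0 ^ 2 * exp (- v)) in E2.
  assert (HA0 : 0 < A) by (rewrite HA; apply pow_lt; lra).
  assert (HA1 : A < 1) by (rewrite HA; nra).
  assert (Hy2 : y * y = INR n) by (apply sqrt_sqrt; lra).
  assert (Hy0 : 0 <= y) by apply sqrt_pos.
  assert (Hy : 89 <= y) by nra.
  assert (Hw : 0 < w <= / 89).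
  { unfold w; split; [apply Rinv_0_lt_compat; lra | apply Rinv_le_contravar; lra]. }
  set (ka := exp (- c)) in *.
  assert (Hka : 0 < ka) by apply exp_pos.
  (* The errors in [q] cost at most [12 e + 10 e] below, against the margin [3 w^7 = 24 e] of
     [bessel_inequality]. *)
  set (e := w ^ 7 / 8) in *.
  assert (W7 : 0 < w ^ 7) by (apply pow_lt; lra).
  assert (W6 : 0 < w ^ 6 <= / 1000000).
  { split; [apply pow_lt; lra|].
    apply Rle_trans with ((/ 89) ^ 6); [apply pow_incr; lra | lra]. }
  assert (He : 0 < e <= / 1000).
  { unfold e; split; [lra|]. replace (w ^ 7) with (w * w ^ 6) by ring. nra. }
  assert (Bd : forall m j, (n - 1 <= m <= n + 3)%nat -> INR m + / 24 = INR n + 1 + / 24 + j ->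
     ka * F j * (1 - e) <= INR (cnt m m) <= ka * F j * (1 + e)).
  { intros m j Hm Hj; assert (H := RE m Hm); rewrite Hj in H.
    fold (F j) in H; apply Rabs_le_between in H; split; lra. }
  assert (B0 := Bd (n + 1)%nat 0 ltac:(lia) ltac:(rewrite plus_INR; simpl; ring)).
  assert (Bm1 := Bd n (-1) ltac:(lia) ltac:(ring)).
  assert (B1 := Bd (n + 2)%nat 1 ltac:(lia) ltac:(rewrite plus_INR; simpl; ring)).
  assert (Bm2 := Bd (n - 1)%nat (-2) ltac:(lia) ltac:(rewrite minus_INR by lia; simpl; ring)).
  assert (B2 := Bd (n + 3)%nat 2 ltac:(lia) ltac:(rewrite plus_INR; simpl; ring)).
  assert (FP : forall j, -2 <= j -> 0 < F j) by (intros j Hj; apply bessel_pos; lra).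
  assert (P0 := FP 0 ltac:(lra)); assert (P1 := FP 1 ltac:(lra)); assert (Pm1 := FP (-1) ltac:(lra)).
  assert (P2 := FP 2 ltac:(lra)); assert (Pm2 := FP (-2) ltac:(lra)).
  set (T := (ka * F 0) ^ 2).
  assert (HT : 0 < T) by (apply pow_lt, Rmult_lt_0_compat; lra).
  assert (Q1 : T * exp (- u) * (1 - e) ^ 2 <= INR (cnt n n) * INR (cnt (n + 2) (n + 2))).
  { replace (T * exp (- u) * (1 - e) ^ 2) with ((ka * F (-1) * (1 - e)) * (ka * F 1 * (1 - e))).
    - apply Rmult_le_compat; try lra; apply Rmult_le_pos; try lra; apply Rmult_le_pos; lra.
    - unfold T; transitivity (ka ^ 2 * (F 1 * F (-1)) * (1 - e) ^ 2); [ring|]; rewrite E1; ring. }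
  assert (Q2 : INR (cnt (n - 1) (n - 1)) * INR (cnt (n + 3) (n + 3)) <= T * exp (- v) * (1 + e) ^ 2).
  { replace (T * exp (- v) * (1 + e) ^ 2) with ((ka * F (-2) * (1 + e)) * (ka * F 2 * (1 + e))).
    - apply Rmult_le_compat; try lra; apply pos_INR.
    - unfold T; transitivity (ka ^ 2 * (F 2 * F (-2)) * (1 + e) ^ 2); [ring|]; rewrite E2; ring. }
  assert (Q0 : INR (cnt (n + 1) (n + 1)) ^ 2 <= T * (1 + e) ^ 2).
  { unfold T; rewrite <- Rpow_mult_distr; apply pow_incr; split; [apply pos_INR | lra]. }
  assert (Ev : exp (- v) <= exp (- 4 * u)) by (apply exp_le; lra).
  assert (Eu : 0 < exp (- u) <= 1).
  { split; [apply exp_pos | rewrite <- exp_0; apply exp_le; lra]. }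
  assert (E4u : 0 < exp (- 4 * u) <= 1).
  { split; [apply exp_pos | rewrite <- exp_0; apply exp_le; lra]. }
  assert (EB : 4 * (1 + PI ^ 2 / (32 * INR n ^ 3)) = 4 + 3 / 2 * A * w ^ 6).
  { rewrite <- Hy2; unfold A, w; field; lra. }
  rewrite EB.
  set (b := 3 / 2 * A * w ^ 6) in *.
  assert (Hb : 0 < b <= / 100) by (unfold b; split; [apply Rmult_lt_0_compat; lra | nra]).
  set (X := exp (- u)) in *; set (Z := exp (- 4 * u)) in *.
  assert (S1 : (1 - 2 * e) <= (1 - e) ^ 2) by nra.
  assert (S2 : (1 + e) ^ 2 <= 1 + 3 * e) by nra.
  apply Rlt_gt.
  apply Rle_lt_trans with (T * ((Z + 3) * (1 + 3 * e))).
  - assert (T * exp (- v) * (1 + e) ^ 2 <= T * (Z * (1 + 3 * e))).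
    { rewrite Rmult_assoc; apply Rmult_le_compat_l; [lra|].
      apply Rmult_le_compat; [left; apply exp_pos | apply pow2_ge_0 | lra | lra]. }
    assert (T * (1 + e) ^ 2 <= T * (1 + 3 * e)) by (apply Rmult_le_compat_l; lra).
    lra.
  - apply Rlt_le_trans with (T * ((4 + b) * (X * (1 - 2 * e)))).
    + apply Rmult_lt_compat_l; [exact HT|].
      assert (H8 : w ^ 7 = 8 * e) by (unfold e; field).
      assert ((4 + b) * (X * (1 - 2 * e)) = 4 * X + b * X - 2 * e * ((4 + b) * X)) by ring.
      assert ((4 + b) * X <= 5) by nra.
      assert (2 * e * ((4 + b) * X) <= 2 * e * 5) by (apply Rmult_le_compat_l; lra).
      assert ((Z + 3) * (1 + 3 * e) <= Z + 3 + 12 * e) by nra.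
      lra.
    + rewrite !(Rmult_assoc (4 + b)).
      replace (T * ((4 + b) * (X * (1 - 2 * e)))) with ((4 + b) * (T * X * (1 - 2 * e))) by ring.
      apply Rmult_le_compat_l; [lra|].
      eapply Rle_trans; [|exact Q1].
      apply Rmult_le_compat_l; [apply Rmult_le_pos; lra | exact S1].
Qed.

(** * Counting distinct partitions by the number of parts *)

(** Here [K] bounds the parts and [k] is their number. Splitting by [k] keeps the table small: below
    8128 only [k <= 126] occurs. *)
Fixpoint cnt_parts (K k n : nat) : nat :=
  match K with
  | O => if (Nat.eqb k 0 && Nat.eqb n 0)%bool then 1 else 0
  | S K' => cnt_parts K' k n +
      match k with
      | O => 0
      | S k' => if Nat.leb (S K') n then cnt_parts K' k' (n - S K') else 0
      end
  end%nat.

Fixpoint nsum (f : nat -> nat) (m : nat) : nat :=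
  match m with
  | O => 0
  | S m' => nsum f m' + f m'
  end%nat.

Lemma nsum_add (f g : nat -> nat) (m : nat) :
  nsum (fun k => f k + g k)%nat m = (nsum f m + nsum g m)%nat.
Proof. induction m as [|m IH]; simpl; [reflexivity | lia]. Qed.

Lemma nsum_ext (f g : nat -> nat) (m : nat) :
  (forall k, (k < m)%nat -> f k = g k) -> nsum f m = nsum g m.
Proof.
  induction m as [|m IH]; intros H; simpl; [reflexivity|].
  rewrite IH by (intros; apply H; lia); rewrite H by lia; reflexivity.
Qed.

Lemma nsum_S_l (f : nat -> nat) (m : nat) :
  nsum f (S m) = (f 0 + nsum (fun k => f (S k)) m)%nat.
Proof. induction m as [|m IH]; [simpl; lia|]. change (nsum f (S (S m))) with (nsum f (S m) + f (S m))%nat. rewrite IH; simpl; lia. Qed.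

Lemma nsum_extend (f : nat -> nat) (m p : nat) :
  (m <= p)%nat -> (forall k, (m <= k)%nat -> f k = 0%nat) -> nsum f p = nsum f m.
Proof.
  intros H Hf; induction H as [|p H IH]; [reflexivity|].
  simpl; rewrite IH, Hf by lia; lia.
Qed.

Lemma cnt_sum_parts (K M n : nat) : (K < M)%nat ->
  cnt K n = nsum (fun k => cnt_parts K k n) M.
Proof.
  revert M n; induction K as [|K IH]; intros M n H.
  - destruct M as [|M]; [lia|].
    rewrite (nsum_extend _ 1); [|lia|intros k Hk; destruct k; [lia | reflexivity]].
    simpl; now destruct n.
  - destruct M as [|M]; [lia|].
    change (cnt (S K) n) with (cnt K n + if Nat.leb (S K) n then cnt K (n - S K) else 0)%nat.
    rewrite (nsum_ext _ (fun k => cnt_parts K k n + match k with O => 0 | S k' =>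
        if Nat.leb (S K) n then cnt_parts K k' (n - S K) else 0 end)%nat) by reflexivity.
    rewrite nsum_add, <- IH by lia; f_equal.
    rewrite nsum_S_l.
    destruct (Nat.leb (S K) n); [apply IH; lia|].
    symmetry; apply (nsum_extend _ 0); [lia | reflexivity].
Qed.

(* Subtracting 1 from each of the [k + 1] parts. *)
Lemma cnt_parts_shift (K k n : nat) :
  cnt_parts (S K) (S k) n =
  (if Nat.leb (S k) n then cnt_parts K (S k) (n - S k) + cnt_parts K k (n - S k) else 0)%nat.
Proof.
  revert k n; induction K as [|K IH]; intros k n.
  - simpl; destruct n as [|n]; [reflexivity|].
    simpl; rewrite Nat.sub_0_r.
    destruct k; simpl; [now rewrite Nat.sub_0_r; destruct n|].
    destruct n; [reflexivity|]; now destruct (Nat.leb k n).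
  - change (cnt_parts (S (S K)) (S k) n) with (cnt_parts (S K) (S k) n +
      if Nat.leb (S (S K)) n then cnt_parts (S K) k (n - S (S K)) else 0)%nat.
    rewrite IH.
    change (cnt_parts (S K) (S k) (n - S k)) with (cnt_parts K (S k) (n - S k) +
      if Nat.leb (S K) (n - S k) then cnt_parts K k (n - S k - S K) else 0)%nat.
    destruct k as [|k].
    + replace (cnt_parts (S K) 0 (n - S (S K))) with (cnt_parts K 0 (n - S (S K))) by (simpl; lia).
      replace (cnt_parts (S K) 0 (n - 1)) with (cnt_parts K 0 (n - 1)) by (simpl; lia).
      destruct (Nat.leb_spec 1 n), (Nat.leb_spec (S (S K)) n), (Nat.leb_spec (S K) (n - 1)); try lia.
      replace (n - 1 - S K)%nat with (n - S (S K))%nat by lia; lia.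
    + rewrite IH.
      change (cnt_parts (S K) (S k) (n - S (S k))) with (cnt_parts K (S k) (n - S (S k)) +
        if Nat.leb (S K) (n - S (S k)) then cnt_parts K k (n - S (S k) - S K) else 0)%nat.
      destruct (Nat.leb_spec (S (S k)) n), (Nat.leb_spec (S (S K)) n),
        (Nat.leb_spec (S K) (n - S (S k))), (Nat.leb_spec (S k) (n - S (S K))); try lia.
      replace (n - S (S K) - S k)%nat with (n - S (S k) - S K)%nat by lia; lia.
Qed.

Lemma cnt_parts_stable (K k n : nat) : (n <= K)%nat -> cnt_parts K k n = cnt_parts n k n.
Proof.
  induction 1 as [|K H IH]; [reflexivity|].
  rewrite <- IH; simpl; destruct k as [|k]; [lia|].
  destruct n as [|n]; [lia|]; destruct (Nat.leb_spec K n); lia.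
Qed.

Definition parts (k n : nat) : nat := cnt_parts n k n.

(** * Geometric convolution *)

(* The coefficients of [x^(k+1) / (1 - x^(k+1)) * f]. *)
Fixpoint geometric_aux (fuel k : nat) (f : nat -> nat) (n : nat) : nat :=
  match fuel with
  | O => 0
  | S fuel' => if Nat.leb (S k) n then f (n - S k) + geometric_aux fuel' k f (n - S k) else 0
  end%nat.

Definition geometric (k : nat) (f : nat -> nat) (n : nat) : nat := geometric_aux (S n) k f n.

Lemma geometric_aux_fuel (p p' k n : nat) (f : nat -> nat) :
  (n < p)%nat -> (n < p')%nat -> geometric_aux p k f n = geometric_aux p' k f n.
Proof.
  revert p' n; induction p as [|p IH]; intros p' n H H'; [lia|].
  destruct p' as [|p']; [lia|]; simpl.
  destruct n as [|n]; [reflexivity|]; destruct (Nat.leb k n); [|reflexivity].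
  f_equal; apply IH; lia.
Qed.

Lemma geometric_eq (k n : nat) (f : nat -> nat) :
  geometric k f n = (if Nat.leb (S k) n then f (n - S k) + geometric k f (n - S k) else 0)%nat.
Proof.
  unfold geometric; change (geometric_aux (S n) k f n) with
    (if Nat.leb (S k) n then f (n - S k) + geometric_aux n k f (n - S k) else 0)%nat.
  destruct (Nat.leb_spec (S k) n); [|reflexivity].
  f_equal; apply geometric_aux_fuel; lia.
Qed.

(** The recursion lowers its argument and so determines the function. Identities between power
    series are checked through it, without a type of power series. *)
Lemma geometric_unique (k : nat) (f g : nat -> nat) :
  (forall n, g n = if Nat.leb (S k) n then f (n - S k) + g (n - S k) else 0)%nat ->
  g = geometric k f.
Proof.
  intros H; apply functional_extensionality; intros n.
  induction n as [n IH] using lt_wf_ind; rewrite H, geometric_eq.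
  destruct (Nat.leb_spec (S k) n); [|reflexivity].
  rewrite IH by lia; reflexivity.
Qed.

Lemma geometric_add (k : nat) (f g : nat -> nat) :
  geometric k (fun n => f n + g n)%nat = (fun n => geometric k f n + geometric k g n)%nat.
Proof.
  symmetry; apply geometric_unique; intros n; rewrite (geometric_eq k n f), (geometric_eq k n g).
  destruct (Nat.leb (S k) n); lia.
Qed.

(** The auxiliary [d'] is what the recursion in [i] prescribes for [d]. It satisfies the recursion
    in [j] that defines [d], so the two agree. *)
Lemma geometric_comm (i j : nat) (f : nat -> nat) :
  geometric i (geometric j f) = geometric j (geometric i f).
Proof.
  symmetry; apply geometric_unique; intros n; revert n.
  set (a := geometric i f); set (b := geometric j f); set (d := geometric j a).
  set (d' := fun n => if Nat.leb (S i) n then (b (n - S i) + d (n - S i))%nat else 0%nat).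
  assert (E : d' = d); [|intros n; change (d n = d' n); now rewrite E].
  apply geometric_unique; intros n; unfold d' at 1 2.
  destruct (Nat.leb_spec (S i) n).
  - unfold b, d; rewrite !(geometric_eq j (n - S i)); fold b d.
    destruct (Nat.leb_spec (S j) (n - S i)), (Nat.leb_spec (S j) n); try lia.
    + unfold a at 2; rewrite (geometric_eq i (n - S j)); fold a.
      destruct (Nat.leb_spec (S i) (n - S j)); [|lia].
      replace (n - S j - S i)%nat with (n - S i - S j)%nat by lia; lia.
    + unfold a; rewrite (geometric_eq i (n - S j)).
      destruct (Nat.leb_spec (S i) (n - S j)); lia.
  - destruct (Nat.leb_spec (S j) n); [|reflexivity].
    unfold a; rewrite (geometric_eq i (n - S j)).
    destruct (Nat.leb_spec (S i) (n - S j)); lia.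
Qed.

Lemma parts_geometric (k : nat) : parts (S k) = geometric k (parts k).
Proof.
  apply geometric_unique; intros n; unfold parts.
  destruct n as [|n]; [reflexivity|].
  rewrite cnt_parts_shift; destruct (Nat.leb_spec (S k) (S n)); [|reflexivity].
  rewrite !(cnt_parts_stable n) by lia; lia.
Qed.

Lemma parts_small (k n : nat) : (2 * n < k * (k + 1))%nat -> parts k n = 0%nat.
Proof.
  revert n; induction k as [|k IHk]; intros n; [lia|].
  induction n as [n IHn] using lt_wf_ind; intros H.
  rewrite parts_geometric, geometric_eq, <- parts_geometric.
  destruct (Nat.leb_spec (S k) n); [|reflexivity].
  rewrite IHk, IHn by nia; reflexivity.
Qed.

Definition delta (n : nat) : nat := if Nat.eqb n 0 then 1 else 0.

Fixpoint geometric_iter (k : nat) (f : nat -> nat) : nat -> nat :=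
  match k with
  | O => f
  | S k' => geometric_iter k' (geometric k' f)
  end.

Lemma geometric_iter_comm (i k : nat) (f : nat -> nat) :
  geometric i (geometric_iter k f) = geometric_iter k (geometric i f).
Proof.
  revert f; induction k as [|k IH]; intros f; [reflexivity|].
  simpl; now rewrite IH, geometric_comm.
Qed.

Lemma geometric_iter_add (k : nat) (f g : nat -> nat) :
  geometric_iter k (fun n => f n + g n)%nat =
  (fun n => geometric_iter k f n + geometric_iter k g n)%nat.
Proof.
  revert f g; induction k as [|k IH]; intros f g; [reflexivity|].
  simpl; now rewrite geometric_add, IH.
Qed.

Lemma geometric_iter_parts (k : nat) : geometric_iter k delta = parts k.
Proof.
  induction k as [|k IH].
  - apply functional_extensionality; intros n; unfold parts, delta; simpl.
    destruct n as [|n]; [reflexivity|].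
    assert (Z : forall K, cnt_parts K 0 (S n) = 0%nat) by (induction K as [|K IHK]; simpl; rewrite ?IHK; reflexivity).
    symmetry; apply Z.
  - simpl; rewrite <- geometric_iter_comm, IH, parts_geometric; reflexivity.
Qed.

(* Horner's scheme for [sum_k prod_(j <= k) x^j / (1 - x^j)]. *)
Fixpoint horner_sum (k : nat) (f : nat -> nat) : nat -> nat :=
  match k with
  | O => f
  | S k' => horner_sum k' (fun n => delta n + geometric k' f n)%nat
  end.

Lemma horner_sum_parts (k n : nat) (f : nat -> nat) :
  horner_sum k f n = (nsum (fun j => parts j n) k + geometric_iter k f n)%nat.
Proof.
  revert f; induction k as [|k IH]; intros f; [reflexivity|].
  simpl; rewrite IH, geometric_iter_add, geometric_iter_parts; lia.
Qed.

(** Starting from [delta], the iterated term supplies [parts k], so the numbers of parts 0 to [k]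
    are all summed; [k + 1] distinct parts would already exceed [n]. *)
Lemma horner_sum_cnt (k n : nat) : (2 * n < (k + 1) * (k + 2))%nat ->
  horner_sum k delta n = cnt n n.
Proof.
  intros H; rewrite horner_sum_parts, geometric_iter_parts.
  change (nsum (fun j => parts j n) (S k) = cnt n n).
  rewrite (cnt_sum_parts n (S (n + k)) n) by lia; symmetry.
  apply (nsum_extend (fun j => parts j n)); [lia|].
  intros j Hj; apply parts_small; nia.
Qed.

(** * Tabulation in binary arithmetic *)

(* [b] is the reversed tail of a queue with front [f]. *)
Fixpoint geometric_list (l f b : list N) : list N :=
  match l with
  | nil => nil
  | a :: l' =>
    match f with
    | h :: f' => let x := N.add a h in x :: geometric_list l' f' (x :: b)
    | nil =>
      match rev_append b nil with
      | h :: f' => let x := N.add a h in x :: geometric_list l' f' (x :: nil)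
      | nil => l
      end
    end
  end%list.

Fixpoint traversed (p : positive) : bool :=
  match p with
  | xH => true
  | xO p' => traversed p'
  | xI p' => traversed p'
  end.

(* Always [true]; it makes call-by-need evaluation compute the entries of the list. *)
Fixpoint forced (l : list N) : bool :=
  match l with
  | nil => true
  | N0 :: l' => forced l'
  | Npos p :: l' => if traversed p then forced l' else false
  end%list.

(** Division by [1 - x^k] keeps the length and multiplication by [x^k] prepends [k] entries, the
    first of which carries [delta]. The list thus gains [k] exact coefficients per step and can
    start short. *)
Fixpoint horner_list (k : nat) (t : list N) : list N :=
  match k with
  | O => t
  | S k' =>
    let t' := (1%N :: repeat 0%N k' ++ geometric_list t (repeat 0%N k) nil)%list in
    if forced t' then horner_list k' t' else nil
  end.

(** The queue keeps a constant length, so every output adds the output that many places earlier, the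
    initial queue standing for those before the start. *)
Lemma geometric_list_spec (l f b : list N) : (0 < length f + length b)%nat ->
  length (geometric_list l f b) = length l /\
  forall i, (i < length l)%nat -> nth i (geometric_list l f b) 0%N =
    (nth i l 0 + nth i (f ++ rev b ++ geometric_list l f b) 0)%N.
Proof.
  revert f b; induction l as [|a l IH]; intros f b Hfb; [simpl; split; [reflexivity | lia]|].
  destruct f as [|h f].
  - simpl geometric_list; rewrite <- rev_alt.
    assert (Hb : length (rev b) = length b) by apply length_rev.
    destruct (rev b) as [|h f]; [simpl in *; lia|].
    destruct (IH f ((a + h)%N :: nil)%list ltac:(simpl; lia)) as [E H].
    split; [simpl; now rewrite E|].
    intros [|i] Hi; [reflexivity|].
    simpl in Hi |- *; rewrite H by lia; reflexivity.
  - simpl geometric_list.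
    destruct (IH f ((a + h)%N :: b)%list ltac:(simpl; lia)) as [E H].
    split; [simpl; now rewrite E|].
    intros [|i] Hi; [reflexivity|].
    simpl in Hi |- *; rewrite H by lia; simpl; rewrite <- app_assoc; reflexivity.
Qed.

Lemma traversed_true (p : positive) : traversed p = true.
Proof. induction p; auto. Qed.

Lemma forced_true (l : list N) : forced l = true.
Proof. induction l as [|[|p] l IH]; simpl; rewrite ?traversed_true; auto. Qed.

Definition represents (l : list N) (f : nat -> nat) : Prop :=
  forall i, (i < length l)%nat -> nth i l 0%N = N.of_nat (f i).

Lemma represents_geometric (k : nat) (t : list N) (f : nat -> nat) : represents t f ->
  represents (1%N :: repeat 0%N k ++ geometric_list t (repeat 0%N (S k)) nil)%list
    (fun n => delta n + geometric k f n)%nat.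
Proof.
  intros H.
  destruct (geometric_list_spec t (repeat 0%N (S k)) nil ltac:(simpl; lia)) as [E G].
  set (o := geometric_list t (repeat 0%N (S k)) nil) in *.
  assert (Ho : forall i, (i < length t)%nat -> nth i o 0%N = N.of_nat (geometric k f (i + S k))).
  { intros i; induction i as [i IH] using lt_wf_ind; intros Hi.
    rewrite G, H, geometric_eq by lia.
    destruct (Nat.leb_spec (S k) (i + S k)); [|lia].
    replace (i + S k - S k)%nat with i by lia; rewrite Nat2N.inj_add; f_equal.
    simpl rev; simpl app at 2.
    destruct (Nat.lt_ge_cases i (S k)).
    - rewrite app_nth1 by (rewrite repeat_length; lia).
      rewrite nth_repeat, geometric_eq; destruct (Nat.leb_spec (S k) i); [lia | reflexivity].
    - rewrite app_nth2 by (rewrite repeat_length; lia); rewrite repeat_length, IH by lia.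
      do 2 f_equal; lia. }
  intros [|i] Hi.
  - unfold delta; rewrite geometric_eq; reflexivity.
  - simpl nth; simpl length in Hi; rewrite length_app, repeat_length, E in Hi.
    unfold delta; simpl Nat.eqb; simpl plus.
    destruct (Nat.lt_ge_cases i k).
    + rewrite app_nth1 by (rewrite repeat_length; lia).
      rewrite nth_repeat, geometric_eq; destruct (Nat.leb_spec (S k) (S i)); [lia | reflexivity].
    + rewrite app_nth2 by (rewrite repeat_length; lia); rewrite repeat_length, Ho by lia.
      replace (i - k + S k)%nat with (S i) by lia; reflexivity.
Qed.

Lemma horner_list_spec (k : nat) (t : list N) (f : nat -> nat) : represents t f ->
  (2 * length (horner_list k t) = k * (k + 1) + 2 * length t)%nat /\
  represents (horner_list k t) (horner_sum k f).
Proof.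
  revert t f; induction k as [|k IH]; intros t f H; [split; [simpl; lia | exact H]|].
  simpl horner_list; rewrite forced_true; simpl horner_sum.
  destruct (IH _ _ (represents_geometric k t f H)) as [E R].
  split; [|exact R].
  destruct (geometric_list_spec t (repeat 0%N (S k)) nil ltac:(simpl; lia)) as [L _].
  change (0%N :: repeat 0%N k)%list with (repeat 0%N (S k)).
  assert (LL : length (1%N :: repeat 0%N k ++ geometric_list t (repeat 0%N (S k)) nil) = (S k + length t)%nat)
    by (cbn [length]; rewrite length_app, L, repeat_length; lia).
  rewrite E, LL; nia.
Qed.

Fixpoint shift_down_pos (s : nat) (p : positive) : N :=
  match s with
  | O => Npos p
  | S s' =>
    match p with
    | xH => 0
    | xO p' => shift_down_pos s' p'
    | xI p' => shift_down_pos s' p'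
    end
  end%N.

Definition shift_down (s : nat) (a : N) : N :=
  match a with
  | N0 => 0%N
  | Npos p => shift_down_pos s p
  end.

(** An upper rounding; for [s = 0] nothing is cut off and the value stays exact. *)
Definition shift_up (s : nat) (a : N) : N :=
  match s with
  | O => a
  | _ => N.succ (shift_down s a)
  end.

(* Numbers are truncated to 56 bits before they are multiplied; 986 comes from [9.86 < PI ^ 2]. *)
Definition turan_test (n a b c d e : N) : bool :=
  (let s := (N.size_nat b - 56)%nat in
   let bd := shift_down s b * shift_down s d in
   let c' := shift_up s c in
   let g := shift_up s a * shift_up s e + 3 * (c' * c') - 4 * bd in
   800 * (n * n * n) * g <? 986 * bd)%N.

Fixpoint turan_check (n : N) (l : list N) : bool :=
  match l with
  | nil => true
  | a :: l' =>
    match l' with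
    | b :: c :: d :: e :: _ =>
      if turan_test n a b c d e then turan_check (N.succ n) l' else false
    | _ => true
    end
  end%list.

Lemma shift_down_spec (s : nat) (a : N) :
  (shift_down s a * 2 ^ N.of_nat s <= a < N.succ (shift_down s a) * 2 ^ N.of_nat s)%N.
Proof.
  destruct a as [|p].
  { simpl shift_down; assert (H := N.pow_nonzero 2 (N.of_nat s)); lia. }
  unfold shift_down; revert p; induction s as [|s IH]; intros p.
  - simpl shift_down_pos; change (2 ^ N.of_nat 0)%N with 1%N; lia.
  - rewrite Nat2N.inj_succ, N.pow_succ_r'; simpl shift_down_pos.
    set (P := (2 ^ N.of_nat s)%N) in *.
    destruct p as [p|p|].
    + specialize (IH p); replace (Npos (xI p)) with (2 * Npos p + 1)%N by reflexivity; nia.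
    + specialize (IH p); replace (Npos (xO p)) with (2 * Npos p)%N by reflexivity; nia.
    + assert (H := N.pow_nonzero 2 (N.of_nat s)); fold P in H; lia.
Qed.

Lemma shift_up_spec (s : nat) (a : N) : (a <= shift_up s a * 2 ^ N.of_nat s)%N.
Proof.
  destruct s as [|s]; [simpl shift_up; change (2 ^ N.of_nat 0)%N with 1%N; lia|].
  assert (H := shift_down_spec (S s) a); unfold shift_up; lia.
Qed.

(** All five numbers are cut by the same [s]; factors of the smaller side are rounded up and those
    of the larger side down, so success carries over to the full numbers. *)
Lemma turan_test_sound (n a b c d e : N) : turan_test n a b c d e = true ->
  (800 * (n * n * n) * (a * e + 3 * (c * c)) < (3200 * (n * n * n) + 986) * (b * d))%N.
Proof.
  unfold turan_test; set (s := (N.size_nat b - 56)%nat).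
  assert (Hb := proj1 (shift_down_spec s b)); assert (Hd := proj1 (shift_down_spec s d)).
  assert (Ha := shift_up_spec s a); assert (Hc := shift_up_spec s c); assert (He := shift_up_spec s e).
  assert (HP : (0 < 2 ^ N.of_nat s)%N) by (assert (H := N.pow_nonzero 2 (N.of_nat s)); lia).
  set (P := (2 ^ N.of_nat s)%N) in *.
  set (b' := shift_down s b) in *; set (d' := shift_down s d) in *.
  set (a' := shift_up s a) in *; set (c' := shift_up s c) in *; set (e' := shift_up s e) in *.
  cbv zeta; rewrite N.ltb_lt; intros H.
  set (m := (n * n * n)%N) in *.
  set (G := (a' * e' + 3 * (c' * c'))%N) in *.
  assert (H1 : (800 * m * G < (3200 * m + 986) * (b' * d'))%N).
  (* Subtraction in [N] is truncated at 0, so the case of a nonpositive difference is treated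
     apart. *)
  { destruct (N.le_gt_cases G (4 * (b' * d'))) as [L|L].
    - assert (800 * m * G <= 800 * m * (4 * (b' * d')))%N by (apply N.mul_le_mono_l; exact L). lia.
    - assert (800 * m * (G - 4 * (b' * d')) + 800 * m * (4 * (b' * d')) = 800 * m * G)%N
        by (rewrite <- N.mul_add_distr_l; f_equal; lia).
      lia. }
  assert (Q1 : (a * e <= a' * e' * (P * P))%N)
    by (transitivity ((a' * P) * (e' * P))%N; [now apply N.mul_le_mono | lia]).
  assert (Q2 : (c * c <= c' * c' * (P * P))%N)
    by (transitivity ((c' * P) * (c' * P))%N; [now apply N.mul_le_mono | lia]).
  assert (Q3 : (b' * d' * (P * P) <= b * d)%N)
    by (transitivity ((b' * P) * (d' * P))%N; [lia | now apply N.mul_le_mono]).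
  apply N.le_lt_trans with (800 * m * (G * (P * P)))%N.
  { apply N.mul_le_mono_l; unfold G; lia. }
  apply N.lt_le_trans with ((3200 * m + 986) * (b' * d' * (P * P)))%N; [|now apply N.mul_le_mono_l].
  replace (800 * m * (G * (P * P)))%N with (800 * m * G * (P * P))%N by ring.
  replace ((3200 * m + 986) * (b' * d' * (P * P)))%N with ((3200 * m + 986) * (b' * d') * (P * P))%N by ring.
  apply N.mul_lt_mono_pos_r; [apply N.mul_pos_pos; exact HP | exact H1].
Qed.

Lemma turan_check_sound (l : list N) (m : N) (i : nat) :
  turan_check m l = true -> (i + 4 < length l)%nat ->
  turan_test (m + N.of_nat i) (nth i l 0%N) (nth (i + 1) l 0%N) (nth (i + 2) l 0%N)
    (nth (i + 3) l 0%N) (nth (i + 4) l 0%N) = true.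
Proof.
  revert m i; induction l as [|a l IH]; intros m i H Hi; [simpl in Hi; lia|].
  destruct l as [|b [|c [|d [|e l]]]]; try (simpl in Hi; lia).
  change (turan_check m (a :: b :: c :: d :: e :: l)) with
    (if turan_test m a b c d e then turan_check (N.succ m) (b :: c :: d :: e :: l) else false) in H.
  destruct (turan_test m a b c d e) eqn:T; [|discriminate].
  destruct i as [|i]; [rewrite N.add_0_r; exact T|].
  specialize (IH (N.succ m) i H ltac:(simpl in *; lia)).
  replace (m + N.of_nat (S i))%N with (N.succ m + N.of_nat i)%N by lia.
  exact IH.
Qed.

(** Dropping 278 entries puts the index [n - 1] of the first case in front. The 126 steps lengthen
    the list from 11 to [11 + 126 * 127 / 2 = 8012] entries, all exact because 127 distinct parts
    sum to at least 8128. *)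
Lemma turan_table :
  turan_check 279 (skipn 278 (horner_list 126 (1%N :: repeat 0%N 10))) = true.
Proof. vm_cast_no_check (eq_refl true). Qed.

Lemma turan_small (n : nat) : (279 <= n)%nat -> INR n < 8000 ->
  4 * (1 + PI ^ 2 / (32 * INR n ^ 3)) * INR (cnt n n) * INR (cnt (n + 2) (n + 2)) >
  INR (cnt (n - 1) (n - 1)) * INR (cnt (n + 3) (n + 3)) + 3 * INR (cnt (n + 1) (n + 1)) ^ 2.
Proof.
  intros Hn HnR.
  assert (HZ : (Z.of_nat n < 8000)%Z) by (apply lt_IZR; rewrite <- INR_IZR_INZ; exact HnR).
  destruct (horner_list_spec 126 (1%N :: repeat 0%N 10) delta) as [L R].
  { intros i Hi; do 11 (destruct i as [|i]; [reflexivity|]); simpl in Hi; lia. }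
  assert (C := turan_check_sound _ _ (n - 279) turan_table).
  set (l := horner_list 126 (1%N :: repeat 0%N 10)) in *.
  change (length (1%N :: repeat 0%N 10)) with 11%nat in L.
  rewrite length_skipn in C; specialize (C ltac:(lia)); rewrite !nth_skipn in C.
  replace (279 + N.of_nat (n - 279))%N with (N.of_nat n) in C by lia.
  assert (V : forall m, (m <= n + 3)%nat -> nth m l 0%N = N.of_nat (cnt m m)).
  { intros m Hm; rewrite R by lia; rewrite horner_sum_cnt by lia; reflexivity. }
  replace (278 + (n - 279))%nat with (n - 1)%nat in C by lia.
  replace (278 + (n - 279 + 1))%nat with n in C by lia.
  replace (278 + (n - 279 + 2))%nat with (n + 1)%nat in C by lia.
  replace (278 + (n - 279 + 3))%nat with (n + 2)%nat in C by lia.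
  replace (278 + (n - 279 + 4))%nat with (n + 3)%nat in C by lia.
  rewrite !V in C by lia.
  apply turan_test_sound in C.
  clear - C Hn.
  set (a := cnt (n - 1) (n - 1)) in *; set (b := cnt n n) in *; set (c := cnt (n + 1) (n + 1)) in *.
  set (d := cnt (n + 2) (n + 2)) in *; set (e := cnt (n + 3) (n + 3)) in *.
  assert (Z1 : (800 * (Z.of_nat n * Z.of_nat n * Z.of_nat n) *
      (Z.of_nat a * Z.of_nat e + 3 * (Z.of_nat c * Z.of_nat c)) <
      (3200 * (Z.of_nat n * Z.of_nat n * Z.of_nat n) + 986) * (Z.of_nat b * Z.of_nat d))%Z) by lia.
  apply IZR_lt in Z1; rewrite ?mult_IZR, ?plus_IZR, ?mult_IZR, <- ?INR_IZR_INZ in Z1.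
  assert (X : 279 <= INR n) by (rewrite INR_IZR_INZ; apply IZR_le; lia).
  assert (BD : 0 <= INR b * INR d) by (apply Rmult_le_pos; apply pos_INR).
  set (x := INR n) in *; set (BDv := INR b * INR d) in *.
  assert (X3 : 0 < x ^ 3) by (apply pow_lt; lra).
  assert (HPI : 986 / 100 <= PI ^ 2) by (assert (H := PI_bounds); nra).
  apply Rlt_gt.
  apply Rlt_le_trans with ((4 + 986 / (800 * x ^ 3)) * BDv).
  - apply Rmult_lt_reg_l with (800 * x ^ 3); [lra|].
    replace (800 * x ^ 3 * ((4 + 986 / (800 * x ^ 3)) * BDv)) with ((3200 * x ^ 3 + 986) * BDv) by (field; lra).
    replace (x ^ 3) with (x * x * x) by ring; nra.
  - rewrite (Rmult_assoc _ (INR b)); fold BDv; apply Rmult_le_compat_r; [exact BD|].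
    replace (986 / (800 * x ^ 3)) with (986 / 100 * (/ (8 * x ^ 3))) by (field; lra).
    replace (4 * (1 + PI ^ 2 / (32 * x ^ 3))) with (4 + PI ^ 2 * (/ (8 * x ^ 3))) by (field; lra).
    apply Rplus_le_compat_l, Rmult_le_compat_r; [left; apply Rinv_0_lt_compat; lra | exact HPI].
Qed.

(** * Partitions as sets *)

Section DistinctPartitions.

Import all_boot.
Local Open Scope nat_scope.

(** The ambient type ['I_N.+1] stays fixed while the bound [K] on the parts varies, as the induction
    on [K] requires. *)
Definition bounded_partitions (N K n : nat) : {set {set 'I_N.+1}} :=
  [set A : {set 'I_N.+1} | (A \subset [set i : 'I_N.+1 | 0 < i <= K]) && (\sum_(i in A) i == n)].

(** The recursion of [cnt] on sets: those without the element [x = K + 1], and those of the form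
    [x |: A], where adding [x] is injective because [x] exceeds every element of [A]. *)
Lemma card_bounded_partitions (N K n : nat) : K <= N -> #|bounded_partitions N K n| = cnt K n.
Proof.
elim: K n => [|K IH] n leKN.
  have -> : bounded_partitions N 0 n = if n == 0 then [set set0] else set0.
    apply/setP => A; rewrite inE.
    have -> : [set i : 'I_N.+1 | 0 < i <= 0] = set0.
      by apply/setP => i; rewrite !inE; case: (val i).
    rewrite subset0; case: (altP (A =P set0)) => [->|nA] /=.
      by rewrite big_set0 eq_sym; case: ifP => _; rewrite !inE ?eqxx.
    by case: ifP => _; rewrite !inE ?(negbTE nA).
  by case: n => [|n]; rewrite ?cards1 ?cards0.
pose x : 'I_N.+1 := inord K.+1.
have vx : x = K.+1 :> nat by rewrite inordK.
have sB (A : {set 'I_N.+1}) : x \notin A ->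
    (A \subset [set i : 'I_N.+1 | 0 < i <= K.+1]) = (A \subset [set i : 'I_N.+1 | 0 < i <= K]).
  move=> nxA; apply/subsetP/subsetP => sA i iA; move: (sA i iA); rewrite !inE.
    case/andP=> -> /=; rewrite leq_eqVlt ltnS => /orP [/eqP ei|//].
    by move: iA; rewrite (_ : i = x) ?(negbTE nxA) //; apply/val_inj; rewrite /= vx.
  by case/andP=> -> /leqW.
rewrite -(cardsID [set A : {set 'I_N.+1} | x \in A]) addnC.
have -> : bounded_partitions N K.+1 n :\: [set A : {set 'I_N.+1} | x \in A] = bounded_partitions N K n.
  apply/setP => A; rewrite !inE; case: (boolP (x \in A)) => xA /=; last by rewrite sB.
  apply/esym/negbTE; rewrite negb_and; apply/orP; left; apply/negP => /subsetP /(_ _ xA).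
  by rewrite inE vx ltnn andbF.
rewrite IH ?(ltnW leKN) //=; congr (_ + _).
have -> : bounded_partitions N K.+1 n :&: [set A : {set 'I_N.+1} | x \in A] =
    if K.+1 <= n then [set x |: A | A in bounded_partitions N K (n - K.+1)] else set0.
  apply/setP => A; apply/idP/idP.
    rewrite !inE => /andP [/andP [sA /eqP sumA] xA].
    move: sumA; rewrite (big_setD1 x xA) /= vx => sumA.
    rewrite -{1}sumA leq_addr.
    apply/imsetP; exists (A :\ x); last by rewrite setD1K.
    rewrite inE -sB ?setD11 // (subset_trans _ sA) ?subD1set //=.
    by rewrite -sumA addKn.
  case: ifP => [leKn|_]; last by rewrite inE.
  case/imsetP => B; rewrite !inE => /andP [sB' /eqP sumB] ->.
  have nxB : x \notin B.
    by apply/negP => /(subsetP sB'); rewrite inE vx ltnn andbF.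
  rewrite setU11 andbT subUset sub1set inE vx /= leqnn sB // sB' /=.
  by rewrite big_setU1 //= sumB vx subnKC.
have lebE : PeanoNat.Nat.leb K.+1 n = (K.+1 <= n).
  by apply/idP/idP => [/PeanoNat.Nat.leb_le /leP|/leP /PeanoNat.Nat.leb_le].
case: ifP => leKn; last first.
  by rewrite cards0; move: lebE; rewrite leKn /= => ->.
move: lebE; rewrite leKn /= => ->.
rewrite card_in_imset ?IH ?(ltnW leKN) //.
move=> A B; rewrite !inE => /andP [sA _] /andP [sB' _] eAB.
have nx (C : {set 'I_N.+1}) : C \subset [set i : 'I_N.+1 | 0 < i <= K] -> x \notin C.
  by move=> sC; apply/negP => /(subsetP sC); rewrite inE vx ltnn andbF.
by rewrite -(setU1K (nx _ sA)) eAB setU1K ?nx.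
Qed.

Lemma q_cnt (n : nat) : q n = cnt n n.
Proof.
rewrite -(@card_bounded_partitions n n n) //; congr (#|pred_of_set _|).
apply/setP => A; rewrite !inE; congr (_ && _).
apply/idP/subsetP => [n0 i iA | sA].
  rewrite inE (leq_ord i) andbT lt0n; apply: contra n0 => /eqP i0.
  by rewrite (_ : ord0 = i) //; apply/val_inj; rewrite /= i0.
by apply/negP => /sA; rewrite inE.
Qed.

End DistinctPartitions.

Theorem theorem1p3 (n : nat) (hn : (279 <= n)%nat) :
  4 * (1 + PI ^ 2 / (32 * INR n ^ 3)) * INR (q n) * INR (q (n + 2)) >
  INR (q (n - 1)) * INR (q (n + 3)) + 3 * INR (q (n + 1)) ^ 2.
Proof.
  rewrite !q_cnt.
  destruct (Rle_lt_dec 8000 (INR n)); [now apply turan_large | now apply turan_small].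
Qed.
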